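(* Let $N\ge0$, $1\le l\le k$, $a,b\ge0$ be integers with $a+b\le l$. Then $$\sum_{\mathbf a\in C^{(k,l)}_{a,b}[N]}q^{\sum_i ia_i}=\begin{cases}\chi^{(k,l)}_{a,b}[N]-\chi^{(k,l)}_{a-1,b+2}[N]-\chi^{(k,l)}_{a,b-1}[N]+\chi^{(k,l)}_{a-1,b+1}[N]&\text{if }b>0,\\ \chi^{(k,l)}_{a,0}[N]-\chi^{(k,l)}_{a-1,2}[N]&\text{if }b=0,\end{cases}$$ where, for integers $a,b\ge0$ with $a+b\le k$, $$\chi^{(k,l)}_{a,b}[N]=\sum_{\substack{m_1,\dots,m_k\ge0\\ m_{l+1}=\dots=m_k=0}}q^{Q(\mathbf m)+\sum_{i=1}^kr_im_i}\prod_{\substack{1\le j\le k\\ m_j\ne0}}\begin{bmatrix}jN-\sum_{i=1}^kA_{j,i}m_i+A_{j,j}-r_j+m_j\\ m_j\end{bmatrix},$$ with $$Q(\mathbf m)=\frac12\sum_{i,j=1}^kA_{i,j}m_im_j-\frac12\sum_{j=1}^kA_{j,j}m_j,\qquad \mathbf m=(m_1,\dots,m_k),$$ $$(r_1,\dots,r_k)=(\underbrace{0,\dots,0}_a,\underbrace{1,2,\dots,b}_b,\underbrace{b+2,b+4,\dots,2k-2a-b}_{k-a-b}).$$ Here one understands $\chi^{(k,l)}_{a-1,b+2}[N]=\chi^{(k,l)}_{a-1,k-a+1}[N]$ if $a+b=k$, and $\chi^{(k,l)}_{a,b}[N]=0$ if $a=-1$.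
   Context: $A_{j,i}=2\min(j,i)+\max(j+i-k,0)$. The $q$-binomial coefficient is $\begin{bmatrix} m \\ n \end{bmatrix}=\prod_{i=1}^n\frac{1-q^{m-n+i}}{1-q^i}$ if $0\le n\le m$, and $0$ otherwise. $C^{(k,l)}_{a,b}[N]$ is the set of sequences $\mathbf a=(a_i)_{i\in\mathbb Z}$ of non-negative integers such that: $a_i=0$ for $i<0$ and for $i>N$; $a_0=a$ and $a_1=b$; and for all $i\in\mathbb Z$: $a_i+a_{i+1}+a_{i+2}\le k$, $a_i+a_{i+1}\le l$, and $a_{i-1}+2a_i+2a_{i+1}+a_{i+2}\le k+l$. *)

(* Defs.v *)
From HB Require Import structures.
From mathcomp Require Import all_boot all_order all_algebra.
From mathcomp Require Import all_classical.
From mathcomp Require Import zify.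

Set Implicit Arguments.
Unset Strict Implicit.
Unset Printing Implicit Defensive.

Import Order.TTheory GRing.Theory Num.Theory.

Local Open Scope classical_set_scope.
Local Open Scope ring_scope.

(* The generating functions live in the field of rational functions Q(q), seen
   as the fraction field of Z[q]. *)
Definition ratfun : fieldType := {fraction {poly int}}.

Definition q : ratfun := tofrac ('X : {poly int}).

(* The upper entry is an arbitrary, possibly negative, integer. *)
Definition qbinom (m : int) (n : nat) : ratfun :=
  if n%:Z <= m then
    \prod_(1 <= i < n.+1) ((1 - q ^ (m - n%:Z + i%:Z)) / (1 - q ^ i%:Z))
  else 0.

Definition A (k j i : nat) : nat := (2 * minn j i + (j + i - k))%N.

(* A vector (m_1, ..., m_k) is a function m on 'I_k, with m_j = m (j - 1). *)
Definition Q (k : nat) (m : {ffun 'I_k -> nat}) : int :=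
  ((\sum_(i < k) \sum_(j < k) (A k i.+1 j.+1 * m i * m j)%N%:Z
    - \sum_(j < k) (A k j.+1 j.+1 * m j)%N%:Z) %/ 2)%Z.

(* (r_1, ..., r_k); it has length k when a + b <= k. *)
Definition rseq (k a b : nat) : seq nat :=
  nseq a 0%N ++ iota 1 b ++ [seq (b + 2 * t)%N | t <- iota 1 (k - a - b)].

Definition r (k a b i : nat) : nat := nth 0%N (rseq k a b) i.-1.

Definition chi_top (k N a b : nat) (m : {ffun 'I_k -> nat}) (j : 'I_k) : int :=
  (j.+1 * N)%N%:Z - \sum_(i < k) (A k j.+1 i.+1 * m i)%N%:Z
  + (A k j.+1 j.+1)%:Z - (r k a b j.+1)%:Z + (m j)%:Z.

Definition chi_term (k N a b : nat) (m : {ffun 'I_k -> nat}) : ratfun :=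
  q ^ (Q m + (\sum_(i < k) r k a b i.+1 * m i)%N%:Z)
  * \prod_(j < k | m j != 0%N) qbinom (chi_top N a b m j) (m j).

Definition supp_le (k l : nat) : set {ffun 'I_k -> nat} :=
  [set m | forall i : 'I_k, (l < i.+1)%N -> m i = 0%N].

(* Used for a + b <= k only. *)
Definition chi (k l N a b : nat) : ratfun :=
  \sum_(m \in @supp_le k l) chi_term N a b m.

(* chi for a >= -1 and a + b <= k + 1, with the boundary conventions
   chi_{-1,b} = 0 and chi_{a,b} = chi_{a,k-a} when a + b = k + 1. *)
Definition chi_ext (k l N : nat) (a : int) (b : nat) : ratfun :=
  match a with
  | Posz a' => if (a' + b == k.+1)%N then chi k l N a' (k - a')
               else chi k l N a' b
  | Negz _ => 0
  end.

Definition admissible (k l a b N : nat) : set (int -> nat) :=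
  [set c | [/\ forall i : int, (i < 0) || (N%:Z < i) -> c i = 0%N,
               c 0 = a,
               c 1 = b
             & forall i : int,
                 [/\ (c i + c (i + 1)%R + c (i + 2)%R <= k)%N,
                     (c i + c (i + 1)%R <= l)%N
                   & (c (i - 1)%R + 2 * c i + 2 * c (i + 1)%R + c (i + 2)%R
                      <= k + l)%N] ] ].

Definition weight (c : int -> nat) : int :=
  \sum_(i \in [set: int]) (i * (c i)%:Z).

(* The division by 2 in Q is exact. *)
Lemma Q_double (k : nat) (m : {ffun 'I_k -> nat}) :
  2 * Q m = \sum_(i < k) \sum_(j < k) (A k i.+1 j.+1 * m i * m j)%N%:Z
            - \sum_(j < k) (A k j.+1 j.+1 * m j)%N%:Z.
Proof.
have AC i j : A k i j = A k j i by rewrite /A; lia.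
rewrite /Q mulrC divzK //.
pose a (i j : 'I_k) : int := (A k i.+1 j.+1 * m i * m j)%N%:Z.
have aC i j : a i j = a j i by rewrite /a AC; congr Posz; lia.
have half : \sum_i \sum_j a i j =
    \sum_i a i i + 2 * \sum_(i < k) \sum_(j < k | (i < j)%N) a i j.
  have split3 i : \sum_j a i j = a i i + (\sum_(j < k | (i < j)%N) a i j
                    + \sum_(j < k | (j < i)%N) a i j).
    rewrite (bigD1 i) //=; congr (_ + _).
    rewrite (bigID (fun j : 'I_k => (i < j)%N)) /=; congr (_ + _).
      by apply: eq_bigl => j; rewrite -val_eqE /=; lia.
    by apply: eq_bigl => j; rewrite -val_eqE /=; lia.
  rewrite (eq_bigr _ (fun i _ => split3 i)) big_split big_split /=.
  congr (_ + _); rewrite mulr_natl mulr2n; congr (_ + _).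
  rewrite (exchange_big_dep xpredT) //=.
  by apply: eq_bigr => j _; apply: eq_bigr => i _.
rewrite half addrAC -sumrB rpredD ?dvdz_mulr ?rpred_sum // => i _.
rewrite /a /A.
have [t ht] : exists t : nat, (m i * m i = m i + 2 * t)%N.
  by exists 'C(m i, 2); elim: (m i) => [|n IH] //; rewrite binS bin1; nia.
rewrite -mulnA ht mulnDr PoszD addrC addKr mulnCA.
by rewrite PoszM dvdz_mulr.
Qed.

(* The sums indexed by sets above are finitely supported sums, which are 0 by
   convention over an infinite support; the next three lemmas show that all the
   supports are finite. *)
Lemma chi_finite_support (k l N a b : nat) :
  finite_set (@supp_le k l `&` (fun m => chi_term N a b m) @^-1` [set~ 0]).
Proof.
pose B : set {ffun 'I_k -> nat} := [set m | forall j, (m j < N.+2)%N].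
pose h (f : {ffun 'I_k -> 'I_N.+2}) : {ffun 'I_k -> nat} :=
  [ffun i => f i : nat].
apply: (@sub_finite_set _ _ (h @` [set: {ffun 'I_k -> 'I_N.+2}])); last first.
  exact/finite_image/finite_finset.
move=> m [_ /= nz].
have Bm : B m.
  move=> j; rewrite ltnNge; apply/negP => mj; apply: nz.
  have mj0 : m j != 0%N by lia.
  rewrite /chi_term [X in _ * X](bigD1 j) //= /qbinom ifF ?mul0r ?mulr0 //.
  apply/negbTE; rewrite -ltNge /chi_top (bigD1 j) //=.
  set s := \sum_(i < k | _) _.
  have s0 : 0 <= s by apply: sumr_ge0.
  have : (j.+1 * N + A k j.+1 j.+1 < A k j.+1 j.+1 * m j)%N.
    by rewrite /A; nia.
  by lia.
exists [ffun j => Ordinal (Bm j)] => //.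
by apply/ffunP => j; rewrite !ffunE.
Qed.

Lemma weight_finite_support (k l a b N : nat) (c : int -> nat) :
  admissible k l a b N c ->
  finite_set ([set: int] `&` (fun i : int => i * (c i)%:Z) @^-1` [set~ 0]).
Proof.
move=> [c0 _ _ _].
apply: (@sub_finite_set _ _ ((fun n : nat => n%:Z) @` `I_N.+1)); last first.
  exact/finite_image/finite_II.
move=> i [_ /= nz]; exists `|i|%N => /=.
- by case: (boolP ((i < 0) || (N%:Z < i))) => [/c0 ci|];
    [case: nz; rewrite ci mulr0 | lia].
- by case: (boolP ((i < 0) || (N%:Z < i))) => [/c0 ci|];
    [case: nz; rewrite ci mulr0 | lia].
Qed.

Lemma admissible_finite (k l a b N : nat) : finite_set (admissible k l a b N).
Proof.
pose h (f : {ffun 'I_N.+1 -> 'I_l.+1}) : int -> nat :=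
  fun i => if i is Posz n then (if (n <= N)%N then f (inord n) : nat else 0%N)
           else 0%N.
apply: (@sub_finite_set _ _ (h @` [set: {ffun 'I_N.+1 -> 'I_l.+1}])).
  move=> c [c0 _ _ cl]; exists [ffun i : 'I_N.+1 => inord (c (Posz i))] => //.
  apply/funext => -[n|n] /=; last by rewrite c0.
  case: leqP => nN; last by rewrite c0 //; lia.
  have [_ H _] := cl n.
  by rewrite ffunE inordK inordK //; lia.
exact/finite_image/finite_finset.
Qed.

(* Main.v *)
Require Import Defs.
From mathcomp Require Import all_boot all_order all_algebra.
From mathcomp Require Import all_classical.
From mathcomp Require Import zify ring.

(** A sequence c of occupation numbers with finite support is the second
difference ([occ]) of the convex function e(s) = sum of (j - s) c_j over j > s,
which vanishes far to the right.  The three families of inequalities satisfied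
by c become the inequalities [conf k l e] on four values of e at a time.

Such functions are parametrised by particles.  A particle has a weight w and a
position h; a finite collection x of particles of weights at most l defines
  cfg k x s = max over sub-collections J of x of
     (sum over J of (h - s w)) - (sum over pairs of J of A_{w,w'}),
an ultradiscrete tau function, evaluated here by the recursion [tau].  The core
of the proof is that x |-> cfg k x is a bijection from the multisets of
particles of weights in 1, ..., l onto the functions e with [conf k l e], zero
at +oo and affine at -oo.

- The image satisfies [conf] ([cfg_conf]).  Given optimal sub-collections at
  two points, the particles belonging to only one of them may be redistributed
  at will ([exchange]); the change of value is a quadratic form in the numbers
  v_t of signed particles of weight > t, minimised by alternating signs.  All
  the inequalities used, including the three-way alternative [cfg_star], are
  instances of this principle.

- There is a dynamics on both sides.  Raising by 1 the position of the front
  particle of weight l adds 1 to e on (-oo, i], that is moves one unit of c from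
  site i to site i + 1, where i is the last index at which an inequality
  bounding a sum of c_i + c_{i+1}, or of c_{i-1} + 2 c_i + 2 c_{i+1} + c_{i+2},
  is an equality ([cross_bump], [top_lastsat]).  On functions satisfying [conf]
  this move is well defined ([lastsat_conf]) and injective ([lastsat_inj]).

- Injectivity ([cfg_inj]): push the front particle far to the right, where it
  decouples from the others and can be removed.

- Surjectivity ([cfg_surj]): repeat the move until l units stand at the right
  end of the support, with an empty site before them; peel them off as one
  particle far to the right, use induction for the rest, then undo the moves one
  at a time.  Undoing is possible because the front particle can be
  lowered, unless two front particles coincide; [no_double] shows that a
  collection with two coinciding front particles is never the result of a move.

Boundary conditions and energy translate simply.  The support of c lies in
(-oo, N] exactly when h <= N w for all particles ([right_box]).  Complementing
the sub-collections J reflects the line ([cfg_reflect]), and turns the condition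
that c is supported in [0, +oo) with c_0 <= a and 2 c_0 + c_1 <= 2 a + b into
lower bounds h >= r_w + (sum of A_{w,w'} over the other particles)
([left_box]); then the sum of the i c_i is e(0), the value of the full
collection ([energy_left]).  For prescribed numbers m_w of particles of weight
w, the positions of the particles of weight w form a partition in a box, whence
the q-binomial coefficients ([chi_term_family]).  Therefore chi_{a,b} is the
generating function of the sequences with c_0 <= a and 2 c_0 + c_1 <= 2 a + b
([chi_states]), and the theorem follows by inclusion-exclusion on these two
bounds. *)

Set Implicit Arguments.
Unset Strict Implicit.
Unset Printing Implicit Defensive.

Import Order.TTheory GRing.Theory Num.Theory.

Local Open Scope classical_set_scope.
Local Open Scope ring_scope.

(** * Tau functions and the exchange principle *)

(** The maximum over the sub-collections J of x of the sum over J of h - u w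
    minus the sum of A_{w,w'} over the pairs of J: each step decides whether
    the head belongs to J, and if so charges its interaction to the others by
    raising u. *)
Fixpoint tau (k : nat) (u : nat -> int) (x : seq (nat * int)) : int :=
  if x is (w, h) :: x' then
    Num.max (tau k u x') (h - u w + tau k (fun v => u v + (A k w v)%:Z) x')
  else 0.

Lemma eq_tau_in k u u' x : {in map fst x, u =1 u'} -> tau k u x = tau k u' x.
Proof.
elim: x u u' => [//|[w h] x IH] u u' uu' /=.
have uux : {in map fst x, u =1 u'} by move=> v vx; rewrite uu' // inE vx orbT.
rewrite (IH u u') // uu' ?mem_head //; congr (Num.max _ (_ + _)).
by apply: IH => v vx; rewrite uux.
Qed.

Lemma eq_tau k u u' x : u =1 u' -> tau k u x = tau k u' x.
Proof. by move=> uu'; apply: eq_tau_in => v _. Qed.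

Definition sgb (s : bool) : int := if s then 1 else - 1.

(** Signed weights w_j with signs s_j: the sum of the s_j d(w_j) plus the sum
    over pairs of s_i s_j A_{w_i,w_j}. *)
Fixpoint cost (k : nat) (d : nat -> int) (D : seq nat) (sg : seq bool) : int :=
  match D, sg with
  | w :: D', s :: sg' =>
      sgb s * d w + cost k (fun v => d v + sgb s * (A k w v)%:Z) D' sg'
  | _, _ => 0
  end.

Lemma eq_cost k d d' D sg : d =1 d' -> cost k d D sg = cost k d' D sg.
Proof.
elim: D sg d d' => [//|w D IH] [//|s sg] d d' dd' /=.
rewrite dd'; congr (_ + _); apply: IH => v; by rewrite dd'.
Qed.

(** Take optimal sub-collections J1 at u1 and J2 at u2; D lists the particles
    lying in exactly one of them, with sign + for J1.  Redistributing D between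
    the two by other signs sg' keeps the union and the intersection, hence
    changes twice the sum of the two values only through [cost]. *)
Lemma exchange k x u1 u2 : exists D sg,
  [/\ subseq D (map fst x), size sg = size D &
   forall u3 u4 sg', (forall w, u3 w + u4 w = u1 w + u2 w) ->
     size sg' = size D ->
   2 * (tau k u1 x + tau k u2 x) + cost k (fun w => u1 w - u2 w) D sg <=
   2 * (tau k u3 x + tau k u4 x) + cost k (fun w => u3 w - u4 w) D sg'].
Proof.
elim: x u1 u2 => [|[w h] x IH] u1 u2.
  by exists [::], [::]; split=> // u3 u4 [].
pose up u := fun v : nat => u v + (A k w v)%:Z.
have upE u : (fun v => u v + (A k w v)%:Z) = up u by [].
have [c1|c1] := leP (h - u1 w + tau k (up u1) x) (tau k u1 x);
have [c2|c2] := leP (h - u2 w + tau k (up u2) x) (tau k u2 x).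
- have [D [sg [sD ssg H]]] := IH u1 u2; exists D, sg; split=> //.
    exact: subseq_trans sD (subseq_cons _ _).
  move=> u3 u4 sg' u34 ssg'; have := H u3 u4 sg' u34 ssg'.
  by rewrite /= !upE; lia.
- have [D [sg [sD ssg H]]] := IH u1 (up u2).
  exists (w :: D), (false :: sg); split=> //=; rewrite ?eqxx ?ssg //.
  move=> u3 u4 [//|s sg'] u34 [ssg'].
  rewrite !upE (@eq_cost k _ (fun v => u1 v - up u2 v)); last first.
    by move=> v; rewrite /up /sgb; lia.
  case: s => /=.
    rewrite (@eq_cost k (fun v => u3 v - u4 v + _) (fun v => up u3 v - u4 v)).
      have := H (up u3) u4 sg' _ ssg'; rewrite /sgb.
      have := u34 w; set z := cost _ _ _ _; set z' := cost _ _ _ _.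
      move=> uw /(_ _)/wrap[v|]; last lia.
      by have := u34 v; rewrite /up; lia.
    by move=> v; rewrite /up /sgb; lia.
  rewrite (@eq_cost k (fun v => u3 v - u4 v + _) (fun v => u3 v - up u4 v)).
    have := H u3 (up u4) sg' _ ssg'; rewrite /sgb.
    have := u34 w; set z := cost _ _ _ _; set z' := cost _ _ _ _.
    move=> uw /(_ _)/wrap[v|]; last lia.
    by have := u34 v; rewrite /up; lia.
  by move=> v; rewrite /up /sgb; lia.
- have [D [sg [sD ssg H]]] := IH (up u1) u2.
  exists (w :: D), (true :: sg); split=> //=; rewrite ?eqxx ?ssg //.
  move=> u3 u4 [//|s sg'] u34 [ssg'].
  rewrite !upE (@eq_cost k _ (fun v => up u1 v - u2 v)); last first.
    by move=> v; rewrite /up /sgb; lia.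
  case: s => /=.
    rewrite (@eq_cost k (fun v => u3 v - u4 v + _) (fun v => up u3 v - u4 v)).
      have := H (up u3) u4 sg' _ ssg'; rewrite /sgb.
      have := u34 w; set z := cost _ _ _ _; set z' := cost _ _ _ _.
      move=> uw /(_ _)/wrap[v|]; last lia.
      by have := u34 v; rewrite /up; lia.
    by move=> v; rewrite /up /sgb; lia.
  rewrite (@eq_cost k (fun v => u3 v - u4 v + _) (fun v => u3 v - up u4 v)).
    have := H u3 (up u4) sg' _ ssg'; rewrite /sgb.
    have := u34 w; set z := cost _ _ _ _; set z' := cost _ _ _ _.
    move=> uw /(_ _)/wrap[v|]; last lia.
    by have := u34 v; rewrite /up; lia.
  by move=> v; rewrite /up /sgb; lia.
- have [D [sg [sD ssg H]]] := IH (up u1) (up u2); exists D, sg; split=> //.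
    exact: subseq_trans sD (subseq_cons _ _).
  move=> u3 u4 sg' u34 ssg'; have := H (up u3) (up u4) sg' _ ssg'.
  rewrite (@eq_cost k (fun v => up u1 v - _) (fun v => u1 v - u2 v)); last first.
    by move=> v; rewrite /up; lia.
  rewrite (@eq_cost k (fun v => up u3 v - _) (fun v => u3 v - u4 v)); last first.
    by move=> v; rewrite /up; lia.
  move=> /(_ _)/wrap[v|]; first by have := u34 v; rewrite /up; lia.
  by have := u34 w; rewrite /= !upE; lia.
Qed.

(** * The exchange cost as a quadratic form *)

(** The number v_t of particles of weight > t, counted with signs. *)
Fixpoint bal (D : seq nat) (sg : seq bool) (t : nat) : int :=
  match D, sg with
  | w :: D', s :: sg' => sgb s * (t < w)%N%:Z + bal D' sg' t
  | _, _ => 0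
  end.

Fixpoint lin (d : nat -> int) (D : seq nat) (sg : seq bool) : int :=
  match D, sg with
  | w :: D', s :: sg' => sgb s * d w + lin d D' sg'
  | _, _ => 0
  end.

Lemma sum_window k a b : (b <= k)%N ->
  (\sum_(t < k) ((a <= t) && (t < b)) = b - a)%N.
Proof.
elim: k b => [|k IH] b bk; first by rewrite big_ord0; lia.
rewrite big_ord_recr /=; have [bk'|bk'] := leqP b k.
  by rewrite IH //; lia.
rewrite (_ : b = k.+1); last lia.
rewrite (eq_bigr (fun t : 'I_k => nat_of_bool ((a <= t) && (t < k))%N)) ?IH //; first lia.
by move=> t _; have := ltn_ord t; lia.
Qed.

Lemma sum_below k b : (b <= k)%N -> (\sum_(t < k) (t < b) = b)%N.
Proof. by move=> bk; rewrite -[RHS]subn0 -(sum_window 0 bk). Qed.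

Lemma sumz_below k b : (b <= k)%N -> \sum_(t < k) (t < b)%N%:Z = b%:Z.
Proof. by move=> bk; rewrite -[in RHS](sum_below bk) (big_morph _ PoszD (erefl 0)). Qed.

(** In terms of the indicator vectors of t < i and of t < j, the matrix A is a
    quadratic form coupling each level t only to itself and to k - 1 - t. *)
Lemma A_sum k i j : (i <= k)%N -> (j <= k)%N ->
  (A k i j)%:Z =
  \sum_(t < k) (t < i)%N%:Z * (2 * (t < j)%N%:Z + (k.-1 - t < j)%N%:Z).
Proof.
move=> ik jk; transitivity
  (2 * (minn i j)%:Z + (i - (k - j))%N%:Z); first by rewrite /A; lia.
rewrite -[in LHS](sumz_below (_ : minn i j <= k)%N); last lia.
rewrite -[in LHS](sum_window (k - j) ik) (big_morph _ PoszD (erefl 0)).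
rewrite mulr_sumr -big_split /=; apply: eq_bigr => t _.
have tk := ltn_ord t.
rewrite (_ : (t < minn i j)%N = (t < i)%N && (t < j)%N); last by lia.
rewrite (_ : (k.-1 - t < j)%N = (k - j <= t)%N); last by lia.
by case: (t < i)%N; case: (t < j)%N; case: (k - j <= t)%N.
Qed.

Lemma cost_lin k d c w D sg :
  cost k (fun v => d v + c * (A k w v)%:Z) D sg =
  cost k d D sg + c * lin (fun v => (A k w v)%:Z) D sg.
Proof.
elim: D sg d => [|v D IH] [|s sg] d /=; rewrite ?mulr0 ?addr0 //.
rewrite mulrDr mulrDr -!addrA; congr (_ + _).
rewrite (@eq_cost k _ (fun v' => (d v' + sgb s * (A k v v')%:Z) + c * (A k w v')%:Z)).
  by rewrite IH; ring.
by move=> v'; lia.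
Qed.

Lemma lin_sum k (f d : nat -> int) D sg : all (leq^~ k) D ->
  (forall w, w \in D -> d w = \sum_(t < k) (t < w)%N%:Z * f t) ->
  lin d D sg = \sum_(t < k) f t * bal D sg t.
Proof.
elim: D sg => [|w D IH] [|s sg] /= Dk dE.
- by rewrite big1 // => t; rewrite mulr0.
- by rewrite big1 // => t; rewrite mulr0.
- by rewrite big1 // => t; rewrite mulr0.
case/andP: Dk => wk Dk.
rewrite IH //; last by move=> v vD; rewrite dE // inE vD orbT.
rewrite dE ?mem_head // mulr_sumr -big_split /=.
by apply: eq_bigr => t _; lia.
Qed.

(** Summands coupling t to its mirror image k - 1 - t may be symmetrised. *)
Lemma sum_sym k (f g : nat -> nat -> int) :
  (forall t u, f t u + f u t = g t u + g u t) ->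
  \sum_(t < k) f t (k.-1 - t)%N = \sum_(t < k) g t (k.-1 - t)%N.
Proof.
move=> fg; suff: 2 * \sum_(t < k) f t (k.-1 - t)%N =
  2 * \sum_(t < k) g t (k.-1 - t)%N by lia.
have dbl (h : nat -> nat -> int) : 2 * \sum_(t < k) h t (k.-1 - t)%N =
    \sum_(t < k) (h t (k.-1 - t)%N + h (k.-1 - t)%N t).
  rewrite big_split /= mulrDl !mul1r; congr (_ + _).
  rewrite (reindex_inj rev_ord_inj) /=; apply: eq_bigr => t _.
  by have := ltn_ord t => tk; congr (h _ _); lia.
by rewrite !dbl; apply: eq_bigr => t _; rewrite fg.
Qed.

(** Expanding the pair interactions by [A_sum] turns the cost into a quadratic
    form in the balances v_t, up to a constant depending only on D. *)
Lemma cost_sum k (f d : nat -> int) D sg : size sg = size D -> all (leq^~ k) D ->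
  (forall w, w \in D -> d w = \sum_(t < k) (t < w)%N%:Z * f t) ->
  2 * cost k d D sg =
  \sum_(t < k) (2 * bal D sg t * bal D sg t
                + bal D sg t * bal D sg (k.-1 - t)
                + 2 * f t * bal D sg t)
  - \sum_(w <- D) (A k w w)%:Z.
Proof.
elim: D sg => [|w D IH] [|s sg] //= ssg Dk dE.
  by rewrite big_nil big1 // => t; rewrite !mulr0.
case: ssg => ssg; case/andP: Dk => wk Dk.
have -> : cost k (fun v => d v + sgb s * (A k w v)%:Z) D sg =
    cost k d D sg + sgb s * lin (fun v => (A k w v)%:Z) D sg by exact: cost_lin.
rewrite mulrDr mulrDr (IH sg ssg Dk) ?big_cons; last first.
  by move=> v vD; rewrite dE // inE vD orbT.
rewrite (@lin_sum k (fun t => 2 * (t < w)%N%:Z + (k.-1 - t < w)%N%:Z)) //; last first.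
  move=> v vD; rewrite (_ : A k w v = A k v w); last by rewrite /A; lia.
  by rewrite A_sum //; move/allP: Dk; apply.
rewrite dE ?mem_head // (A_sum wk wk).
set b := bal D sg.
have main : \sum_(t < k) (2 * (sgb s * ((t < w)%N%:Z * f t))
    + (2 * b t * b t + b t * b (k.-1 - t)%N + 2 * f t * b t)
    + 2 * (sgb s * ((2 * (t < w)%N%:Z + (k.-1 - t < w)%N%:Z) * b t))
    + (t < w)%N%:Z * (2 * (t < w)%N%:Z + (k.-1 - t < w)%N%:Z)) =
  \sum_(t < k) (2 * (sgb s * (t < w)%N%:Z + b t) * (sgb s * (t < w)%N%:Z + b t)
    + (sgb s * (t < w)%N%:Z + b t)
      * (sgb s * (k.-1 - t < w)%N%:Z + b (k.-1 - t)%N)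
    + 2 * f t * (sgb s * (t < w)%N%:Z + b t)).
  apply: (@sum_sym k (fun t u => 2 * (sgb s * ((t < w)%N%:Z * f t))
    + (2 * b t * b t + b t * b u + 2 * f t * b t)
    + 2 * (sgb s * ((2 * (t < w)%N%:Z + (u < w)%N%:Z) * b t))
    + (t < w)%N%:Z * (2 * (t < w)%N%:Z + (u < w)%N%:Z))
   (fun t u => 2 * (sgb s * (t < w)%N%:Z + b t) * (sgb s * (t < w)%N%:Z + b t)
    + (sgb s * (t < w)%N%:Z + b t) * (sgb s * (u < w)%N%:Z + b u)
    + 2 * f t * (sgb s * (t < w)%N%:Z + b t))) => t u.
  by case: s; case: (t < w)%N; case: (u < w)%N; rewrite /sgb; lia.
by rewrite -main !big_split /= -!mulr_sumr; ring.
Qed.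

(** Costs can be compared level by level once t is paired with k - 1 - t; the
    function g distributes the allowed excess c over the levels. *)
Lemma cost_le k (f1 f3 g : nat -> int) (c : int) (d1 d3 : nat -> int) D sg1 sg3 :
  size sg1 = size D -> size sg3 = size D -> all (leq^~ k) D ->
  (forall w, w \in D -> d1 w = \sum_(t < k) (t < w)%N%:Z * f1 t) ->
  (forall w, w \in D -> d3 w = \sum_(t < k) (t < w)%N%:Z * f3 t) ->
  (forall t u, (t < k)%N -> u = (k.-1 - t)%N ->
     let x := bal D sg1 t in let y := bal D sg1 u in
     let x' := bal D sg3 t in let y' := bal D sg3 u in
     x' * x' + y' * y' + x' * y' + f3 t * x' + f3 u * y' <=
     x * x + y * y + x * y + f1 t * x + f1 u * y + 2 * g t + 2 * g u) ->
  \sum_(t < k) g t = c ->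
  cost k d3 D sg3 <= cost k d1 D sg1 + 2 * c.
Proof.
move=> s1 s3 Dk d1E d3E H gc.
have C1 := cost_sum s1 Dk d1E; have C3 := cost_sum s3 Dk d3E.
have sym (f : nat -> int) sg : \sum_(t < k) (2 * bal D sg t * bal D sg t
     + bal D sg t * bal D sg (k.-1 - t) + 2 * f t * bal D sg t) =
   \sum_(t < k) (bal D sg t * bal D sg t
     + bal D sg (k.-1 - t) * bal D sg (k.-1 - t)
     + bal D sg t * bal D sg (k.-1 - t) + f t * bal D sg t
     + f (k.-1 - t)%N * bal D sg (k.-1 - t)%N).
  apply: (@sum_sym k (fun t u => 2 * bal D sg t * bal D sg t
     + bal D sg t * bal D sg u + 2 * f t * bal D sg t)
    (fun t u => bal D sg t * bal D sg t + bal D sg u * bal D sg u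
     + bal D sg t * bal D sg u + f t * bal D sg t
     + f u * bal D sg u)) => t u; lia.
have gsym : \sum_(t < k) (4 * g t) =
    \sum_(t < k) (2 * g t + 2 * g (k.-1 - t)%N).
  by apply: (@sum_sym k (fun t u => 4 * g t)
    (fun t u => 2 * g t + 2 * g u)) => t u; lia.
have : \sum_(t < k) (bal D sg3 t * bal D sg3 t
     + bal D sg3 (k.-1 - t) * bal D sg3 (k.-1 - t)
     + bal D sg3 t * bal D sg3 (k.-1 - t) + f3 t * bal D sg3 t
     + f3 (k.-1 - t)%N * bal D sg3 (k.-1 - t)%N) <=
  \sum_(t < k) ((bal D sg1 t * bal D sg1 t
     + bal D sg1 (k.-1 - t) * bal D sg1 (k.-1 - t)
     + bal D sg1 t * bal D sg1 (k.-1 - t) + f1 t * bal D sg1 t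
     + f1 (k.-1 - t)%N * bal D sg1 (k.-1 - t)%N)
     + (2 * g t + 2 * g (k.-1 - t)%N)).
  by apply: ler_sum => t _; have := H t (k.-1 - t)%N (ltn_ord t) (erefl _) => /=; lia.
rewrite [X in _ <= X]big_split /= -gsym -mulr_sumr gc -!sym; lia.
Qed.

(** * Alternating redistributions *)

Definition above (t : nat) (D : seq nat) : nat := count (ltn t) D.

(** Flipping a sign changes the balance by an even number. *)
Lemma bal_parity D sg t : size sg = size D ->
  exists z : int, bal D sg t = (odd (above t D))%:Z + 2 * z.
Proof.
elim: D sg => [|w D IH] [|s sg] //= ssg; first by exists 0.
case: ssg => /IH[z ->]; rewrite /above /= -/(above t D) oddD.
case: s; case: (t < w)%N; case: (odd (above t D)) => /=;
  [exists (z + 1)|exists z|exists z|exists z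
  |exists z|exists (z - 1)|exists z|exists z]; rewrite /sgb; lia.
Qed.

Lemma bal_beyond l D sg t : all (leq^~ l) D -> (l <= t)%N -> bal D sg t = 0.
Proof.
move=> Dl lt; elim: D sg Dl => [|w D IH] [|s sg] //= /andP[wl Dl].
by rewrite IH // (_ : (t < w)%N = false) ?mulr0 //; lia.
Qed.

Lemma above_beyond l D t : all (leq^~ l) D -> (l <= t)%N -> above t D = 0%N.
Proof.
move=> Dl lt; apply/eqP; rewrite /above eqn0Ngt -has_count; apply/hasPn => w.
by move/(allP Dl) => /=; lia.
Qed.

Lemma mkseq_cons T (g : nat -> T) m : mkseq g m.+1 = g 0%N :: mkseq (g \o S) m.
Proof. by rewrite /mkseq /= (iotaDl 1 0) -map_comp. Qed.

Lemma bal_mkseq D g t : sorted geq D ->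
  bal D (mkseq g (size D)) t = \sum_(j < above t D) sgb (g j).
Proof.
elim: D g => [|w D IH] g sD; first by rewrite big_ord0.
rewrite mkseq_cons [LHS]/= IH; last exact: path_sorted sD.
rewrite /above /= -/(above t D); have [tw|wt] := ltnP t w.
  by rewrite add1n big_ord_recl mulr1.
rewrite (_ : above t D = 0%N) ?addn0 ?big_ord0 ?mulr0 //.
apply: (@above_beyond w) => //.
have tr : transitive geq by move=> a b c ba ac; apply: leq_trans ac ba.
by have := order_path_min tr sD.
Qed.

(** Alternating signs +, -, +, ..., with a single repetition after the first n
    signs; no repetition occurs when n is at least the number of signs. *)
Definition altern (n j : nat) : bool := odd j (+) (j < n)%N.

(** The sum of the first N signs of [altern n], for odd n. *)
Definition altval (n N : nat) : int :=
  if (N <= n)%N then (odd N)%:Z else 2 - (odd N)%:Z.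

Lemma sum_altern n N : odd n -> \sum_(j < N) sgb (altern n j) = altval n N.
Proof.
move=> on; elim: N => [|N IH]; first by rewrite big_ord0.
rewrite big_ord_recr /= IH /altval /altern /sgb /=.
have [Nn|Nn|->] := ltngtP N n; last by rewrite on.
- by case: (odd N) => /=; lia.
- by case: (odd N) => /=; lia.
Qed.

Lemma affine_sum k l (a b : int) w : (l <= k)%N -> (w <= l)%N ->
  a * w%:Z + b * (w - (k - l))%N%:Z =
  \sum_(t < k) (t < w)%N%:Z * (a + b * (k - l <= t)%N%:Z).
Proof.
move=> lk wl; have wk := leq_trans wl lk.
rewrite -[X in a * X](sumz_below wk).
rewrite -(sum_window (k - l) wk) !(big_morph _ PoszD (erefl 0)) !mulr_sumr.
rewrite -big_split /=; apply: eq_bigr => t _.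
by case: (t < w)%N; case: (k - l <= t)%N; rewrite ?mulr0 ?mulr1 /=; ring.
Qed.

(** The redistribution used is always an alternating one along D sorted by
    decreasing weights: its balances are 0 or 1 (or 1 or 2 after the defect at
    n), while those of the given signs are only known modulo 2 and to vanish at
    the levels >= l0.  It then suffices to compare the two quadratic forms for
    each pair of levels t and u = k - 1 - t, where t < l amounts to k - l <= u. *)
Lemma tau_le k l l0 (x : seq (nat * int)) (u1 u2 : nat -> int) (a1 b1 : int) :
  (l <= k)%N -> (l0 <= l)%N -> all (leq^~ l0) (map fst x) -> sorted geq (map fst x) ->
  (forall w, (w <= l)%N ->
     u1 w - u2 w = a1 * w%:Z + b1 * (w - (k - l))%N%:Z) ->
  exists D, [/\ all (leq^~ l0) D, sorted geq D &
  forall (u3 u4 : nat -> int) (a3 b3 : int) n (g : nat -> int) (c : int), odd n ->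
    (forall w, u3 w + u4 w = u1 w + u2 w) ->
    (forall w, (w <= l)%N ->
       u3 w - u4 w = a3 * w%:Z + b3 * (w - (k - l))%N%:Z) ->
    \sum_(t < k) g t = c ->
    (forall t u, (t < k)%N -> u = (k.-1 - t)%N -> forall x y x' y' : int,
       (exists z, x = (odd (above t D))%:Z + 2 * z) ->
       (exists z, y = (odd (above u D))%:Z + 2 * z) ->
       (~~ (t < l0)%N -> x = 0) -> (~~ (u < l0)%N -> y = 0) ->
       x' = altval n (above t D) -> y' = altval n (above u D) ->
       x' * x' + y' * y' + x' * y' + (a3 + b3 * (u < l)%N%:Z) * x'
         + (a3 + b3 * (t < l)%N%:Z) * y' <=
       x * x + y * y + x * y + (a1 + b1 * (u < l)%N%:Z) * x
         + (a1 + b1 * (t < l)%N%:Z) * y + 2 * g t + 2 * g u) ->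
    tau k u1 x + tau k u2 x <= tau k u3 x + tau k u4 x + c].
Proof.
move=> lk l0l xl xs d1E; have [D [sg [sD ssg H]]] := exchange k x u1 u2.
have Dl : all (leq^~ l0) D by apply/allP => w /(mem_subseq sD); exact: (allP xl).
have tr : transitive geq by move=> a b c ba ac; apply: leq_trans ac ba.
have Ds : sorted geq D by exact: subseq_sorted sD xs.
exists D; split=> // u3 u4 a3 b3 n g c on u34 d3E gc pw.
have smk : size (mkseq (altern n) (size D)) = size D by rewrite size_mkseq.
have := H u3 u4 _ u34 smk.
have := @cost_le k (fun t => a1 + b1 * (k - l <= t)%N%:Z)
  (fun t => a3 + b3 * (k - l <= t)%N%:Z) g c
  (fun w => u1 w - u2 w) (fun w => u3 w - u4 w) D sg
  (mkseq (altern n) (size D)) ssg smk.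
move=> /(_ _)/wrap[|].
  by apply: sub_all Dl => w /= wl; apply: leq_trans wl (leq_trans l0l lk).
move=> /(_ _)/wrap[w wD|]; first by rewrite -affine_sum ?d1E // ?(leq_trans (allP Dl _ wD)).
move=> /(_ _)/wrap[w wD|]; first by rewrite -affine_sum ?d3E // ?(leq_trans (allP Dl _ wD)).
move=> /(_ _)/wrap[t u tk uE /=|].
  rewrite (_ : (k - l <= t)%N = (u < l)%N); last by lia.
  rewrite (_ : (k - l <= u)%N = (t < l)%N); last by lia.
  apply: pw => //; rewrite ?bal_mkseq ?sum_altern //.
  - exact: bal_parity.
  - exact: bal_parity.
  - by rewrite -leqNgt => lt; apply: bal_beyond Dl lt.
  - by rewrite -leqNgt => lt; apply: bal_beyond Dl lt.
by move=> /(_ gc); lia.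
Qed.

(** * The quadratic inequalities attached to a pair of levels *)

Definition graded (l : nat) (x : seq (nat * int)) : bool :=
  all (fun w => 0 < w <= l)%N (map fst x) && sorted geq (map fst x).

(** Translates of the tau function: s is the point, and m counts additional
    particles of weight l interacting with x. *)
Definition tw (k l m : nat) (x : seq (nat * int)) (s : int) : int :=
  tau k (fun w => s * w%:Z + m%:Z * (A k l w)%:Z) x.

Lemma altval_odd D t : altval (size D).*2.+1 (above t D) = (odd (above t D))%:Z.
Proof.
by rewrite /altval ifT // /above; have := count_size (ltn t) D; lia.
Qed.

(** The contribution to the cost of two mirror levels with balances x and y. *)
Definition form (c1 c2 x y : int) : int := x * x + y * y + x * y + c1 * x + c2 * y.

(** Integrality enters only through this inequality: applied to z, z' and
    z + z' it makes all the comparisons below linear in the products. *)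
Lemma mul_pred_ge0 (z c : int) : 0 <= (z - c) * (z - c - 1).
Proof.
by have [h|h] := leP z c; [rewrite -mulrNN mulr_ge0 | rewrite mulr_ge0]; lia.
Qed.

Ltac quad z z' :=
  have := mul_pred_ge0 z (- 1); have := mul_pred_ge0 z 0; have := mul_pred_ge0 z 1;
  have := mul_pred_ge0 z' (- 1); have := mul_pred_ge0 z' 0; have := mul_pred_ge0 z' 1;
  have := mul_pred_ge0 (z + z') (- 1); have := mul_pred_ge0 (z + z') 0;
  have := mul_pred_ge0 (z + z') 1; have := mul_pred_ge0 (z + z') 2; lia.

Ltac form_cases z z' :=
  let e := fresh in let f := fresh in
  rewrite /form;
  repeat match goal with b : bool |- _ => case: b => /= end;
  move=> e f; try (have {}e := e isT); try (have {}f := f isT);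
  quad z z'.

Section Arith.
Variables (z z' : int).
Local Notation "b %:B" := (nat_of_bool b)%:Z (at level 2, left associativity, format "b %:B").

Lemma form_P (a b p q : bool) : (~~ a -> p%:B + 2 * z = 0) -> (~~ b -> q%:B + 2 * z' = 0) ->
  form (- 1) (- 1) p%:B q%:B <=
  form (- 3) (- 3) (p%:B + 2 * z) (q%:B + 2 * z') + 2 * a%:B + 2 * b%:B.
Proof. form_cases z z'. Qed.

Lemma form_T (p q : bool) :
  form (- 2) (- 2) p%:B q%:B <=
  form (- 4) (- 4) (p%:B + 2 * z) (q%:B + 2 * z') + 4.
Proof.
by rewrite /form; case: p; case: q => /=; quad z z'. Qed.

Lemma form_S (a b p q : bool) : (~~ a -> p%:B + 2 * z = 0) -> (~~ b -> q%:B + 2 * z' = 0) ->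
  form (- 1) (- 1) p%:B q%:B <=
  form (- 5) (- 5) (p%:B + 2 * z) (q%:B + 2 * z') + 2 * (1 + a%:B) + 2 * (1 + b%:B).
Proof. form_cases z z'. Qed.

Lemma form_mono (a b p q : bool) : (~~ a -> p%:B + 2 * z = 0) -> (~~ b -> q%:B + 2 * z' = 0) ->
  form (- 1 - b%:B) (- 1 - a%:B) p%:B q%:B <=
  form (- 3 - b%:B) (- 3 - a%:B) (p%:B + 2 * z) (q%:B + 2 * z') + 2 * a%:B + 2 * b%:B.
Proof. form_cases z z'. Qed.

Lemma form_star1 (a b p q : bool) : (~~ a -> p%:B + 2 * z = 0) -> (~~ b -> q%:B + 2 * z' = 0) ->
  (a -> b -> ~~ p && ~~ q) ->
  form (- 1 + b%:B) (- 1 + a%:B) p%:B q%:B <=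
  form (- 1 - b%:B) (- 1 - a%:B) (p%:B + 2 * z) (q%:B + 2 * z').
Proof.
rewrite /form; case: a; case: b; case: p; case: q => //= e f g;
  try (by have := g isT isT); try (have {}e := e isT); try (have {}f := f isT);
  quad z z'.
Qed.

(** The balance 0 or 1 of parity p before the defect, 2 or 1 after it (b true). *)
Definition flip (b : bool) (p : bool) : int := if b then 2 - p%:B else p%:B.

Lemma form_star2 (a b p q d e : bool) : (~~ a -> p%:B + 2 * z = 0) -> (~~ b -> q%:B + 2 * z' = 0) ->
  a || b -> (~~ b -> d) -> (~~ a -> e) -> (~~ a -> ~~ d) -> (~~ b -> ~~ e) ->
  (a -> b -> d -> ~~ p && ~~ q && ~~ e) -> (a -> b -> e -> ~~ p && ~~ q && ~~ d) ->
  form (- 3 + b%:B) (- 3 + a%:B) (flip d p) (flip e q) <=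
  form (- 1 - b%:B) (- 1 - a%:B) (p%:B + 2 * z) (q%:B + 2 * z')
    - 2 * (~~ b)%:B - 2 * (~~ a)%:B.
Proof.
rewrite /form /flip; case: a => /=; case: b => //= xa yb _;
  case: d => //= h1; case: e => //= h2;
  try (by have := h1 isT); try (by have := h2 isT);
  move=> h3 h4; try (by have := h3 isT); try (by have := h4 isT);
  move=> h5 h6; try (have {}h5 := h5 isT isT isT); try (have {}h6 := h6 isT isT isT);
  move: xa yb h5 h6; case: p; case: q => //= xa yb _ _;
  try (have {}xa := xa isT); try (have {}yb := yb isT);
  quad z z'.
Qed.

Lemma form_star3 (a b p q d e : bool) : (~~ a -> p%:B + 2 * z = 0) -> (~~ b -> q%:B + 2 * z' = 0) ->
  a || b -> (~~ b -> d) -> (~~ a -> e) -> (~~ a -> ~~ d) -> (~~ b -> ~~ e) ->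
  (a -> b -> ~~ d -> ~~ p && ~~ q && e) -> (a -> b -> ~~ e -> ~~ p && ~~ q && d) ->
  form (- 3 - b%:B) (- 3 - a%:B) (flip d p) (flip e q) <=
  form (- 1 - b%:B) (- 1 - a%:B) (p%:B + 2 * z) (q%:B + 2 * z')
    - 2 * a%:B - 2 * b%:B.
Proof.
rewrite /form /flip; case: a => /=; case: b => //= xa yb _;
  case: d => //= h1; case: e => //= h2;
  try (by have := h1 isT); try (by have := h2 isT);
  move=> h3 h4; try (by have := h3 isT); try (by have := h4 isT);
  move=> h5 h6; try (have {}h5 := h5 isT isT isT); try (have {}h6 := h6 isT isT isT);
  move: xa yb h5 h6; case: p; case: q => //= xa yb _ _;
  try (have {}xa := xa isT); try (have {}yb := yb isT);
  quad z z'.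
Qed.

Lemma form_spread (a b a0 b0 p q : bool) :
  (~~ a0 -> p%:B + 2 * z = 0) -> (~~ b0 -> q%:B + 2 * z' = 0) ->
  (a0 -> a) -> (b0 -> b) ->
  form (- 1) (- 1) p%:B q%:B <=
  form (- 3 - 2 * b%:B) (- 3 - 2 * a%:B) (p%:B + 2 * z) (q%:B + 2 * z')
   + 2 * (a0%:B + (a && b)%:B) + 2 * (b0%:B + (a && b)%:B).
Proof.
rewrite /form; case: a0 => /= xa; case: b0 => /= yb; case: a => //= h1; case: b => //= h2;
  try (by have := h1 isT); try (by have := h2 isT);
  try (have {}xa := xa isT); try (have {}yb := yb isT);
  move: xa yb; case: p; case: q => //= xa yb;
  quad z z'.
Qed.

End Arith.

(** * Inequalities between translates of a tau function *)

(** [tau_le] for translates: differences of translates are linear in w and in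
    (w - (k - l))_+, since A_{l,w} = 2 w + (w - (k - l))_+ for w <= l. *)
Lemma tw_le k l l0 x m1 s1 m2 s2 (a1 b1 : int) :
  (l <= k)%N -> (l0 <= l)%N -> graded l0 x ->
  a1 = s1 - s2 + 2 * (m1%:Z - m2%:Z) -> b1 = m1%:Z - m2%:Z ->
  exists D, [/\ all (leq^~ l0) D, sorted geq D &
  forall m3 s3 m4 s4 (a3 b3 : int) n (g : nat -> int) (c : int), odd n ->
    (m3 + m4 = m1 + m2)%N -> s3 + s4 = s1 + s2 ->
    a3 = s3 - s4 + 2 * (m3%:Z - m4%:Z) -> b3 = m3%:Z - m4%:Z ->
    \sum_(t < k) g t = c ->
    (forall t u, (t < k)%N -> u = (k.-1 - t)%N -> forall z z' : int,
       (~~ (t < l0)%N -> (odd (above t D))%:Z + 2 * z = 0) ->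
       (~~ (u < l0)%N -> (odd (above u D))%:Z + 2 * z' = 0) ->
       form (a3 + b3 * (u < l)%N%:Z) (a3 + b3 * (t < l)%N%:Z)
         (altval n (above t D)) (altval n (above u D)) <=
       form (a1 + b1 * (u < l)%N%:Z) (a1 + b1 * (t < l)%N%:Z)
         ((odd (above t D))%:Z + 2 * z) ((odd (above u D))%:Z + 2 * z')
         + 2 * g t + 2 * g u) ->
    tw k l m1 x s1 + tw k l m2 x s2 <= tw k l m3 x s3 + tw k l m4 x s4 + c].
Proof.
move=> lk l0l /andP[xl xs] a1E b1E.
have xl' : all (leq^~ l0) (map fst x) by apply: sub_all xl => w /andP[].
have AE w : (w <= l)%N -> (A k l w)%:Z = 2 * w%:Z + (w - (k - l))%N%:Z.
  by rewrite /A; lia.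
have [|D [Dl Ds H]] := @tau_le k l l0 x
  (fun w => s1 * w%:Z + m1%:Z * (A k l w)%:Z) (fun w => s2 * w%:Z + m2%:Z * (A k l w)%:Z)
  a1 b1 lk l0l xl' xs.
  by move=> w wl; rewrite AE // a1E b1E; ring.
exists D; split=> // m3 s3 m4 s4 a3 b3 n g c on m34 s34 a3E b3E gc pw.
apply: (H _ _ a3 b3 n g) => //.
- move=> w; transitivity ((s3 + s4) * w%:Z + (m3 + m4)%N%:Z * (A k l w)%:Z).
    by rewrite PoszD; ring.
  by rewrite m34 s34 PoszD; ring.
- by move=> w wl; rewrite AE // a3E b3E; ring.
- move=> t u tk uE x1 y1 x' y' [z zE] [z' zE']; rewrite zE zE' => x0 y0 -> ->.
  exact: (pw t u tk uE z z' x0 y0).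
Qed.

Section Inequalities.
Variables (k l : nat) (x : seq (nat * int)).
Hypotheses (lk : (l <= k)%N) (gx : graded l x).
Variables (m : nat) (s : int).
Local Notation t0 := (tw k l m x).
Local Notation t1 := (tw k l m.+1 x).

Lemma tw_P : t0 (s - 1) + t0 (s + 2) <= t0 s + t0 (s + 1) + l%:Z.
Proof.
have [||D [Dl Ds H]] := @tw_le k l l x m (s - 1) m (s + 2) (- 3) 0 lk (leqnn l) gx; try lia.
(* A defect at an odd index beyond all the signs: plain alternation. *)
apply: (H m s m (s + 1) (- 1) 0 (size D).*2.+1 (fun t => (t < l)%N%:Z));
  rewrite /= ?odd_double //; try lia; first exact: sumz_below.
move=> t u tk uE z z' x0 y0; rewrite !altval_odd !mul0r !addr0.
exact: form_P.
Qed.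

Lemma tw_T : t0 (s - 1) + t0 (s + 3) <= t0 s + t0 (s + 2) + k%:Z.
Proof.
have [||D [Dl Ds H]] := @tw_le k l l x m (s - 1) m (s + 3) (- 4) 0 lk (leqnn l) gx; try lia.
apply: (H m s m (s + 2) (- 2) 0 (size D).*2.+1 (fun t => 1));
  rewrite /= ?odd_double //; try lia; first by rewrite sumr_const card_ord natz.
move=> t u tk uE z z' x0 y0; rewrite !altval_odd !mul0r !addr0.
by have := form_T z z' (odd (above t D)) (odd (above u D)); lia.
Qed.

Lemma tw_S : t0 (s - 2) + t0 (s + 3) <= t0 s + t0 (s + 1) + (k + l)%N%:Z.
Proof.
have [||D [Dl Ds H]] := @tw_le k l l x m (s - 2) m (s + 3) (- 5) 0 lk (leqnn l) gx; try lia.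
apply: (H m s m (s + 1) (- 1) 0 (size D).*2.+1 (fun t => 1 + (t < l)%N%:Z));
  rewrite /= ?odd_double //; try lia.
  by rewrite big_split /= sumz_below // sumr_const card_ord natz.
move=> t u tk uE z z' x0 y0; rewrite !altval_odd !mul0r !addr0.
exact: form_S.
Qed.

Lemma tw_mono : t0 s + t1 (s + 1) <= t0 (s + 1) + t1 s + l%:Z.
Proof.
have [||D [Dl Ds H]] := @tw_le k l l x m s m.+1 (s + 1) (- 3) (- 1) lk (leqnn l) gx; try lia.
apply: (H m (s + 1) m.+1 s (- 1) (- 1) (size D).*2.+1 (fun t => (t < l)%N%:Z));
  rewrite /= ?odd_double //; try lia; first exact: sumz_below.
move=> t u tk uE z z' x0 y0; rewrite !altval_odd !mulN1r.
exact: form_mono.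
Qed.

Lemma above_anti t u D : (t <= u)%N -> (above u D <= above t D)%N.
Proof. by move=> tu; apply: sub_count => w /= uw; lia. Qed.

(** With N_t the number of exchanged particles of weight > t, the relevant levels
    are those of [k - l, l), which the mirror symmetry preserves.  If all N_t
    there are even, plain alternation gives the first inequality.  Otherwise let
    a and b be the extreme levels with N_t odd: a defect placed at a gives the
    second inequality when a + b <= k - 1, and one placed at b gives the third
    when a + b >= k. *)
Lemma tw_star :
  [\/ t0 (s + 1) + t1 s <= t1 (s - 1) + t0 (s + 2),
      t0 (s + 1) + t1 s <= t1 (s - 2) + t0 (s + 3) - (k - l)%N%:Z |
      t0 (s + 1) + t1 s <= t0 s + t1 (s + 1) - l%:Z].
Proof.
have [||D [Dl Ds H]] := @tw_le k l l x m (s + 1) m.+1 s (- 1) (- 1) lk (leqnn l) gx; try lia.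
pose N t := above t D.
have [ev|] := boolP (all (fun t => ~~ odd (N t)) (iota (k - l) (l - (k - l)))).
  apply: Or31; rewrite -[leRHS]addr0.
  apply: (H m.+1 (s - 1) m (s + 2) (- 1) 1 (size D).*2.+1 (fun t => 0));
    rewrite /= ?odd_double //; try lia; first by rewrite sumr_const mul0rn.
  move=> t u tk uE z z' x0 y0; rewrite !altval_odd !mulN1r !mul1r !mulr0 !addr0.
  apply: form_star1 => // tl ul; apply/andP; split.
    by apply: (allP ev); rewrite mem_iota; lia.
  by apply: (allP ev); rewrite mem_iota; lia.
rewrite -has_predC => /hasP[t' t'i /negPn ot'].
have oddl t : odd (N t) -> (t < l)%N.
  by move=> o; rewrite ltnNge; apply: contraTN o => /(above_beyond Dl); rewrite /N => ->.
pose Q t := (k - l <= t)%N && odd (N t).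
have exQ : exists t, Q t.
  by exists t'; rewrite /Q ot' andbT; move: t'i; rewrite mem_iota; lia.
have ubQ t : Q t -> (t <= l)%N by move=> /andP[_ /oddl]; lia.
case: (ex_minnP exQ) => a /andP[pa oa] amin.
case: (ex_maxnP exQ ubQ) => b /andP[pb ob] bmax.
have al := oddl _ oa; have bl := oddl _ ob.
have low t : (k - l <= t)%N -> odd (N t) -> (a <= t <= b)%N.
  by move=> pt ot; rewrite amin ?bmax // /Q pt ot.
have flipE (c t : nat) : odd (N c) -> altval (N c) (N t) = flip (t <= c)%N (odd (N t)).
  move=> oc; rewrite /altval /flip; have [tc|ct] := leqP t c.
    have := above_anti D tc; rewrite -/(N c) -/(N t) leq_eqVlt => /orP[/eqP<-|h].
      by rewrite leqnn oc.
    by rewrite leqNgt h.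
  by rewrite (above_anti D (ltnW ct)).
have flipE_lt (c t : nat) : odd (N c) -> altval (N c) (N t) = flip (t < c)%N (odd (N t)).
  move=> oc; rewrite flipE // /flip leq_eqVlt.
  by have [->|] := eqVneq t c; rewrite ?oc ?ltnn.
have a_le_b : (a <= b)%N by have := low a pa oa; lia.
have even t : (k - l <= t)%N -> ~~ (a <= t <= b)%N -> ~~ odd (N t).
  by move=> pt; apply: contra; apply: low.
have [ab|ab] := leqP (a + b) k.-1.
  apply: Or32.
  apply: (H m.+1 (s - 2) m (s + 3) (- 3) 1 (N a) (fun t => - (t < k - l)%N%:Z)) => //; try lia.
    by rewrite sumrN sumz_below //; lia.
  move=> t u tk uE z z' x0 y0; rewrite !flipE_lt //.
  have := @form_star2 z z' (t < l)%N (u < l)%N (odd (N t)) (odd (N u)) (t < a)%N (u < a)%N x0 y0.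
  rewrite !mulN1r !mul1r !mulrN (_ : (t < k - l)%N = ~~ (u < l)%N); last by lia.
  rewrite (_ : (u < k - l)%N = ~~ (t < l)%N); last by lia.
  apply; try lia.
    move=> tl ul ta.
    rewrite -andbA; apply/and3P; split; [apply: even | apply: even | ]; move: lk tk uE a_le_b ab tl ul ta; clear; lia.
  move=> tl ul ua.
  rewrite -andbA; apply/and3P; split; [apply: even | apply: even | ]; move: lk tk uE a_le_b ab tl ul ua; clear; lia.
apply: Or33.
apply: (H m s m.+1 (s + 1) (- 3) (- 1) (N b) (fun t => - (t < l)%N%:Z)) => //; try lia.
  by rewrite sumrN sumz_below //; lia.
move=> t u tk uE z z' x0 y0; rewrite !flipE //.
have := @form_star3 z z' (t < l)%N (u < l)%N (odd (N t)) (odd (N u)) (t <= b)%N (u <= b)%N x0 y0.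
rewrite !mulN1r !mulrN => H1; apply: H1; try lia.
  move=> tl ul tb.
  rewrite -andbA; apply/and3P; split; [apply: even | apply: even | ]; move: lk tk uE a_le_b ab tl ul tb; clear; lia.
move=> tl ul ub.
rewrite -andbA; apply/and3P; split; [apply: even | apply: even | ]; move: lk tk uE a_le_b ab tl ul ub; clear; lia.
Qed.

End Inequalities.

(** Weights below l give l - 1 in the bound where weights up to l would give l;
    this strictness separates the crossings of two coinciding particles of
    weight l. *)
Lemma tw_spread k l x m s : (l <= k)%N -> graded l.-1 x -> (0 < l)%N ->
  tw k l m x (s + 1) + tw k l m.+2 x s <=
  tw k l m.+1 x s + tw k l m.+1 x (s + 1) + (l.-1 + (l - (k - l)))%N%:Z.
Proof.
move=> lk gx l0.
have [||D [Dl Ds H]] := @tw_le k l l.-1 x m (s + 1) m.+2 s (- 3) (- 2) lk (leq_pred l) gx; try lia.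
apply: (H m.+1 s m.+1 (s + 1) (- 1) 0 (size D).*2.+1
  (fun t => (t < l.-1)%N%:Z + ((k - l <= t) && (t < l))%N%:Z));
  rewrite /= ?odd_double //; try lia.
  rewrite big_split /= sumz_below; last by lia.
  by rewrite -(sum_window (k - l) lk) PoszD (big_morph _ PoszD (erefl 0)).
move=> t u tk uE z z' x0 y0; rewrite !altval_odd !mul0r !addr0.
have := @form_spread z z' (t < l)%N (u < l)%N (t < l.-1)%N (u < l.-1)%N
  (odd (above t D)) (odd (above u D)) x0 y0.
rewrite (_ : (k - l <= t)%N = (u < l)%N); last by lia.
rewrite (_ : (k - l <= u)%N = (t < l)%N); last by lia.
rewrite [(u < l)%N && _]andbC !mulNr => H1; apply: H1; lia.
Qed.

(** * Second differences, saturation and moves *)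

Section Particles.
Implicit Types (i j s h g N L : int) (u : nat -> int) (p : nat * int) (x y : seq (nat * int)).

Definition occ (e : int -> int) (i : int) : int := e (i - 1) - 2 * e i + e (i + 1).
Definition dP (e : int -> int) (i : int) : int := e (i - 1) - e i - e (i + 1) + e (i + 2).
Definition dT (e : int -> int) (i : int) : int := e (i - 1) - e i - e (i + 2) + e (i + 3).
Definition dS (e : int -> int) (i : int) : int := e (i - 2) - e i - e (i + 1) + e (i + 3).

(** Normalisation of neighbouring indices, as one multi-rule. *)
Lemma idxE (i : int) :
  ((i + 1 + 1 = i + 2) * (i + 1 + 2 = i + 3) * (i + 1 + 3 = i + 4)
  * (i + 2 + 1 = i + 3) * (i + 2 + 2 = i + 4) * (i + 2 + 3 = i + 5)
  * (i + 3 + 1 = i + 4) * (i + 3 + 2 = i + 5) * (i + 3 + 3 = i + 6)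
  * (i + 4 + 1 = i + 5) * (i + 4 + 2 = i + 6)
  * (i + 1 - 1 = i) * (i + 1 - 2 = i - 1) * (i + 1 - 3 = i - 2)
  * (i + 2 - 1 = i + 1) * (i + 2 - 2 = i) * (i + 2 - 3 = i - 1)
  * (i + 3 - 1 = i + 2) * (i + 3 - 2 = i + 1) * (i + 3 - 3 = i)
  * (i + 4 - 1 = i + 3) * (i + 4 - 2 = i + 2)
  * (i - 1 + 1 = i) * (i - 1 + 2 = i + 1) * (i - 1 + 3 = i + 2)
  * (i - 2 + 1 = i - 1) * (i - 2 + 2 = i) * (i - 2 + 3 = i + 1)
  * (i - 3 + 1 = i - 2) * (i - 3 + 2 = i - 1) * (i - 3 + 3 = i)
  * (i - 4 + 1 = i - 3) * (i - 4 + 2 = i - 2) * (i - 4 + 3 = i - 1)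
  * (i - 1 - 1 = i - 2) * (i - 1 - 2 = i - 3) * (i - 1 - 3 = i - 4)
  * (i - 2 - 1 = i - 3) * (i - 2 - 2 = i - 4) * (i - 2 - 3 = i - 5)
  * (i - 3 - 1 = i - 4) * (i - 3 - 2 = i - 5) * (i - 4 - 1 = i - 5)).
Proof. by do !split; lia. Qed.

Lemma dP_occ e i : dP e i = occ e i + occ e (i + 1).
Proof. by rewrite /dP /occ !idxE; lia. Qed.

Lemma dT_occ e i : dT e i = occ e i + occ e (i + 1) + occ e (i + 2).
Proof. by rewrite /dT /occ !idxE; lia. Qed.

Lemma dS_occ e i :
  dS e i = occ e (i - 1) + 2 * occ e i + 2 * occ e (i + 1) + occ e (i + 2).
Proof. by rewrite /dS /occ !idxE; lia. Qed.

(** For c = 1 one unit of the second difference moves from site i to i + 1. *)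
Definition bump (c : int) (e : int -> int) (i s : int) : int := e s + c * (s <= i)%R%:Z.

Lemma occ_bump c e i m :
  occ (bump c e i) m = occ e m + c * ((m == i + 1)%:Z - (m == i)%:Z).
Proof. by rewrite /occ /bump; nia. Qed.

Lemma dP_bump c e i m :
  dP (bump c e i) m = dP e m + c * ((m == i + 1)%:Z - (m == i - 1)%:Z).
Proof. by rewrite /dP /bump; nia. Qed.

Lemma dT_bump c e i m :
  dT (bump c e i) m = dT e m + c * ((m == i + 1)%:Z - (m == i - 2)%:Z).
Proof. by rewrite /dT /bump; nia. Qed.

Lemma dS_bump c e i m :
  dS (bump c e i) m = dS e m
  + c * ((m == i + 1)%:Z + (m == i + 2)%:Z - (m == i - 1)%:Z - (m == i - 2)%:Z).
Proof. by rewrite /dS /bump; nia. Qed.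

Record conf (k l : nat) (e : int -> int) : Prop := Conf {
  conf_occ : forall i, 0 <= occ e i;
  conf_P : forall i, dP e i <= l%:Z;
  conf_T : forall i, dT e i <= k%:Z;
  conf_S : forall i, dS e i <= (k + l)%N%:Z }.

(** Saturation of one of the two inequalities bounding sums centred between the
    sites i and i + 1. *)
Definition sat (k l : nat) (e : int -> int) (i : int) : bool :=
  (dP e i == l%:Z) || (dS e i == (k + l)%N%:Z).

Lemma unsatP k l e i : conf k l e ->
  reflect (dP e i < l%:Z /\ dS e i < (k + l)%N%:Z) (~~ sat k l e i).
Proof.
move=> [_ cP _ cS]; apply: (iffP idP); rewrite /sat; have := cP i; have := cS i; lia.
Qed.

Lemma sat_bump k l e c i : sat k l (bump c e i) i = sat k l e i.
Proof. by rewrite /sat dP_bump dS_bump; congr (_ || _); congr (_ == _); lia. Qed.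

(** Two such saturations at distance 2 force a third one on the right, because of
    the bounds on the sums between them. *)
Lemma sat_chain k l e i : conf k l e -> dP e i = l%:Z -> dS e (i + 2) = (k + l)%N%:Z -> sat k l e (i + 3).
Proof.
move=> ce; have := conf_P ce (i + 3); have := conf_S ce (i + 1); have := conf_T ce (i + 2).
by rewrite /sat !dP_occ !dT_occ !dS_occ !idxE; lia.
Qed.

Section Local.
Variables (k l : nat) (e : int -> int).
Hypothesis (l0 : (0 < l)%N) (ce : conf k l e).

Ltac local i := have := conf_occ ce (i - 2); have := conf_occ ce (i - 1);
  have := conf_occ ce i; have := conf_occ ce (i + 1); have := conf_occ ce (i + 2);
  have := conf_occ ce (i + 3);
  have := conf_P ce (i - 1); have := conf_P ce i; have := conf_P ce (i + 1);
  have := conf_P ce (i + 2);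
  have := conf_T ce (i - 2); have := conf_T ce (i - 1); have := conf_T ce i;
  have := conf_T ce (i + 1);
  have := conf_S ce (i - 1); have := conf_S ce i; have := conf_S ce (i + 1);
  have := conf_S ce (i + 2).

(** A saturated sum next to an unsaturated one leaves room to move one unit to
    the right: the site i is occupied and the inequalities gaining a unit are
    strict. *)
Lemma move_conf i : sat k l e i -> ~~ sat k l e (i + 1) ->
  dS e (i + 2) < (k + l)%N%:Z -> conf k l (bump 1 e i).
Proof.
move=> si /(unsatP _ ce)[nP nS] nS2.
have [oi Ti] : 0 < occ e i /\ dT e (i + 1) < k%:Z.
  move: si nP nS nS2; rewrite /sat; local i.
  by rewrite !dP_occ !dT_occ !dS_occ !idxE; lia.
split=> m; rewrite ?occ_bump ?dP_bump ?dT_bump ?dS_bump.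
- have := conf_occ ce m; have [mi|mi] := eqVneq m i; first by rewrite mi; lia.
  by have [mE|] := eqVneq m (i + 1); lia.
- by have := conf_P ce m; have [mE|] := eqVneq m (i + 1); [rewrite mE|]; lia.
- by have := conf_T ce m; have [mE|] := eqVneq m (i + 1); [rewrite mE|]; lia.
- have := conf_S ce m; have [mE|n1] := eqVneq m (i + 1); first by rewrite mE; lia.
  by have [mE|n2] := eqVneq m (i + 2); [rewrite mE|]; lia.
Qed.

(** The mirror image of [move_conf]. *)
Lemma back_conf i : sat k l e i -> ~~ sat k l e (i - 1) ->
  dS e (i - 2) < (k + l)%N%:Z -> conf k l (bump (- 1) e i).
Proof.
move=> si /(unsatP _ ce)[nP nS] nS2.
have [oi Ti] : 0 < occ e (i + 1) /\ dT e (i - 2) < k%:Z.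
  move: si nP nS nS2; rewrite /sat; local i.
  by rewrite !dP_occ !dT_occ !dS_occ !idxE; lia.
split=> m; rewrite ?occ_bump ?dP_bump ?dT_bump ?dS_bump.
- have := conf_occ ce m; have [mi|mi] := eqVneq m i; first by rewrite mi; lia.
  by have [mE|] := eqVneq m (i + 1); first (by rewrite mE; lia); lia.
- by have := conf_P ce m; have [mE|] := eqVneq m (i - 1); [rewrite mE|]; lia.
- by have := conf_T ce m; have [mE|] := eqVneq m (i - 2); [rewrite mE|]; lia.
- have := conf_S ce m; have [mE|n1] := eqVneq m (i - 1); first by rewrite mE; lia.
  by have [mE|n2] := eqVneq m (i - 2); [rewrite mE|]; lia.
Qed.

End Local.

Definition lastsat (k l : nat) (e : int -> int) (i : int) : Prop :=
  sat k l e i /\ forall j, i < j -> ~~ sat k l e j.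

Definition firstsat (k l : nat) (e : int -> int) (i : int) : Prop :=
  sat k l e i /\ forall j, j < i -> ~~ sat k l e j.

Lemma eq_occ e e' : e =1 e' -> occ e =1 occ e'.
Proof. by move=> ee i; rewrite /occ !ee. Qed.
Lemma eq_dP e e' : e =1 e' -> dP e =1 dP e'.
Proof. by move=> ee i; rewrite /dP !ee. Qed.
Lemma eq_dT e e' : e =1 e' -> dT e =1 dT e'.
Proof. by move=> ee i; rewrite /dT !ee. Qed.
Lemma eq_dS e e' : e =1 e' -> dS e =1 dS e'.
Proof. by move=> ee i; rewrite /dS !ee. Qed.

Lemma eq_conf k l e e' : e =1 e' -> conf k l e -> conf k l e'.
Proof.
move=> ee [cO cP cT cS]; split=> i.
- by rewrite -(eq_occ ee).
- by rewrite -(eq_dP ee).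
- by rewrite -(eq_dT ee).
- by rewrite -(eq_dS ee).
Qed.

Lemma eq_saturated k l e e' : e =1 e' -> sat k l e =1 sat k l e'.
Proof. by move=> ee i; rewrite /sat (eq_dP ee) (eq_dS ee). Qed.

Lemma eq_lastsat k l e e' i : e =1 e' -> lastsat k l e i -> lastsat k l e' i.
Proof.
move=> ee [si nsi]; split=> [|j ij]; first by rewrite -(eq_saturated k l ee).
by rewrite -(eq_saturated k l ee); apply: nsi.
Qed.

Lemma lastsat_uniq k l e i i' : lastsat k l e i -> lastsat k l e i' -> i = i'.
Proof.
move=> [si ni] [si' ni']; case: (ltgtP i i') => // ii'.
  by have := ni _ ii'; rewrite si'.
by have := ni' _ ii'; rewrite si.
Qed.

Lemma lastsat_conf k l e i : (0 < l)%N -> conf k l e -> lastsat k l e i ->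
  conf k l (bump 1 e i).
Proof.
move=> l0 ce [si ni]; apply: move_conf => //; first by apply: ni; lia.
by have /(unsatP _ ce)[] : ~~ sat k l e (i + 2) by apply: ni; lia.
Qed.

Lemma firstsat_conf k l e i : (0 < l)%N -> conf k l e -> firstsat k l e i ->
  conf k l (bump (- 1) e i).
Proof.
move=> l0 ce [si ni]; apply: back_conf => //; first by apply: ni; lia.
by have /(unsatP _ ce)[] : ~~ sat k l e (i - 2) by apply: ni; lia.
Qed.

(** A move keeps its index saturated, so if two moves with i < i' had the same
    result, i' would be i + 1 or i + 2.  In the first case the saturated sum at i
    exceeds its bound for e'; in the second one either this happens again, or
    [sat_chain] creates a saturation at i + 3, beyond the last. *)
Lemma lastsat_le k l e e' i i' : (0 < l)%N -> conf k l e -> conf k l e' ->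
  lastsat k l e i -> lastsat k l e' i' -> bump 1 e i =1 bump 1 e' i' -> ~ i < i'.
Proof.
move=> l0 ce ce' li li' cc ii'; have cc1 := lastsat_conf l0 ce li.
have := @sat_bump k l e 1 i; have := @sat_bump k l e' 1 i'.
rewrite -(eq_saturated k l cc) (proj1 li) (proj1 li') => ci' ci.
have [nP nS] := unsatP i' ce (proj2 li _ ii').
have i'E : i' = i + 1 \/ i' = i + 2.
  by move: ci' nP nS; rewrite /sat dP_bump dS_bump; lia.
have := conf_P ce' i; have := conf_S ce' i.
have := dP_bump 1 e' i' i; have := dS_bump 1 e' i' i.
rewrite -(eq_dP cc) -(eq_dS cc); case: i'E => i'E.
  by move: ci; rewrite i'E /sat; lia.
have Pi : dP (bump 1 e i) i = l%:Z -> dS (bump 1 e i) (i + 2) = (k + l)%N%:Z -> False.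
  move=> Pi Si; have := sat_chain cc1 Pi Si.
  have /(unsatP _ ce)[] : ~~ sat k l e (i + 3) by apply: (proj2 li); lia.
  by rewrite /sat dP_bump dS_bump; lia.
move: Pi ci ci' nP; rewrite i'E /sat !dP_bump; lia.
Qed.

Lemma lastsat_inj k l e e' i i' : (0 < l)%N -> conf k l e -> conf k l e' ->
  lastsat k l e i -> lastsat k l e' i' -> bump 1 e i =1 bump 1 e' i' ->
  i = i' /\ e =1 e'.
Proof.
move=> l0 ce ce' li li' cc.
have ii' : i = i'.
  have h1 := lastsat_le l0 ce ce' li li' cc.
  have h2 : ~ i' < i by apply: (lastsat_le l0 ce' ce li' li) => s; rewrite cc.
  by case: (ltgtP i i') => //.
by split=> // s; have := cc s; rewrite /bump ii'; lia.
Qed.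

Lemma int_threshold (P : pred int) a b : (forall s : int, P (s + 1) -> P s) ->
  P a -> ~~ P b -> exists i, forall s, P s = (s <= i).
Proof.
move=> mono Pa nPb.
have down n s : P (s + n%:Z) -> P s.
  elim: n s => [|n IH] s; first by rewrite addr0.
  by move=> h; apply: IH; apply: mono; move: h; rewrite -addrA; congr P; lia.
have ex : exists n : nat, ~~ P (a + n%:Z).
  exists `|b - a|%N; apply: contra nPb => h.
  have [ab|ab] := leP a b.
    by move: h; rewrite (_ : a + `|b - a|%N%:Z = b) //; lia.
  by apply: (down `|a - b|%N); rewrite (_ : b + _ = a) //; lia.
case: (ex_minnP ex) => n nP nmin.
exists (a + n%:Z - 1) => s; apply/idP/idP => [Ps|sn].
  rewrite leNgt; apply/negP => h; move: nP; rewrite (down `|s - (a + n%:Z)%R|%N) //.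
  by rewrite (_ : _ + _ = s) //; lia.
have [sa|sa] := leP s a.
  by apply: (down `|a - s|%N); rewrite (_ : _ + _ = a) //; lia.
apply: contraT => /negPf nPs; have := nmin `|s - a|%N.
by rewrite (_ : a + `|s - a|%N%:Z = s) ?nPs; last lia; move=> /(_ isT); lia.
Qed.

Lemma lastsat_ex k l (e : int -> int) i N : (0 < l)%N -> (forall s, N <= s -> e s = 0) ->
  sat k l e i -> exists j, lastsat k l e j.
Proof.
move=> l0 eN si.
have bound j : sat k l e j -> j <= N + 3.
  by rewrite /sat /dP /dS => sj; rewrite leNgt; apply/negP => jN; move: sj; rewrite !eN; lia.
have ex : exists n : nat, sat k l e (N + 3 - n%:Z).
  by exists `|(N + 3 - i)%R|%N; have := bound _ si => iN; rewrite (_ : _ - _ = i) //; lia.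
case: (ex_minnP ex) => n sn nmin; exists (N + 3 - n%:Z); split=> // j jn.
apply/negP => sj; have := bound _ sj => jN; have := nmin `|(N + 3 - j)%R|%N.
by rewrite (_ : N + 3 - _ = j); [move=> /(_ sj); lia | lia].
Qed.

Lemma firstsat_ex k l (e : int -> int) i N : (0 < l)%N -> (forall s, s <= N -> occ e s = 0) ->
  sat k l e i -> exists j, firstsat k l e j.
Proof.
move=> l0 eN si.
have bound j : sat k l e j -> N - 3 <= j.
  rewrite /sat dP_occ dS_occ => sj; rewrite leNgt; apply/negP => jN.
  by move: sj; rewrite !eN; lia.
have ex : exists n : nat, sat k l e (N - 3 + n%:Z).
  by exists `|(i - (N - 3))%R|%N; have := bound _ si => iN; rewrite (_ : _ + _ = i) //; lia.
case: (ex_minnP ex) => n sn nmin; exists (N - 3 + n%:Z); split=> // j jn.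
apply/negP => sj; have := bound _ sj => jN; have := nmin `|(j - (N - 3))%R|%N.
by rewrite (_ : N - 3 + _ = j); [move=> /(_ sj); lia | lia].
Qed.

(** Saturation is local: functions that agree on one side of J have the same
    sums there. *)
Section Agree.
Variables (e f : int -> int) (J : int).

Lemma dP_low i : (forall s, s <= J -> e s = f s) -> i + 2 <= J -> dP e i = dP f i.
Proof. by move=> ef iJ; rewrite /dP !ef; lia. Qed.
Lemma dS_low i : (forall s, s <= J -> e s = f s) -> i + 3 <= J -> dS e i = dS f i.
Proof. by move=> ef iJ; rewrite /dS !ef; lia. Qed.

Lemma dP_high i : (forall s, J <= s -> e s = f s) -> J <= i - 1 -> dP e i = dP f i.
Proof. by move=> ef iJ; rewrite /dP !ef; lia. Qed.
Lemma dT_high i : (forall s, J <= s -> e s = f s) -> J <= i - 1 -> dT e i = dT f i.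
Proof. by move=> ef iJ; rewrite /dT !ef; lia. Qed.
Lemma dS_high i : (forall s, J <= s -> e s = f s) -> J <= i - 2 -> dS e i = dS f i.
Proof. by move=> ef iJ; rewrite /dS !ef; lia. Qed.
Lemma occ_high i : (forall s, J <= s -> e s = f s) -> J <= i - 1 -> occ e i = occ f i.
Proof. by move=> ef iJ; rewrite /occ !ef; lia. Qed.

Lemma sat_high k l i : (forall s, J <= s -> e s = f s) -> J <= i - 2 ->
  sat k l e i = sat k l f i.
Proof. by move=> ef iJ; rewrite /sat (dP_high ef) ?(dS_high ef); lia. Qed.

End Agree.

(** * The function attached to a collection of particles *)

Definition cfg (k : nat) (x : seq (nat * int)) (s : int) : int :=
  tau k (fun w => s * w%:Z) x.

(** Adding a particle of weight l in front of x lowers the positions of x by the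
    interaction A_{l,w}. *)
Definition sh (k l : nat) (x : seq (nat * int)) : seq (nat * int) :=
  [seq (p.1, p.2 - (A k l p.1)%:Z) | p <- x].

Lemma sh_fst k l x : map fst (sh k l x) = map fst x.
Proof. by rewrite /sh -map_comp. Qed.

Lemma tau_sh k l u x : tau k u (sh k l x) = tau k (fun w => u w + (A k l w)%:Z) x.
Proof.
elim: x u => [//|[w h] x IH] u /=; rewrite !IH.
congr (Num.max _ _); rewrite (@eq_tau k _ (fun v => u v + (A k l v)%:Z + (A k w v)%:Z)).
  by lia.
by move=> v; lia.
Qed.

Lemma cfg_sh k l x s : cfg k (sh k l x) s = tau k (fun w => s * w%:Z + (A k l w)%:Z) x.
Proof. exact: tau_sh. Qed.

Lemma cfg_cons k w h x s :
  cfg k ((w, h) :: x) s = Num.max (cfg k x s) (h - s * w%:Z + cfg k (sh k w x) s).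
Proof. by rewrite cfg_sh. Qed.

Lemma sh_cons k l w h x : sh k l ((w, h) :: x) = (w, h - (A k l w)%:Z) :: sh k l x.
Proof. by []. Qed.

Lemma graded_sh k l0 l x : graded l0 (sh k l x) = graded l0 x.
Proof. by rewrite /graded sh_fst. Qed.

Lemma tau_ge0 k u x : 0 <= tau k u x.
Proof. by elim: x u => [//|[w h] x IH] u /=; have := IH u; lia. Qed.

Lemma cfg_ge0 k x s : 0 <= cfg k x s. Proof. exact: tau_ge0. Qed.

Lemma tau_anti k u u' x : (forall w, u w <= u' w) -> tau k u' x <= tau k u x.
Proof.
elim: x u u' => [//|[w h] x IH] u u' uu' /=.
have := IH u u' uu'; have := uu' w.
have := IH (fun v => u v + (A k w v)%:Z) (fun v => u' v + (A k w v)%:Z).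
by move=> /(_ _)/wrap[v|]; [have := uu' v; lia | lia].
Qed.

Lemma cfg_sh_le k l x s : cfg k (sh k l x) s <= cfg k x s.
Proof. by rewrite cfg_sh; apply: tau_anti => w; lia. Qed.

(** Shifting the potential by g costs at most the total of g over x. *)
Lemma tau_lip k u (g : nat -> nat) x :
  tau k u x <= tau k (fun v => u v + (g v)%:Z) x + (\sum_(p <- x) g p.1)%N%:Z.
Proof.
elim: x u => [|[w h] x IH] u /=; first by rewrite big_nil.
rewrite big_cons /= PoszD; have h1 := IH u.
have := IH (fun v => u v + (A k w v)%:Z).
rewrite (@eq_tau k (fun v => u v + (A k w v)%:Z + (g v)%:Z)
           (fun v => u v + (g v)%:Z + (A k w v)%:Z)); first by lia.
by move=> v; lia.
Qed.

Lemma tau_convex k u d x :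
  2 * tau k u x <= tau k (fun w => u w - d w) x + tau k (fun w => u w + d w) x.
Proof.
elim: x u => [//|[w h] x IH] u /=.
have h1 := IH u; have := IH (fun v => u v + (A k w v)%:Z).
rewrite (@eq_tau k (fun v => u v + (A k w v)%:Z - d v)
           (fun v => u v - d v + (A k w v)%:Z)); last by move=> v; lia.
rewrite (@eq_tau k (fun v => u v + (A k w v)%:Z + d v)
           (fun v => u v + d v + (A k w v)%:Z)); last by move=> v; lia.
lia.
Qed.

Lemma tw0 k l x s : tw k l 0 x s = cfg k x s.
Proof. by apply: eq_tau => w; rewrite mul0r addr0. Qed.
Lemma tw1 k l x s : tw k l 1 x s = cfg k (sh k l x) s.
Proof. by rewrite cfg_sh; apply: eq_tau => w; rewrite mul1r. Qed.
Lemma tw2 k l x s : tw k l 2 x s = cfg k (sh k l (sh k l x)) s.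
Proof. by rewrite cfg_sh tau_sh; apply: eq_tau => w; lia. Qed.

Section Cfg.
Variables (k l : nat) (x : seq (nat * int)).
Hypotheses (lk : (l <= k)%N) (gx : graded l x).

(** Convexity holds for every maximum of affine functions; the other three
    bounds come from the exchange principle. *)
Lemma cfg_conf : conf k l (cfg k x).
Proof.
split=> i.
- have := @tau_convex k (fun w => i * w%:Z) (fun w => w%:Z) x.
  rewrite /= /occ /cfg (@eq_tau k (fun w => (i - 1) * w%:Z) (fun w => i * w%:Z - w%:Z)).
    rewrite (@eq_tau k (fun w => (i + 1) * w%:Z) (fun w => i * w%:Z + w%:Z)). by rewrite addrAC subr_ge0.
    by move=> v; lia.
  by move=> v; lia.
- by have := tw_P lk gx 0 i; rewrite !tw0 /dP; lia.
- by have := tw_T lk gx 0 i; rewrite !tw0 /dT; lia.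
- by have := tw_S lk gx 0 i; rewrite !tw0 /dS; lia.
Qed.

Lemma cfg_mono s : cfg k x s + cfg k (sh k l x) (s + 1)
  <= cfg k x (s + 1) + cfg k (sh k l x) s + l%:Z.
Proof. by have := tw_mono lk gx 0 s; rewrite !tw0 !tw1. Qed.

Lemma cfg_star s :
  let E := cfg k x in let F := cfg k (sh k l x) in
  [\/ E (s + 1) + F s <= F (s - 1) + E (s + 2),
      E (s + 1) + F s <= F (s - 2) + E (s + 3) - (k - l)%N%:Z |
      E (s + 1) + F s <= E s + F (s + 1) - l%:Z].
Proof. by have := tw_star lk gx 0 s; rewrite !tw0 !tw1. Qed.

End Cfg.

Lemma cfg_spread k l x s : (0 < l <= k)%N -> graded l.-1 x ->
  cfg k x (s + 1) + cfg k (sh k l (sh k l x)) s <=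
  cfg k (sh k l x) s + cfg k (sh k l x) (s + 1) + (l.-1 + (l - (k - l)))%N%:Z.
Proof.
by move=> /andP[l0 lk] gx; have := tw_spread 0 s lk gx l0; rewrite tw0 tw2 !tw1.
Qed.

Lemma tau_right k (g : nat -> int) x : all (fun w => 0 < w)%N (map fst x) ->
  exists N, forall s, N <= s -> tau k (fun w => s * w%:Z + g w) x = 0.
Proof.
elim: x g => [|[w h] x IH] g /=; first by exists 0.
move=> /andP[w0 x0]; have [N1 H1] := IH g x0.
have [N2 H2] := IH (fun v => g v + (A k w v)%:Z) x0.
exists (Num.max (Num.max N1 N2) (Num.max 0 (h - g w))) => s sN.
rewrite H1; last by lia.
rewrite (@eq_tau k _ (fun v => s * v%:Z + (g v + (A k w v)%:Z))); last by move=> v; lia.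
rewrite H2; last by lia.
by apply/max_idPl; nia.
Qed.

Lemma cfg_right k l x : graded l x -> exists N, forall s, N <= s -> cfg k x s = 0.
Proof.
move=> /andP[xl _]; have [|N H] := @tau_right k (fun=> 0) x.
  by apply: sub_all xl => w /andP[].
by exists N => s /H; rewrite /cfg => <-; apply: eq_tau => w; rewrite addr0.
Qed.

Lemma tau_left k (g : nat -> int) x : all (fun w => 0 < w)%N (map fst x) ->
  exists N c, forall s, s <= N ->
    tau k (fun w => s * w%:Z + g w) x = c - s * (\sum_(p <- x) p.1)%N%:Z.
Proof.
elim: x g => [|[w h] x IH] g /=.
  by exists 0, 0 => s _; rewrite big_nil mulr0 subr0.
move=> /andP[w0 x0]; have [N1 [c1 H1]] := IH g x0.
have [N2 [c2 H2]] := IH (fun v => g v + (A k w v)%:Z) x0.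
exists (Num.min (Num.min N1 N2) (Num.min 0 (h - g w + c2 - c1))), (h - g w + c2) => s sN.
rewrite H1; last by lia.
rewrite (@eq_tau k _ (fun v => s * v%:Z + (g v + (A k w v)%:Z))); last by move=> v; lia.
rewrite H2 ?big_cons /=; last by lia.
rewrite PoszD mulrDr; set n := (\sum_(p <- x) p.1)%N.
have : s * w%:Z <= s by nia.
lia.
Qed.

Lemma cfg_left k l x : graded l x -> exists N c, forall s, s <= N ->
  cfg k x s = c - s * (\sum_(p <- x) p.1)%N%:Z.
Proof.
move=> /andP[xl _]; have [|N [c H]] := @tau_left k (fun=> 0) x.
  by apply: sub_all xl => w /andP[].
by exists N, c => s /H <-; apply: eq_tau => w; rewrite addr0.
Qed.

(** By [cfg_mono] the branch containing a front particle of weight l dominates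
    exactly on a half line (-oo, i]. *)
Lemma cfg_cross k l x h : (0 < l <= k)%N -> graded l x ->
  exists i, forall s, (cfg k x s <= h - s * l%:Z + cfg k (sh k l x) s) = (s <= i).
Proof.
move=> /andP[l0 lk] gx; pose C := (\sum_(p <- x) A k l p.1)%N.
have mono (s : int) : cfg k x (s + 1) <= h - (s + 1) * l%:Z + cfg k (sh k l x) (s + 1) ->
   cfg k x s <= h - s * l%:Z + cfg k (sh k l x) s.
  by have := cfg_mono lk gx s; lia.
apply: (@int_threshold _ (- `|h| - C%:Z) (`|h| + 1) mono).
  set s := (X in cfg k x X).
  have := @tau_lip k (fun w => s * w%:Z) (A k l) x; rewrite -/C -cfg_sh -/(cfg k x s).
  by rewrite {}/s; nia.
set s := (X in cfg k x X); have := cfg_sh_le k l x s.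
by rewrite {}/s; nia.
Qed.

(** * Moving the front particle of a block of equal weights *)

Definition blk (l : nat) (hs : seq int) : seq (nat * int) := [seq (l, h) | h <- hs].

Lemma blk_cons l h hs y : blk l (h :: hs) ++ y = (l, h) :: (blk l hs ++ y).
Proof. by []. Qed.

(** Up to i, and only there, the optimal sub-collections at s may contain a
    front particle of weight l and position h added to x. *)
Definition cross (k l : nat) (h : int) (x : seq (nat * int)) (i : int) : Prop :=
  forall s, (cfg k x s <= h - s * l%:Z + cfg k (sh k l x) s) = (s <= i).

Lemma graded_head l h x : (0 < l)%N -> graded l x -> graded l ((l, h) :: x).
Proof.
move=> l0 /andP[xa xs]; apply/andP; split=> /=; first by rewrite l0 leqnn.
have tr : transitive geq by move=> a b c ba ac; apply: leq_trans ac ba.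
by rewrite (path_sortedE tr) xs andbT; apply: sub_all xa => w /andP[].
Qed.

Lemma graded_low l x : graded l.-1 x -> graded l x.
Proof.
case/andP=> xa xs; apply/andP; split=> //.
by apply: sub_all xa => w /andP[w0 wl]; rewrite w0 (leq_trans wl) ?leq_pred.
Qed.

Lemma graded_blk l hs y : (0 < l)%N -> graded l.-1 y -> graded l (blk l hs ++ y).
Proof.
move=> l0; elim: hs => [|h hs IH] gy /=; first exact: graded_low.
exact/graded_head/IH.
Qed.

Lemma sh_blk k l hs y :
  sh k l (blk l hs ++ y) = blk l [seq h - (A k l l)%:Z | h <- hs] ++ sh k l y.
Proof. by rewrite /sh /blk map_cat -!map_comp. Qed.

Lemma unsat_low k l y j : (0 < l <= k)%N -> graded l.-1 y -> ~~ sat k l (cfg k y) j.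
Proof.
move=> /andP[l0 lk] gy; have l1k : (l.-1 <= k)%N by lia.
have := conf_P (cfg_conf l1k gy) j; have := conf_S (cfg_conf l1k gy) j.
by rewrite /sat; lia.
Qed.

Section Blocks.
Variables (k l : nat).
Hypothesis (l0k : (0 < l <= k)%N).

Let l0 : (0 < l)%N. Proof. by case/andP: l0k. Qed.
Let lk : (l <= k)%N. Proof. by case/andP: l0k. Qed.

(** Raising h by 1 raises by 1 the branch containing the particle, which wins
    exactly up to the crossing index. *)
Lemma cross_bump h x i : cross k l h x i ->
  bump 1 (cfg k ((l, h) :: x)) i =1 cfg k ((l, h + 1) :: x).
Proof. by move=> ci s; rewrite /bump !cfg_cons; have := ci s; lia. Qed.

Lemma cross_back h x i : cross k l (h - 1) x i ->
  bump (- 1) (cfg k ((l, h) :: x)) i =1 cfg k ((l, h - 1) :: x).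
Proof. by move=> ci s; rewrite /bump !cfg_cons; have := ci s; lia. Qed.

(** The first two alternatives of [cfg_star] make dP, respectively dS, reach its
    bound at the crossing index; the third one contradicts the crossing. *)
Lemma cross_sat h x i : graded l x -> cross k l h x i -> sat k l (cfg k ((l, h) :: x)) i.
Proof.
move=> gx ci; have gx' := graded_head h l0 gx.
have := conf_P (cfg_conf lk gx') i; have := conf_S (cfg_conf lk gx') i.
rewrite /sat /dP /dS.
have eE s : cfg k x s <= cfg k ((l, h) :: x) s by rewrite cfg_cons; lia.
have eF s : h - s * l%:Z + cfg k (sh k l x) s <= cfg k ((l, h) :: x) s.
  by rewrite cfg_cons; lia.
have ei : cfg k ((l, h) :: x) i = h - i * l%:Z + cfg k (sh k l x) i.
  by rewrite cfg_cons; have := ci i; lia.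
have ei1 : cfg k ((l, h) :: x) (i + 1) = cfg k x (i + 1).
  by rewrite cfg_cons; have := ci (i + 1); lia.
have := eF (i - 1); have := eF (i - 2); have := eE (i + 2); have := eE (i + 3).
have := ci (i + 1); have := ci i; have := eF (i + 1).
have star : [\/ cfg k x (i + 1) + cfg k (sh k l x) i <= cfg k (sh k l x) (i - 1) + cfg k x (i + 2),
  cfg k x (i + 1) + cfg k (sh k l x) i <= cfg k (sh k l x) (i - 2) + cfg k x (i + 3) - (k - l)%N%:Z |
  cfg k x (i + 1) + cfg k (sh k l x) i <= cfg k x i + cfg k (sh k l x) (i + 1) - l%:Z].
  exact: cfg_star lk gx i.
by rewrite ei ei1; case: star; lia.
Qed.

Lemma cross_sat_low h x i : graded l x -> cross k l (h - 1) x i ->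
  sat k l (cfg k ((l, h) :: x)) i.
Proof.
move=> gx ci; rewrite -(@sat_bump k l _ (- 1)) (eq_saturated k l (cross_back ci)).
exact: cross_sat.
Qed.

(** To the right of the crossing the function is the one of x, which is not
    saturated there; the two sums that straddle the crossing would exceed their
    bounds after the move if they were saturated. *)
Lemma lastsat_shift h x i : graded l x -> cross k l h x i ->
  (forall j, i < j -> ~~ sat k l (cfg k x) j) -> lastsat k l (cfg k ((l, h) :: x)) i.
Proof.
move=> gx ci ns; split; first exact: cross_sat.
move=> j ij; have ce := cfg_conf lk (graded_head h l0 gx).
have ce' := cfg_conf lk (graded_head (h + 1) l0 gx).
have eqr (s : int) : i < s -> cfg k ((l, h) :: x) s = cfg k x s.
  by move=> si; rewrite cfg_cons; have := ci s; lia.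
apply/(unsatP _ ce); have /(unsatP _ (cfg_conf lk gx))[] := ns j ij.
have cP := conf_P ce' j; have cS := conf_S ce' j.
rewrite -(eq_dP (cross_bump ci)) dP_bump in cP.
rewrite -(eq_dS (cross_bump ci)) dS_bump in cS.
have [jE|j1] := eqVneq j (i + 1); first by rewrite jE in cP cS *; lia.
have eP : dP (cfg k ((l, h) :: x)) j = dP (cfg k x) j by rewrite /dP !eqr //; lia.
have [jE|j2] := eqVneq j (i + 2); first by rewrite jE in cP cS eP *; lia.
by rewrite eP /dS !eqr //; lia.
Qed.

(** Among particles of equal weight l the foremost one crosses last, so the
    remaining ones cause no saturation further to the right. *)
Lemma top_lastsat h hs y i : sorted (fun a b : int => b <= a) (h :: hs) ->
  graded l.-1 y -> cross k l h (blk l hs ++ y) i ->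
  lastsat k l (cfg k (blk l (h :: hs) ++ y)) i.
Proof.
elim: hs h y i => [|h' hs IH] h y i srt gy ci.
  apply: lastsat_shift => //; first exact: graded_low.
  by move=> j _; apply: unsat_low.
have gx := graded_blk (h' :: hs) l0 gy; have gr := graded_blk hs l0 gy.
apply: lastsat_shift => // j ij.
have [i' ci'] := cfg_cross h' l0k gr.
have /andP[hh' srt'] : (h' <= h) && sorted (fun a b : int => b <= a) (h' :: hs) by [].
have [_ ni'] := IH h' y i' srt' gy ci'.
apply: ni'; apply: le_lt_trans ij.
rewrite -ci blk_cons sh_cons !cfg_cons.
by have := ci' i'; have := cfg_sh_le k l (blk l hs ++ y) i'; lia.
Qed.

Lemma firstsat_shift h x i : graded l x -> cross k l (h - 1) x i ->
  (forall j, j < i -> ~~ sat k l (cfg k (sh k l x)) j) ->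
  firstsat k l (cfg k ((l, h) :: x)) i.
Proof.
move=> gx ci ns; split; first exact: cross_sat_low.
move=> j ij; have ce := cfg_conf lk (graded_head h l0 gx).
have ce' := cfg_conf lk (graded_head (h - 1) l0 gx).
have gs : graded l (sh k l x) by rewrite graded_sh.
have eqr (s : int) : s <= i -> cfg k ((l, h) :: x) s = h - s * l%:Z + cfg k (sh k l x) s.
  by move=> si; rewrite cfg_cons; have := ci s; lia.
apply/(unsatP _ ce); have /(unsatP _ (cfg_conf lk gs))[] := ns j ij.
have cP := conf_P ce' j; have cS := conf_S ce' j.
rewrite -(eq_dP (cross_back ci)) dP_bump in cP.
rewrite -(eq_dS (cross_back ci)) dS_bump in cS.
have [jE|j1] := eqVneq j (i - 1); first by rewrite jE in cP cS *; lia.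
have eP : dP (cfg k ((l, h) :: x)) j = dP (cfg k (sh k l x)) j by rewrite /dP !eqr; lia.
have [jE|j2] := eqVneq j (i - 2); first by rewrite jE in cP cS eP *; lia.
by rewrite eP /dS !eqr; lia.
Qed.

(** The mirror image of [top_lastsat]: to the left of the crossing of the
    hindmost particle the other particles feel its interaction, whence the
    induction on shifted collections. *)
Lemma bottom_firstsat h hs y i : sorted (fun a b : int => a <= b) (h :: hs) ->
  graded l.-1 y -> cross k l (h - 1) (blk l hs ++ y) i ->
  firstsat k l (cfg k (blk l (h :: hs) ++ y)) i.
Proof.
have [n sz] := ubnP (size hs); elim: n hs h y i sz => // n IH [|h' hs] h y i sz srt gy ci.
  apply: firstsat_shift => //; first exact: graded_low.
  by move=> j _; apply: unsat_low; rewrite ?graded_sh.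
have gx := graded_blk (h' :: hs) l0 gy; have gr := graded_blk hs l0 gy.
apply: firstsat_shift => // j ij.
have gsy : graded l.-1 (sh k l y) by rewrite graded_sh.
have gsr : graded l (sh k l (blk l hs ++ y)) by rewrite graded_sh.
pose c := (A k l l)%:Z.
have [i' ci'] := cfg_cross (h' - c - 1) l0k gsr.
have /andP[hh' srt'] : (h <= h') && sorted (fun a b : int => a <= b) (h' :: hs) by [].
have srtc : sorted (fun a b : int => a <= b) (h' - c :: [seq z - c | z <- hs]).
  rewrite (_ : _ :: _ = map (fun z => z - c) (h' :: hs)) // sorted_map.
  by apply: sub_sorted srt' => a b /=; lia.
have := IH [seq z - c | z <- hs] (h' - c) (sh k l y) i' _ srtc gsy.
rewrite size_map => /(_ sz); rewrite -sh_blk => /(_ ci')[_ ni'].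
suff: ~~ sat k l (cfg k (sh k l (blk l (h' :: hs) ++ y))) j by [].
rewrite sh_blk; apply: ni'; apply: lt_le_trans ij _.
rewrite -ci'; have := ci i; rewrite blk_cons sh_cons !cfg_cons lexx.
by have := ci (i + 1); rewrite blk_cons sh_cons !cfg_cons -/c; move: hh'; clear; lia.
Qed.

End Blocks.

(** * Injectivity *)

Lemma AC k v w : A k v w = A k w v. Proof. by rewrite /A; lia. Qed.

Lemma tau_swap k u p q x : tau k u (p :: q :: x) = tau k u (q :: p :: x).
Proof.
case: p q => [w h] [w' h'] /=; rewrite (AC k w' w).
rewrite (@eq_tau k (fun v => u v + (A k w' v)%:Z + (A k w v)%:Z)
  (fun v => u v + (A k w v)%:Z + (A k w' v)%:Z)); first by lia.
by move=> v; lia.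
Qed.

Lemma tau_cons k u w h x : tau k u ((w, h) :: x) =
  Num.max (tau k u x) (h - u w + tau k (fun v => u v + (A k w v)%:Z) x).
Proof. by []. Qed.

Lemma tau_pull k u x p y : tau k u (x ++ p :: y) = tau k u (p :: x ++ y).
Proof.
elim: x u => [//|[w h] x IH] u.
have -> : tau k u (p :: ((w, h) :: x) ++ y) = tau k u ((w, h) :: p :: x ++ y).
  exact: tau_swap.
by rewrite cat_cons !tau_cons !IH.
Qed.

Lemma tau_perm k u x y : perm_eq x y -> tau k u x = tau k u y.
Proof.
elim: x u y => [|[w h] x IH] u y pxy.
  by have := perm_size pxy; case: y pxy.
have py : (w, h) \in y by rewrite -(perm_mem pxy) mem_head.
case/splitPr: y / py pxy => y1 y2 pxy; rewrite tau_pull.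
have pxy' : perm_eq x (y1 ++ y2).
  by rewrite -(perm_cons (w, h)) (permPl pxy) perm_catC /= perm_cons perm_catC.
by rewrite /= (IH _ _ pxy') (IH _ _ pxy').
Qed.

Lemma cfg_perm k x y s : perm_eq x y -> cfg k x s = cfg k y s.
Proof. exact: tau_perm. Qed.

(** Decreasing weights, then decreasing positions: sorted lists stand for
    multisets of particles. *)
Definition ordrel (p q : nat * int) : bool :=
  (q.1 < p.1)%N || ((q.1 == p.1) && (q.2 <= p.2)).

Definition canon (l : nat) (x : seq (nat * int)) : bool :=
  all (fun w => 0 < w <= l)%N (map fst x) && sorted ordrel x.

Lemma ordrel_trans : transitive ordrel.
Proof. by move=> [a a'] [b b'] [c c']; rewrite /ordrel /=; lia. Qed.

Lemma canon_graded l x : canon l x -> graded l x.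
Proof.
case/andP=> xa xs; apply/andP; split=> //; rewrite sorted_map.
by apply: sub_sorted xs => [[a a'] [b b']]; rewrite /ordrel /=; lia.
Qed.

Lemma canon_blk l hs y : (0 < l)%N -> sorted (fun a b : int => b <= a) hs ->
  canon l.-1 y -> canon l (blk l hs ++ y).
Proof.
move=> l0; elim: hs => [|h hs IH] shs cy.
  case/andP: cy => ya ys; apply/andP; split=> //.
  by apply: sub_all ya => w /andP[w0 wl]; rewrite w0 (leq_trans wl) ?leq_pred.
have /andP[ga gs] := IH (path_sorted shs) cy; apply/andP; split=> /=.
  by rewrite l0 leqnn.
rewrite (path_sortedE ordrel_trans) gs andbT all_cat; apply/andP; split.
  have tr : transitive (fun a b : int => b <= a) by move=> a b c; lia.
  have := order_path_min tr shs; rewrite all_map.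
  by apply: sub_all => g gh /=; rewrite /ordrel /= eqxx gh orbT.
case/andP: cy => ya _; move: ya; rewrite all_map; apply: sub_all => p /= /andP[p0 pl].
by rewrite /ordrel /=; lia.
Qed.

Lemma canonP l x : (0 < l)%N -> canon l x ->
  exists hs y, [/\ x = blk l hs ++ y, sorted (fun a b : int => b <= a) hs & canon l.-1 y].
Proof.
move=> l0; elim: x => [|[w h] x IH] cx; first by exists [::], [::].
case/andP: (cx) => /= /andP[/andP[w0 wl] xa] xs.
have cx' : canon l x by rewrite /canon xa (path_sorted xs).
have [hs [y [xE shs cy]]] := IH cx'.
move: wl; rewrite leq_eqVlt => /orP[/eqP wE|wl].
  exists (h :: hs), y; split=> //; first by rewrite xE wE.
  case: hs xE shs => [//|g hs] xE shs; apply/andP; split; last exact: shs.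
  by move: xs; rewrite xE wE /= /ordrel /= => /andP[]; lia.
exists [::], ((w, h) :: x); split=> //; apply/andP; split=> //=.
apply/andP; split; first by rewrite w0; lia.
have := order_path_min ordrel_trans xs; rewrite all_map => xo.
apply/allP => p px; have := allP xo p px; have := allP xa p.1 (map_f _ px).
by rewrite /ordrel /=; lia.
Qed.

Lemma canon_low l x : canon l.-1 x -> canon l x.
Proof.
case/andP=> xa xs; apply/andP; split=> //.
by apply: sub_all xa => w /andP[w0 wl]; rewrite w0 (leq_trans wl) ?leq_pred.
Qed.

Lemma canon_sh k l l0 x : canon l0 (sh k l x) = canon l0 x.
Proof.
rewrite /canon sh_fst /sh sorted_map; congr (_ && _).
apply: eq_sorted => -[a a'] [b b']; rewrite /ordrel /=.
by have [->|] := eqVneq b a; rewrite /= ?lerBlDr ?subrK //; lia.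
Qed.

Lemma sh_inj k l : injective (sh k l).
Proof.
apply: inj_map => -[a a'] [b b'] /= [-> e]; congr pair; lia.
Qed.

Section Injective.
Variables (k : nat).
Local Notation desc := (sorted (fun a b : int => b <= a)).

Lemma desc_up h hs : desc (h :: hs) -> desc (h + 1 :: hs).
Proof. by case: hs => [//|g hs] /= /andP[gh ->]; rewrite andbT; lia. Qed.

Lemma top_step l h hs y : (0 < l <= k)%N -> desc (h :: hs) -> graded l.-1 y ->
  exists i, lastsat k l (cfg k (blk l (h :: hs) ++ y)) i /\
  bump 1 (cfg k (blk l (h :: hs) ++ y)) i =1 cfg k (blk l (h + 1 :: hs) ++ y).
Proof.
move=> l0k hh gy; have /andP[l0 lk] := l0k.
have [i ci] := cfg_cross h l0k (graded_blk hs l0 gy).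
by exists i; split; [exact: top_lastsat | exact: cross_bump].
Qed.

(** Moves are determined by the function alone, so two collections with the same
    function keep the same function when their front particles advance. *)
Lemma top_steps l h hs y g gs z n : (0 < l <= k)%N -> desc (h :: hs) ->
  graded l.-1 y -> desc (g :: gs) -> graded l.-1 z ->
  cfg k (blk l (h :: hs) ++ y) =1 cfg k (blk l (g :: gs) ++ z) ->
  cfg k (blk l (h + n%:Z :: hs) ++ y) =1 cfg k (blk l (g + n%:Z :: gs) ++ z).
Proof.
move=> l0k; elim: n h g => [|n IH] h g hh gy hg gz e; first by rewrite !addr0.
have [i [li bi]] := top_step l0k hh gy; have [i' [li' bi']] := top_step l0k hg gz.
have ii' := lastsat_uniq (eq_lastsat e li) li'.
rewrite (_ : h + n.+1%:Z = h + 1 + n%:Z); last by lia.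
rewrite (_ : g + n.+1%:Z = g + 1 + n%:Z); last by lia.
apply: IH => //; [exact: desc_up | exact: desc_up |].
by move=> s; rewrite -bi -bi' /bump ii' e.
Qed.

(** A function is saturated somewhere exactly when there is a particle of weight
    l.  If both collections have one, push the front particles so far that their
    branches win at a given s: the functions of the remaining collections then
    agree up to the interaction shift. *)
Lemma cfg_inj l x y : (l <= k)%N -> canon l x -> canon l y ->
  cfg k x =1 cfg k y -> x = y.
Proof.
elim: l x y => [|l IHl] x y lk cx cy.
  by case: x cx => [|[[]] //]; case: y cy => [|[[]]].
have l0k : (0 < l.+1 <= k)%N by [].
have [n sz] := ubnP (size x); elim: n x y cx cy sz => // n IH x y cx cy sz e.
have [hs [x0 [xE hs_s cx0]]] := canonP (ltn0Sn l) cx.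
have [gs [y0 [yE gs_s cy0]]] := canonP (ltn0Sn l) cy.
have gx0 := canon_graded cx0; have gy0 := canon_graded cy0.
case: hs xE hs_s => [|h hs] xE hs_s; case: gs yE gs_s => [|g gs] yE gs_s.
- by rewrite xE yE; apply: IHl => //; rewrite -?xE -?yE //; lia.
- have [i [[si _] _]] := top_step l0k gs_s gy0; move: si.
  by rewrite -yE -(eq_saturated k l.+1 e) xE (negPf (unsat_low _ l0k gx0)).
- have [i [[si _] _]] := top_step l0k hs_s gx0; move: si.
  by rewrite -xE (eq_saturated k l.+1 e) yE (negPf (unsat_low _ l0k gy0)).
pose x' := blk l.+1 hs ++ x0; pose y' := blk l.+1 gs ++ y0.
have big s : h + cfg k (sh k l.+1 x') s = g + cfg k (sh k l.+1 y') s.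
  pose n' := (`|cfg k x' s| + `|cfg k y' s| + `|h| + `|g| + `|(s * l.+1%:Z)%R|)%N.
  rewrite xE yE in e; have := top_steps n' l0k hs_s gx0 gs_s gy0 e s.
  rewrite !blk_cons -/x' -/y' !cfg_cons.
  have := cfg_ge0 k (sh k l.+1 x') s; have := cfg_ge0 k (sh k l.+1 y') s.
  by rewrite /n'; clear; lia.
have cx' : canon l.+1 x' by apply: canon_blk => //; apply: path_sorted hs_s.
have cy' : canon l.+1 y' by apply: canon_blk => //; apply: path_sorted gs_s.
have gh : h = g.
  have [N1 H1] : exists N, forall s, N <= s -> cfg k (sh k l.+1 x') s = 0.
    by apply: (@cfg_right k l.+1); rewrite graded_sh; apply: canon_graded.
  have [N2 H2] : exists N, forall s, N <= s -> cfg k (sh k l.+1 y') s = 0.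
    by apply: (@cfg_right k l.+1); rewrite graded_sh; apply: canon_graded.
  by have := big (Num.max N1 N2); rewrite H1 ?H2; clear; lia.
suff : x' = y' by rewrite xE yE !blk_cons gh -/x' -/y' => ->.
apply: (@sh_inj k l.+1); apply: IH; rewrite ?canon_sh //.
  by rewrite size_map; move: sz; rewrite xE blk_cons /= -/x'; clear; lia.
by move=> s; have := big s; rewrite gh; clear; lia.
Qed.

End Injective.

(** * The phantom of two coinciding front particles *)

Definition affine (a b : int) (e : int -> int) (s : int) : int := a - s * b + e s.

Lemma occ_affine a b e i : occ (affine a b e) i = occ e i.
Proof. by rewrite /occ /affine; lia. Qed.
Lemma dP_affine a b e i : dP (affine a b e) i = dP e i.
Proof. by rewrite /dP /affine; lia. Qed.
Lemma dT_affine a b e i : dT (affine a b e) i = dT e i.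
Proof. by rewrite /dT /affine; lia. Qed.
Lemma dS_affine a b e i : dS (affine a b e) i = dS e i.
Proof. by rewrite /dS /affine; lia. Qed.

Lemma conf_affine k l a b e : conf k l e -> conf k l (affine a b e).
Proof.
by move=> [cO cP cT cS]; split=> i; rewrite ?occ_affine ?dP_affine ?dT_affine ?dS_affine.
Qed.

Lemma sat_affine k l a b e i : sat k l (affine a b e) i = sat k l e i.
Proof. by rewrite /sat dP_affine dS_affine. Qed.

Section Phantom.
Variables (k l : nat) (y : seq (nat * int)).
Hypotheses (l0k : (0 < l <= k)%N) (gy : graded l.-1 y).

Let l0 : (0 < l)%N. Proof. by case/andP: l0k. Qed.
Let lk : (l <= k)%N. Proof. by case/andP: l0k. Qed.

Definition follower (h : int) : int -> int :=
  affine h l%:Z (cfg k (sh k l ((l, h + 1) :: y))).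

(** If the collection with two front particles at h + 1 arose by a move, the
    function before the move would be the maximum of the branch containing
    neither particle and of the branches containing one or both of them, lowered
    by one.  The latter form [follower]: a front particle at h, joined to y and
    one particle at h + 1. *)
Definition phantom (h : int) (s : int) : int := Num.max (cfg k y s) (follower h s).

Lemma followerE h s : follower h s = h - s * l%:Z +
  Num.max (cfg k (sh k l y) s)
    (h + 1 - (A k l l)%:Z - s * l%:Z + cfg k (sh k l (sh k l y)) s).
Proof. by rewrite /follower /affine sh_cons cfg_cons. Qed.

Lemma phantom_threshold h :
  exists J, forall s, (cfg k y s <= follower h s) = (s <= J).
Proof.
have gy' := graded_low gy.
have gsy : graded l (sh k l y) by rewrite graded_sh.
have [i ci] := cfg_cross h l0k gy'.
have [N HN] : exists N, forall s, N <= s -> cfg k (sh k l ((l, h + 1) :: y)) s = 0.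
  by apply: (@cfg_right k l); rewrite graded_sh; apply: graded_head.
apply: (@int_threshold _ i (Num.max N (`|h| + 1))).
- move=> s; rewrite !followerE.
  by have := cfg_mono lk gy' s; have := cfg_mono lk gsy s; lia.
- by rewrite followerE; have := ci i; lia.
rewrite /follower /affine HN; last by lia.
by have := cfg_ge0 k y (Num.max N (`|h| + 1)); nia.
Qed.

Lemma phantom_bump h J : (forall s, (cfg k y s <= follower h s) = (s <= J)) ->
  bump 1 (phantom h) J =1 cfg k ((l, h + 1) :: (l, h + 1) :: y).
Proof.
move=> HJ s; rewrite /bump /phantom; have := HJ s.
by rewrite followerE cfg_cons sh_cons !cfg_cons; lia.
Qed.

(** If the phantom at h satisfied all the bounds, so would the one at h + 1: with
    J the threshold of the phantom and i the last saturated index of the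
    follower, bumping at J gives the function of two particles at h + 1, and i is
    admissible for a further move; the result is the phantom at h + 1. *)
Lemma phantom_step h : conf k l (phantom h) -> conf k l (phantom (h + 1)).
Proof.
move=> ce; set e := phantom h in ce; set V := follower h.
have gy' := graded_low gy.
have gsy : graded l.-1 (sh k l y) by rewrite graded_sh.
have gx : graded l ((l, h + 1) :: y) by apply: graded_head.
have gxx : graded l ((l, h + 1) :: (l, h + 1) :: y) by apply: graded_head.
have gsx : graded l (sh k l ((l, h + 1) :: y)) by rewrite graded_sh.
have cV : conf k l V by apply/conf_affine/cfg_conf.
have [i ci] := cfg_cross (h + 1 - (A k l l)%:Z) l0k (graded_low gsy).
have [sVi nVi] : lastsat k l V i.
  have [si ni] : lastsat k l (cfg k (sh k l ((l, h + 1) :: y))) i.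
    by apply: (@top_lastsat k l l0k _ [::] (sh k l y)).
  by split=> [|j ij]; rewrite sat_affine //; apply: ni.
have [J HJ] := phantom_threshold h.
have lowE s : s <= J -> e s = V s.
  by move=> sJ; rewrite /e /phantom -/V; have := HJ s; rewrite -/V; lia.
have highE s : J < s -> V s < e s.
  by move=> sJ; rewrite /e /phantom -/V; have := HJ s; rewrite -/V; lia.
have geE s : V s <= e s by rewrite /e /phantom -/V; lia.
have cJ := phantom_bump HJ; rewrite -/e in cJ; set c := bump 1 e J in cJ.
have cc : conf k l c by apply: eq_conf (cfg_conf lk gxx) => s; rewrite cJ.
have nJ : ~~ sat k l e (J + 1).
  apply/(unsatP _ ce); have := conf_P cc (J + 1); have := conf_S cc (J + 1).
  by rewrite /c dP_bump dS_bump; clear; lia.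
have iJ1 : i + 1 <= J.
  rewrite leNgt; apply/negP => Ji; have := HJ (i + 1); have := ci i.
  have := cfg_spread i l0k gy; rewrite /V followerE.
  have AE : (A k l l)%:Z = 2 * l%:Z + (l - (k - l))%N%:Z by move: lk; rewrite /A; clear; lia.
 by move: Ji l0 lk; rewrite AE; clear; lia.
have PS : dP V i = l%:Z \/ dS V i = (k + l)%N%:Z by move: sVi; rewrite /sat; lia.
have iJ2 : i + 2 <= J.
  rewrite leNgt; apply/negP => Ji; have JE : J = i + 1 by lia.
  have := conf_P ce i; have := conf_S ce i; move: PS.
  have h2 : V (i + 2) < e (i + 2) by apply: highE; rewrite JE; clear; lia.
  have h3 : V (i + 3) < e (i + 3) by apply: highE; rewrite JE; clear; lia.
  have l0' s : s <= i + 1 -> e s = V s by move=> si; apply: lowE; move: si; rewrite ?JE; clear; lia.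
  rewrite /dP /dS (l0' (i - 2)) ?(l0' (i - 1)) ?(l0' i) ?(l0' (i + 1)); try (clear; lia).
  by clear -h2 h3; lia.
have PVi : dP e i = l%:Z \/ (dS e i = (k + l)%N%:Z /\ i + 3 <= J).
  have := conf_S ce i; move: PS.
  have l0' s : s <= i + 2 -> e s = V s by move=> si; apply: lowE; move: si iJ2; rewrite ?JE; clear; lia.
  rewrite /dP /dS (l0' (i - 2)) ?(l0' (i - 1)) ?(l0' i) ?(l0' (i + 1)) ?(l0' (i + 2));
    try (clear; lia).
  have [h3|h3] := leP (i + 3) J; first by have := lowE (i + 3) h3; move: h3; clear; lia.
  by have := highE (i + 3) h3; clear; lia.
have nV1 : dP V (i + 1) < l%:Z /\ dS V (i + 1) < (k + l)%N%:Z.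
  by apply/(unsatP _ cV)/nVi; clear; lia.
have nV2 : dS V (i + 2) < (k + l)%N%:Z.
  by have /(unsatP _ cV)[] : ~~ sat k l V (i + 2) by apply: nVi; clear; lia.
have sci : sat k l c i.
  by rewrite /sat /c dP_bump dS_bump; case: PVi => [|[]]; move: iJ2; clear; lia.
have nc1 : ~~ sat k l c (i + 1).
  apply/(unsatP _ cc); rewrite /c dP_bump dS_bump; split.
    have [h3|h3] := leP (i + 3) J.
      rewrite (dP_low lowE) ?idxE //.
      by case: nV1 h3; clear; lia.
    by have := conf_P ce (i + 1); move: h3 iJ2; clear; lia.
  have [h3|h3] := leP (i + 4) J.
    rewrite (dS_low lowE) ?idxE //.
    by case: nV1 h3; clear; lia.
  by have := conf_S ce (i + 1); move: h3 iJ2; clear; lia.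
have nc2 : dS c (i + 2) < (k + l)%N%:Z.
  rewrite /c dS_bump; have [h3|h3] := leP (i + 5) J.
    rewrite (dS_low lowE) ?idxE //.
    by move: nV2 h3; clear; lia.
  have := conf_S ce (i + 2); have [JE|JE] := eqVneq J (i + 2).
    rewrite le_eqVlt => /orP[/eqP Se|]; last by rewrite JE; clear; lia.
    have Pe : dP e i = l%:Z by case: PVi => // -[_]; rewrite JE; clear; lia.
    by move: nJ; rewrite JE !idxE (sat_chain ce Pe Se).
  by move: h3 iJ2 JE; clear; lia.
apply: eq_conf (move_conf l0 cc sci nc1 nc2) => s.
rewrite /bump cJ cfg_cons sh_cons !cfg_cons /phantom followerE.
have := ci s; have := HJ s; rewrite followerE; have := HJ i; rewrite followerE.
by move: iJ2; clear; lia.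
Qed.

(** Far to the right of y the phantom is explicit, and violates the bounds. *)
Lemma phantom_absurd h : ~ conf k l (phantom h).
Proof.
move=> ch; have up n : conf k l (phantom (h + n%:Z)).
  elim: n => [|n IH]; first by rewrite addr0.
  by rewrite (_ : h + n.+1%:Z = h + n%:Z + 1); [exact: phantom_step | lia].
have gy' := graded_low gy.
have [N0 H0] := cfg_right k gy'.
have [N1 H1] : exists N, forall s, N <= s -> cfg k (sh k l y) s = 0.
  by apply: (@cfg_right k l); rewrite graded_sh.
have [N2 H2] : exists N, forall s, N <= s -> cfg k (sh k l (sh k l y)) s = 0.
  by apply: (@cfg_right k l); rewrite !graded_sh.
(* At h = m l with m large the values near m do not see y. *)
have [m [mh m0 m1 m2]] : exists m : int, [/\ `|h| <= m, N0 <= m - 4, N1 <= m - 4 & N2 <= m - 4].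
  by exists (`|h| + `|N0| + `|N1| + `|N2| + 4); split; lia.
have [n nE] : exists n : nat, h + n%:Z = m * l%:Z.
  by exists `|(m * l%:Z - h)%R|%N; nia.
have := up n; rewrite nE => cm.
have pE s (t : int) : s = m - t -> t <= 4 -> phantom (m * l%:Z) s =
    Num.max 0 (t * l%:Z + Num.max 0 (1 - (A k l l)%:Z + t * l%:Z)).
  by move=> -> t4; rewrite /phantom followerE H0 ?H1 ?H2 ?mulrBl; lia.
have AE : (A k l l)%:Z = 2 * l%:Z + (l - (k - l))%N%:Z by move: lk; rewrite /A; clear; lia.
have := conf_P cm (m - 1); have := conf_S cm (m - 1); rewrite /dP /dS !idxE.
have e1 := @pE (m - 1) 1 ltac:(lia) isT; have e2 := @pE (m - 2) 2 ltac:(lia) isT.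
have e3 := @pE (m - 3) 3 ltac:(lia) isT; have e0 := @pE m 0 ltac:(lia) isT.
have f1 := @pE (m + 1) (- 1) ltac:(lia) isT; have f2 := @pE (m + 2) (- 2) ltac:(lia) isT.
rewrite e1 e2 e3 e0 f1 f2 AE; move: lk l0; clear; lia.
Qed.

End Phantom.

(** * Backward moves *)

Definition premove (k l : nat) (b : int -> int) i (x : seq (nat * int)) : Prop :=
  [/\ conf k l b, lastsat k l b i & bump 1 b i =1 cfg k x].

Section Double.
Variables (k l : nat).
Hypothesis (l0k : (0 < l <= k)%N).
Local Notation desc := (sorted (fun a b : int => b <= a)).
Local Notation asc := (sorted (fun a b : int => a <= b)).

Let l0 : (0 < l)%N. Proof. by case/andP: l0k. Qed.
Let lk : (l <= k)%N. Proof. by case/andP: l0k. Qed.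

Local Notation premove := (premove k l).

Lemma blk_perm hs gs y : perm_eq hs gs -> perm_eq (blk l hs ++ y) (blk l gs ++ y).
Proof. by move=> hg; rewrite perm_cat2r; apply: perm_map. Qed.

(** Lowering the hindmost particle of weight l commutes with undoing a move, as
    the two take place at different indices f < i: at equal indices the result
    would be the function of a collection whose front particle had been raised,
    against injectivity. *)
Lemma premove_lower b i h g hs y : desc (h :: rcons hs g) -> canon l.-1 y ->
  premove b i (blk l (h :: rcons hs g) ++ y) ->
  exists2 f, f < i & [/\ premove (bump (- 1) b f) i (blk l (h :: rcons hs (g - 1)) ++ y),
     firstsat k l b f & conf k l (bump (- 1) b f)].
Proof.
move=> dh cy [cb lb bb]; have gy := canon_graded cy.
set R := blk l (rev (h :: hs)) ++ y.
have gR : graded l R by apply: graded_blk.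
have pY (a : int) : perm_eq (blk l (h :: rcons hs a) ++ y) ((l, a) :: R).
  by rewrite -blk_cons; apply: blk_perm; rewrite -rcons_cons perm_rcons perm_cons perm_sym perm_rev.
have aR : asc (g :: rev (h :: hs)).
  by rewrite -rev_rcons rcons_cons rev_sorted.
have [i0 ci0] := cfg_cross (g - 1) l0k gR.
have [si0 ni0] := bottom_firstsat l0k aR gy ci0.
rewrite blk_cons -/R in si0 ni0.
have back0 := cross_back l0k ci0; have bbR : bump 1 b i =1 cfg k ((l, g) :: R).
  by move=> s; rewrite bb; apply: cfg_perm.
have sE j : sat k l (cfg k ((l, g) :: R)) j = sat k l (bump 1 b i) j.
  by rewrite (eq_saturated k l bbR).
have sci : sat k l (cfg k ((l, g) :: R)) i by rewrite sE sat_bump; case: lb.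
have i0i : i0 <= i by rewrite leNgt; apply/negP => /ni0; rewrite sci.
have dlow : desc (h :: rcons hs (g - 1)).
  by move: dh; rewrite /= !rcons_path => /andP[-> /= gl]; lia.
have cP m := dP_bump 1 b i m; have cS m := dS_bump 1 b i m.
have ni : i0 != i.
  apply/eqP => i0E; have bE : b =1 cfg k (blk l (h :: rcons hs (g - 1)) ++ y).
    move=> s; rewrite (cfg_perm k s (pY (g - 1))) -back0 i0E /bump -bbR /bump; clear; lia.
  have [i1 [li1 bi1]] := top_step l0k dlow gy.
  have i1E := lastsat_uniq (eq_lastsat bE lb) li1.
  have : blk l (h + 1 :: rcons hs (g - 1)) ++ y = blk l (h :: rcons hs g) ++ y.
    apply: (@cfg_inj k l) => //; try by apply: canon_blk => //; exact: desc_up.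
    by move=> s; rewrite -bi1 -bb -i1E /bump bE.
  by rewrite !blk_cons => -[] /eqP; rewrite -subr_eq0; clear; lia.
have i0lt : i0 < i by move: ni i0i; clear; lia.
have sbi0 : sat k l b i0 /\ i0 != i - 1 /\ (i0 = i - 2 -> dP b i0 = l%:Z).
  have := conf_P cb i0; have := conf_S cb i0.
  move: si0; rewrite sE /sat cP cS; move: i0lt; clear; lia.
have [N HN] : exists N, forall s, s <= N -> occ b s = 0.
  have [N [c Hc]] := cfg_left k (graded_head g l0 gR).
  exists (Num.min (N - 1) (i - 1)) => s sN.
  have := occ_bump 1 b i s; rewrite (eq_occ bbR) /occ !Hc; [|move: sN; clear; lia..].
  by move: sN; clear; lia.
have [f [sf nf]] := firstsat_ex l0 HN (proj1 sbi0).
have fE : f = i0.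
  have fi0 : f <= i0 by rewrite leNgt; apply/negP => /nf; rewrite (proj1 sbi0).
  apply/eqP; rewrite eq_le fi0 leNgt; apply/negP => lt.
  have := ni0 f lt; rewrite sE /sat cP cS; move: sf sbi0; rewrite /sat.
  by move: lt i0lt; clear; lia.
have fb : firstsat k l b f by split.
have cbf := firstsat_conf l0 cb fb.
exists f; [by rewrite fE | split=> //; split=> //].
  split.
    have := conf_P cb i; have := conf_S cb i.
    have [_ [n1 P2]] := sbi0; rewrite -fE in n1 P2.
    have nchain : ~ (f = i - 2 /\ dS b i = (k + l)%N%:Z).
      move=> [f2 S2]; have Pf := P2 f2; rewrite f2 in Pf.
      have := @sat_chain k l b (i - 2) cb Pf; rewrite !idxE => /(_ S2).
      by apply/negP/(proj2 lb); clear; lia.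
    move: (proj1 lb) nchain; rewrite /sat dP_bump dS_bump; move: n1 i0lt; rewrite -fE.
    by clear; lia.
  move=> j ij; apply/(unsatP _ cbf); have /(unsatP _ cb) := proj2 lb j ij.
  by rewrite dP_bump dS_bump; move: ij i0lt; rewrite -fE; clear; lia.
move=> s; rewrite (cfg_perm k s (pY (g - 1))) -back0 fE.
by rewrite /bump -bbR /bump; clear; lia.
Qed.

End Double.

Section NoDouble.
Variables (k l : nat).
Hypothesis (l0k : (0 < l <= k)%N).
Local Notation desc := (sorted (fun a b : int => b <= a)).
Local Notation asc := (sorted (fun a b : int => a <= b)).

Let l0 : (0 < l)%N. Proof. by case/andP: l0k. Qed.
Let lk : (l <= k)%N. Proof. by case/andP: l0k. Qed.

Local Notation premove := (premove k l).

Lemma blk_rcons h hs a y :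
  perm_eq (blk l (h :: rcons hs a) ++ y) ((l, a) :: blk l (h :: hs) ++ y).
Proof.
rewrite -blk_cons; apply: blk_perm.
by rewrite -rcons_cons perm_rcons.
Qed.

Lemma premove_lowers b i h g hs y n : desc (h :: rcons hs g) -> canon l.-1 y ->
  premove b i (blk l (h :: rcons hs g) ++ y) ->
  exists c, premove c i (blk l (h :: rcons hs (g - n%:Z)) ++ y).
Proof.
elim: n b g => [|n IH] b g dh cy pb; first by exists b; rewrite subr0.
have [f _ [pb' _ _]] := premove_lower l0k dh cy pb.
have -> : g - n.+1%:Z = (g - 1) - n%:Z by lia.
apply: IH pb' => //.
by move: dh; rewrite /= !rcons_path => /andP[-> /= gl]; lia.
Qed.

(** Lowering one of the two particles, then comparing with the collection where
    both are lowered, identifies the function before the move with the phantom. *)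
Lemma no_double_base b i h y : canon l.-1 y -> ~ premove b i (blk l [:: h; h] ++ y).
Proof.
move=> cy pb; have gy := canon_graded cy.
have dh : desc (h :: rcons [::] h) by rewrite /= lexx.
have [f fi [[cb' lb' bb'] _ _]] := premove_lower l0k dh cy pb.
have dh1 : desc [:: h - 1; h - 1] by rewrite /= lexx.
have [i1 [li1 bi1]] := top_step l0k dh1 gy.
have [||_ e] := lastsat_inj l0 cb' _ lb' li1.
- exact/cfg_conf/graded_blk.
- by move=> s; rewrite bb' bi1 subrK.
apply: (@phantom_absurd k l y l0k gy (h - 1)); case: pb => cb lb bb.
apply: eq_conf cb => s; have := e s; have := bb s.
rewrite /phantom followerE !blk_cons !(cfg_cons, sh_cons) /= /bump.
by rewrite !subrK; move: fi; clear; lia.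
Qed.

(** Further particles of weight l are disposed of one by one: the hindmost one is
    lowered until its crossing index t is far to the left of the front; to the
    right of t it is invisible, so that it may be deleted. *)
Lemma no_double b i h hs y : desc (h :: h :: hs) -> canon l.-1 y ->
  ~ premove b i (blk l (h :: h :: hs) ++ y).
Proof.
elim/last_ind: hs b => [|hs g IH] b dh cy pb; first exact: (no_double_base cy pb).
have gy := canon_graded cy; set R := blk l (h :: h :: hs) ++ y.
have dR : desc (h :: h :: hs).
  by move: dh; rewrite /= !rcons_path => /and3P[-> -> _].
have gR : graded l R by apply: graded_blk.
have [J [lJ _]] := top_step l0k dR gy; rewrite -/R in lJ.
(* 20 exceeds all the widths of the local conditions used below. *)
pose M : int := J - 20; pose n : nat := (`|(g - M * l%:Z + cfg k (sh k l R) M)%R|%N.+1).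
have [c [cc lc bc]] := @premove_lowers b i h g (h :: hs) y n dh cy pb.
have [t ct] := cfg_cross (g - n%:Z) l0k gR.
have tM : t < M.
  by rewrite ltNge -ct; have := cfg_ge0 k R M; rewrite /n; lia.
have bR : bump 1 c i =1 cfg k ((l, g - n%:Z) :: R).
  by move=> s; rewrite bc; apply: cfg_perm; apply: (blk_rcons h (h :: hs)).
have high s : t + 1 <= s -> bump 1 c i s = cfg k R s.
  by move=> st; rewrite bR cfg_cons; have := ct s; lia.
have sJ : sat k l (bump 1 c i) J.
  by rewrite (sat_high k l high) ?(proj1 lJ) //; rewrite /M in tM; lia.
have Ji : J - 2 <= i.
  rewrite leNgt; apply/negP => iJ; have := proj2 lc J ltac:(lia).
  by move: sJ; rewrite /sat dP_bump dS_bump; lia.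
have it : t + 10 < i by move: tM Ji; rewrite /M; clear; lia.
pose d := bump (- 1) (cfg k R) i.
have dc s : t + 1 <= s -> d s = c s.
  by move=> /high; rewrite /d /bump; lia.
have cR := cfg_conf lk gR.
have cd : conf k l d.
  split=> m; have [mt|mt] := leP (t + 3) m.
  - by rewrite (occ_high dc) ?(conf_occ cc) //; lia.
  - by have := conf_occ cR m; rewrite occ_bump; move: mt it; clear; lia.
  - by rewrite (dP_high dc) ?(conf_P cc) //; lia.
  - by have := conf_P cR m; rewrite dP_bump; move: mt it; clear; lia.
  - by rewrite (dT_high dc) ?(conf_T cc) //; lia.
  - by have := conf_T cR m; rewrite dT_bump; move: mt it; clear; lia.
  - by rewrite (dS_high dc) ?(conf_S cc) //; lia.
  - by have := conf_S cR m; rewrite dS_bump; move: mt it; clear; lia.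
apply: (IH d dR cy); split=> //; last first.
  by move=> s; rewrite /d /bump -/R; lia.
split; first by rewrite (sat_high k l dc) ?(proj1 lc) //; lia.
move=> j ij; rewrite (sat_high k l dc); first exact: (proj2 lc).
by lia.
Qed.

(** Undoing a move stays in the image of the particle collections: the front
    particle is lowered by 1. *)
Lemma pullback b i x : canon l x -> premove b i x ->
  exists2 z, canon l z & b =1 cfg k z.
Proof.
move=> cx [cb lb bb]; have [hs [y [xE dh cy]]] := canonP l0 cx.
have gy := canon_graded cy.
have sx : sat k l (cfg k x) i by rewrite -(eq_saturated k l bb) sat_bump (proj1 lb).
case: hs xE dh => [|h hs] xE dh.
  by move: sx; rewrite xE (negPf (unsat_low _ l0k gy)).
have dh1 : desc (h - 1 :: hs).
  case: hs xE dh => [//|h' hs] xE dh; have [hE|hn] := eqVneq h' h.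
    by case: (@no_double b i h hs y); move: dh xE; rewrite hE => // _ <-.
  by case/andP: dh => hh ph; apply/andP; split=> //; lia.
have cz : canon l (blk l (h - 1 :: hs) ++ y) by apply: canon_blk.
have [i1 [li1 bi1]] := top_step l0k dh1 gy.
exists (blk l (h - 1 :: hs) ++ y) => //.
have [||_ //] := lastsat_inj l0 cb _ lb li1.
- exact/cfg_conf/canon_graded.
- by move=> s; rewrite bb bi1 subrK -xE.
Qed.

End NoDouble.

(** * Surjectivity *)

Lemma occ0_right (e : int -> int) N M : (forall s, N <= s -> e s = 0) ->
  (forall s, M < s -> occ e s = 0) -> forall s, M <= s -> e s = 0.
Proof.
move=> eN e0 s Ms; have step (n : nat) t : N - n%:Z <= t -> M <= t -> e t = 0.
  elim: n t => [|n IH] t tn Mt; first by apply: eN; lia.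
  have [h|h] := leP (N - n%:Z) t; first exact: IH.
  have := e0 (t + 1) ltac:(lia); rewrite /occ !idxE.
  by rewrite (IH (t + 1)) ?(IH (t + 2)); lia.
by apply: (step `|(N - s)%R|%N); lia.
Qed.

(** No unit at the sites <= L, and at most n units in all. *)
Definition left_tail (e : int -> int) L (n : int) : Prop :=
  forall s, s <= L -> occ e s = 0 /\ e s - e (s + 1) <= n.

Lemma left_tail_slope (e : int -> int) L n : (forall i, 0 <= occ e i) ->
  left_tail e L n -> forall s, e s - e (s + 1) <= n.
Proof.
move=> eo eL s; have [sL|sL] := leP s L; first by case: (eL s sL).
have step (m : nat) : e (L + m%:Z) - e (L + m%:Z + 1) <= n.
  elim: m => [|m IH]; first by rewrite addr0; case: (eL L (lexx L)).
  have := eo (L + m%:Z + 1); rewrite /occ !idxE.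
  by rewrite (_ : L + m.+1%:Z = L + m%:Z + 1) ?idxE; lia.
by have := step `|(s - L)%R|%N; rewrite (_ : L + _ = s); lia.
Qed.

Lemma slope_bound (e : int -> int) n N : (forall s, e s - e (s + 1) <= n) ->
  (forall s, N <= s -> e s = 0) -> forall m : nat, e (N - m%:Z) <= n * m%:Z.
Proof.
move=> sl eN; elim=> [|m IH]; first by rewrite subr0 eN ?lexx ?mulr0.
have := sl (N - m.+1%:Z); rewrite (_ : N - m.+1%:Z + 1 = N - m%:Z); first by nia.
by lia.
Qed.

Section Far.
Variables (k l : nat) (f : int -> int) (N : int).
Hypothesis (l0k : (0 < l <= k)%N).
Hypothesis f0 : forall s, N - 2 <= s -> f s = 0.

Let l0 : (0 < l)%N. Proof. by case/andP: l0k. Qed.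
Let lk : (l <= k)%N. Proof. by case/andP: l0k. Qed.

(** The function f with one more particle of weight l to the right of its
    support, where the interaction is not felt. *)
Definition far (h : int) (s : int) : int := f s + Num.max 0 (h - s * l%:Z).

Lemma far_index h : exists i, forall s, (s * l%:Z <= h) = (s <= i).
Proof.
apply: (@int_threshold (fun s => s * l%:Z <= h) (- `|h|) (`|h| + 1)).
- by move=> s; lia.
- by nia.
- by nia.
Qed.

Lemma far_bump h i : (forall s, (s * l%:Z <= h) = (s <= i)) ->
  bump 1 (far h) i =1 far (h + 1).
Proof. by move=> hi s; rewrite /bump /far; have := hi s; lia. Qed.

Lemma far_lastsat h i : N * l%:Z <= h -> (forall s, (s * l%:Z <= h) = (s <= i)) ->
  lastsat k l (far h) i.
Proof.
move=> Nh hi; have Ni : N <= i by rewrite -hi.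
have high s : i < s -> far h s = 0.
  by move=> si; rewrite /far f0; [have := hi s; lia | lia].
have low s : s <= i -> i - 2 <= s -> far h s = h - s * l%:Z.
  by move=> si is2; rewrite /far f0; [have := hi s; lia | lia].
have h1 := hi (i + 1).
split.
  by rewrite /sat /dP (high (i + 1)) ?(high (i + 2)) ?low ?(low i); lia.
move=> j ij; rewrite /sat /dP /dS.
rewrite (high j) ?(high (j + 1)) ?(high (j + 2)) ?(high (j + 3)); try (move: ij; clear; lia).
have [j1|j1] := leP (i + 3) j; first by rewrite !high; lia.
have [->|j2] := eqVneq j (i + 1).
  by rewrite !idxE !low; lia.
have -> : j = i + 2 by move: ij j1 j2; clear; lia.
by rewrite !idxE (high (i + 1)) ?(low i); lia.
Qed.

Lemma far_conf h (n : nat) : N * l%:Z <= h -> conf k l (far h) -> conf k l (far (h + n%:Z)).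
Proof.
move=> Nh ch; elim: n => [|n IH]; first by rewrite addr0.
have [i hi] := far_index (h + n%:Z).
have li : lastsat k l (far (h + n%:Z)) i by apply: far_lastsat hi; lia.
rewrite (_ : h + n.+1%:Z = h + n%:Z + 1); last by lia.
exact: eq_conf (far_bump hi) (lastsat_conf l0 IH li).
Qed.

Lemma far_pullback h (n : nat) : N * l%:Z <= h -> conf k l (far h) ->
  (exists2 x, canon l x & far (h + n%:Z) =1 cfg k x) ->
  exists2 x, canon l x & far h =1 cfg k x.
Proof.
move=> Nh ch; elim: n => [|n IH]; first by rewrite addr0.
move=> [x cx ex]; apply: IH; have [i hi] := far_index (h + n%:Z).
apply: (@pullback k l l0k _ i x) => //; split; first exact: far_conf.
  by apply: far_lastsat hi; lia.
move=> s; rewrite (far_bump hi) -ex; congr (far _ _); lia.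
Qed.

(** For h large the separated function comes from v by undoing the interaction
    shift caused by the new front particle. *)
Lemma far_cfg v : canon l v -> f =1 cfg k v -> exists B, forall h, B <= h ->
  exists2 x, canon l x & far h =1 cfg k x.
Proof.
move=> cv fv; pose v' := [seq (p.1, p.2 + (A k l p.1)%:Z) | p <- v].
have shv : sh k l v' = v.
  by rewrite /sh -map_comp map_id_in // => -[w h] _ /=; congr pair; lia.
have cv' : canon l v' by rewrite -(canon_sh k l) shv.
have [N1 H1] := cfg_right k (canon_graded cv').
have [B HB] : exists B, all (fun p : nat * int => p.2 <= B) v'.
  elim: v' {shv cv' H1} => [|p v' [B HB]]; first by exists 0.
  exists (Num.max p.2 B); rewrite /= le_max lexx /=.
  by apply: sub_all HB => z /= zB; rewrite le_max zB orbT.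
exists (Num.max B (Num.max N N1 * l%:Z)) => h hB; exists ((l, h) :: v').
  case/andP: cv' => va vs; rewrite /canon /= l0 leqnn va /=.
  rewrite (path_sortedE ordrel_trans) vs andbT; apply/allP => p pv.
  have := allP HB p pv; have := allP va _ (map_f fst pv); rewrite /ordrel /=; lia.
have [i ci] := cfg_cross h l0k (canon_graded cv'); have [i0 hi0] := far_index h.
rewrite shv in ci; move=> s; rewrite cfg_cons shv /far -fv; have := hi0 s.
have [si|si] := leP s i0.
  have : Num.max N N1 <= i0 by rewrite -hi0; lia.
  move=> Ni0; have i0i : i0 <= i by rewrite -ci H1 -?fv ?f0 ?hi0; have := hi0 i0; lia.
  by have := ci s; rewrite -fv; lia.
have : Num.max N N1 <= i0 by rewrite -hi0; lia.
by move=> Ni0; rewrite H1 ?f0; lia.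
Qed.

End Far.

(** Saturation at the right end N means l units at N and none at N - 1; removing
    them leaves a function vanishing from N - 2 on. *)
Lemma peel k l (e : int -> int) N L n : (0 < l <= k)%N -> conf k l e ->
  (forall s, N <= s -> e s = 0) -> left_tail e L n -> sat k l e N ->
  let f := fun s => e s - Num.max 0 (N * l%:Z - s * l%:Z) in
  [/\ conf k l f, (forall s, N - 2 <= s -> f s = 0)
    & left_tail f (Num.min L (N - 2)) (n - l%:Z)].
Proof.
move=> /andP[l0 lk] ce eN eL sN f.
have dist s : Num.max 0 (N * l%:Z - s * l%:Z) = if s <= N then N * l%:Z - s * l%:Z else 0.
  by case: leP; nia.
have oN : occ e N = l%:Z /\ occ e (N - 1) = 0.
  have := conf_P ce (N - 1); have := conf_occ ce (N - 1); move: sN.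
  rewrite /sat !dP_occ !dS_occ !idxE.
  have z s : N < s -> occ e s = 0 by move=> Ns; rewrite /occ !eN; lia.
  by rewrite (z (N + 1)) ?(z (N + 2)); lia.
have of_ s : occ f s = occ e s - l%:Z * (s == N)%:Z.
  rewrite /occ /f !dist; case: (ltgtP s N) => sN'; rewrite ?mulr0 ?mulr1 ?subr0;
    by do 3?case: ifP; move: sN'; clear; nia.
have le_of s : occ f s <= occ e s by rewrite of_; lia.
have f0 s : N - 2 <= s -> f s = 0.
  move=> sN2; have [Ns|Ns] := leP N s; first by rewrite /f dist eN //; case: ifP => // sN1; rewrite (_ : s = N) ?subrr //; lia.
  move: oN; rewrite /occ !idxE (eN N) ?(eN (N + 1)); try lia.
  move=> [e1 e2]; have [->|s1] := eqVneq s (N - 1).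
    by rewrite /f dist; case: ifP; lia.
  by rewrite (_ : s = N - 2); [rewrite /f dist; case: ifP; lia | lia].
split=> //.
- split=> i.
  + by rewrite of_; have := conf_occ ce i; case: eqVneq => [->|]; lia.
  + have := conf_P ce i; rewrite !dP_occ.
    by have := le_of i; have := le_of (i + 1); lia.
  + have := conf_T ce i; rewrite !dT_occ.
    by have := le_of i; have := le_of (i + 1); have := le_of (i + 2); lia.
  + have := conf_S ce i; rewrite !dS_occ.
    by have := le_of i; have := le_of (i + 1); have := le_of (i + 2); have := le_of (i - 1); lia.
- move=> s sL; have [o0 sl] := eL s ltac:(lia).
  split; first by rewrite of_ o0; case: eqVneq => [sE|]; lia.
  by rewrite /f !dist; do ?case: ifP; lia.
Qed.

(** Induction on l, then on the number n of units, then on the number of moves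
    still possible within the support bound N.  Without saturation the bounds
    hold for l - 1.  If the last saturation lies before N, move and pull back.  If
    it lies at N, peel off a particle and bring it back from far away. *)
Theorem cfg_surj k l (e : int -> int) N L : (l <= k)%N -> conf k l e ->
  (forall s, N <= s -> e s = 0) -> (forall s, s <= L -> occ e s = 0) ->
  exists2 x, canon l x & e =1 cfg k x.
Proof.
elim: l e N L => [|l IHl] e N L lk ce eN eL.
  exists [::] => // s; apply: (@occ0_right e N s) => // {}s _.
  by have := conf_P ce s; have := conf_occ ce s; have := conf_occ ce (s + 1);
    rewrite dP_occ; lia.
have l0k : (0 < l.+1 <= k)%N by [].
have [n Hn] : exists n : nat, left_tail e L (n%:Z - 1).
  exists (`|(e L - e (L + 1))%R|%N.+1) => s sL; split; first exact: eL.
  have step (m : nat) : e (L - m%:Z) - e (L - m%:Z + 1) = e L - e (L + 1).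
    elim: m => [|m <-]; first by rewrite subr0.
    have := eL (L - m%:Z) ltac:(lia); rewrite /occ.
    by rewrite (_ : L - m.+1%:Z = L - m%:Z - 1) ?idxE; lia.
  by have := step `|(L - s)%R|%N; rewrite (_ : L - _ = s); lia.
elim: n e N L ce eN eL Hn => [|n IHn] e N L ce eN eL Hn.
  have := slope_bound (left_tail_slope (conf_occ ce) Hn) eN.
  move=> /(_ 1%N) eN1; have := slope_bound (left_tail_slope (conf_occ ce) Hn) eN.
  have := left_tail_slope (conf_occ ce) Hn N; rewrite !eN; lia.
wlog LN : L eL Hn / L <= N.
  move=> W; apply: (W (Num.min L N)); last by lia.
    by move=> s sL; apply: eL; lia.
  by move=> s sL; apply: Hn; lia.
have [m Hm] : exists m : nat, n%:Z * `|(N - L)%R|%N%:Z - e L < m%:Z.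
  by exists (`|(n%:Z * `|(N - L)%R|%N%:Z - e L)%R|%N.+1); lia.
elim: m e ce eN eL Hn Hm => [|m IHm] e ce eN eL Hn Hm.
  have := slope_bound (left_tail_slope (conf_occ ce) Hn) eN `|(N - L)%R|%N.
  by rewrite (_ : N - _ = L); lia.
have [[i si]|ns] := pselect (exists i, sat k l.+1 e i); last first.
  have ce' : conf k l e.
    have un i : dP e i < l.+1%:Z /\ dS e i < (k + l.+1)%N%:Z.
      by apply/(unsatP _ ce)/negP => si; apply: ns; exists i.
    by split=> i; [exact: conf_occ ce i | | exact: conf_T ce i |]; have := un i; lia.
  by have [x cx ex] := IHl e N L (ltnW lk) ce' eN eL; exists x => //; apply: canon_low.
have {i si} [i li] := lastsat_ex (ltn0Sn l) eN si.
have [iN|iN] := ltP i N.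
  (* The move raises e L by 1, and e L is bounded by n (N - L). *)
  pose e' := bump 1 e i; have ce' := lastsat_conf (ltn0Sn l) ce li.
  have iL : L < i.
    rewrite ltNge; apply/negP => iL.
    have := conf_occ ce' i; rewrite occ_bump eL //; lia.
  have [x cx ex] : exists2 x, canon l.+1 x & e' =1 cfg k x.
    apply: IHm => //.
    - by move=> s Ns; rewrite /e' /bump eN //; lia.
    - by move=> s sL; rewrite /e' occ_bump eL //; lia.
    - move=> s sL; have [o0 sl] := Hn s sL.
      by rewrite /e' occ_bump o0 /bump; lia.
    - by rewrite /e' /bump; lia.
  by apply: (@pullback k l.+1 l0k e i x).
have iE : i = N.
  apply/eqP; rewrite eq_le iN andbT leNgt; apply/negP => Ni.
  have := proj1 li; rewrite /sat /dP /dS !(eN i, eN (i + 1), eN (i + 2), eN (i + 3)); try lia.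
  have [i1|i1] := eqVneq i (N + 1); last by rewrite !eN; lia.
  have := conf_P ce N; rewrite /dP i1 !idxE !(eN N, eN (N + 1), eN (N + 2)); lia.
have [] := peel l0k ce eN Hn; first by rewrite -iE; apply: (proj1 li).
set f := (fun s => _) => cf f0 fL.
have ef : e =1 far l.+1 f (N * l.+1%:Z) by move=> s; rewrite /far /f subrK.
have [v cv fv] : exists2 x, canon l.+1 x & f =1 cfg k x.
  apply: (IHn f (N - 2) (Num.min L (N - 2))) => //.
    by move=> s sL; case: (fL s sL).
  by move=> s sL; case: (fL s sL); lia.
have [B HB] := far_cfg l0k f0 cv fv.
have [x cx ex] : exists2 x, canon l.+1 x & far l.+1 f (N * l.+1%:Z) =1 cfg k x.
  apply: (far_pullback (n := `|(B - N * l.+1%:Z)%R|%N) l0k f0) => //.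
    exact: eq_conf ce.
  by apply: HB; lia.
by exists x => // s; rewrite ef ex.
Qed.

(** * Reflection *)

Lemma tau_eq0 k u x : all (fun p : nat * int => p.2 <= u p.1) x -> tau k u x = 0.
Proof.
elim: x u => [//|[w h] x IH] u /= /andP[hu xu]; rewrite IH // IH; first by apply/max_idPl; lia.
by apply: sub_all xu => p /=; lia.
Qed.

Lemma tau_single k u p x : p \in x -> p.2 - u p.1 <= tau k u x.
Proof.
move=> px; rewrite (tau_perm k u (perm_to_rem px)).
case: p {px} => w h; move: (rem _ _) => y; rewrite tau_cons /=.
by have := tau_ge0 k (fun v => u v + (A k w v)%:Z) y; lia.
Qed.

(** When each particle contributes at most 2 w, a second particle is always
    repelled at least as much as it gains, since A_{w,w'} >= 2 w' for w' <= w;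
    one particle at most matters. *)
Lemma tau_crowd k u x (B : int) : sorted geq (map fst x) -> 0 <= B ->
  all (fun p : nat * int => (p.2 - u p.1 <= 2 * p.1%:Z) && (p.2 - u p.1 <= B)) x ->
  tau k u x <= B.
Proof.
move=> + B0; elim: x => [//|[w h] x IH] /= srt /andP[/andP[h2 hB] xB].
have {IH} h1 := IH (path_sorted srt) xB.
rewrite [X in _ + X]tau_eq0; first by lia.
have tr : transitive geq by move=> a b c ba ac; apply: leq_trans ac ba.
have := order_path_min tr srt; rewrite all_map => xw; apply/allP => p px.
have := allP xw p px; have := allP xB p px.
by rewrite /A /=; lia.
Qed.

(** The value of the full collection. *)
Fixpoint tot (k : nat) (u : nat -> int) (x : seq (nat * int)) : int :=
  if x is (w, h) :: x' then h - u w + tot k (fun v => u v + (A k w v)%:Z) x' else 0.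

Lemma eq_tot k u u' x : u =1 u' -> tot k u x = tot k u' x.
Proof.
elim: x u u' => [//|[w h] x IH] u u' uu /=; rewrite uu; congr (_ + _).
by apply: IH => v; rewrite uu.
Qed.

Lemma tot_shift k u (g : nat -> int) x :
  tot k (fun v => u v + g v) x = tot k u x - \sum_(p <- x) g p.1.
Proof.
elim: x u => [|[w h] x IH] u; first by rewrite big_nil subr0.
rewrite big_cons /= (@eq_tot k _ (fun v => u v + (A k w v)%:Z + g v)); last by move=> v; lia.
by rewrite IH; ring.
Qed.

Definition interaction k x (w : nat) : int := \sum_(p <- x) (A k w p.1)%:Z.

(** Complementing sub-collections: the value of J is the value of the full
    collection plus the value of the complement of J for reflected positions.
    The constant c is free, as only c - h matters, and this freedom allows the
    induction. *)
Lemma tau_reflect k u (c : nat -> int) x : tau k u x = tot k u x +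
  tau k (fun v => c v - interaction k x v + (A k v v)%:Z - u v) [seq (p.1, c p.1 - p.2) | p <- x].
Proof.
elim: x u => [|[w h] x IH] u //=; set y := [seq _ | p <- x].
have fE v : interaction k ((w, h) :: x) v = (A k w v)%:Z + interaction k x v.
  by rewrite /interaction big_cons AC.
rewrite (@eq_tau k (fun v => c v - interaction k ((w, h) :: x) v + _ - u v)
  (fun v => c v - interaction k x v + (A k v v)%:Z - (u v + (A k w v)%:Z))); last first.
  by move=> v; rewrite fE; lia.
rewrite (@eq_tau k (fun v => c v - interaction k ((w, h) :: x) v + _ - u v + _)
  (fun v => c v - interaction k x v + (A k v v)%:Z - u v)); last first.
  by move=> v; rewrite fE; lia.
have := IH u; have := IH (fun v => u v + (A k w v)%:Z); rewrite -/y fE.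
rewrite tot_shift (_ : \sum_(p <- x) _ = interaction k x w) //.
lia.
Qed.

(** The reflected position is the interaction with the other particles minus h. *)
Definition refl k x : seq (nat * int) :=
  [seq (p.1, interaction k x p.1 - (A k p.1 p.1)%:Z - p.2) | p <- x].

Definition energy k x : int := tot k (fun=> 0) x.

Lemma cfg_reflect k x s :
  cfg k x s = energy k x - s * (\sum_(p <- x) p.1)%N%:Z + cfg k (refl k x) (- s).
Proof.
rewrite /cfg (tau_reflect k _ (fun w => interaction k x w - (A k w w)%:Z)); congr (_ + _).
  rewrite /energy (@eq_tot k _ (fun w => 0 + s * w%:Z)); last by move=> w; lia.
  by rewrite tot_shift -mulr_sumr (big_morph _ PoszD (erefl 0%:Z)).
by apply: eq_tau => w; lia.
Qed.

(** * Boundary conditions and energy *)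

Lemma refl_fst k x : map fst (refl k x) = map fst x.
Proof. by rewrite /refl -map_comp. Qed.

Lemma graded_refl k l x : graded l (refl k x) = graded l x.
Proof. by rewrite /graded refl_fst. Qed.

Lemma occ_reflect k x i : occ (cfg k x) i = occ (cfg k (refl k x)) (- i).
Proof.
have e1 : - (i - 1) = - i + 1 by clear; lia.
have e2 : - (i + 1) = - i - 1 by clear; lia.
rewrite /occ (cfg_reflect k x i) (cfg_reflect k x (i - 1)) (cfg_reflect k x (i + 1)) e1 e2.
by move: (\sum_(p <- x) p.1)%N => n; move: (cfg k _ _) (cfg k _ _) (cfg k _ _) (energy k x); clear; lia.
Qed.

Lemma right_box k l x N : graded l x ->
  (forall s, N < s -> occ (cfg k x) s = 0) <-> all (fun p => p.2 <= N * p.1%:Z) x.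
Proof.
move=> gx; split=> [H|xN s Ns].
  have [N1 H1] := cfg_right k gx.
  have := occ0_right H1 H (lexx N); rewrite /cfg => z.
  by apply/allP => p /(tau_single k (fun w => N * w%:Z)); rewrite z; lia.
have z t : N <= t -> cfg k x t = 0.
  by move=> Nt; apply: tau_eq0; apply: sub_all xN => p /=; nia.
by rewrite /occ !z; lia.
Qed.

Lemma occ_at0 (e : int -> int) : (forall s, 0 <= s -> e s = 0) -> occ e 0 = e (- 1).
Proof. by move=> z; rewrite /occ !add0r (z 0) ?(z 1) //; lia. Qed.

Lemma occ_atN1 (e : int -> int) : (forall s, 0 <= s -> e s = 0) ->
  occ e (- 1) = e (- 2) - 2 * e (- 1).
Proof.
move=> z; rewrite /occ (_ : - 1 - 1 = - 2 :> int) //.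
by rewrite (_ : - 1 + 1 = 0 :> int) // (z 0) // addr0.
Qed.

(** By reflection the three conditions bound the values at 0, -1 and -2 of a
    function vanishing on [0, +oo).  Single particles give necessary conditions,
    and [tau_crowd] shows that they suffice. *)
Lemma left_box k l x (a b : int) : graded l x -> 0 <= a -> 0 <= b ->
  [/\ forall s, s < 0 -> occ (cfg k x) s = 0, occ (cfg k x) 0 <= a
    & 2 * occ (cfg k x) 0 + occ (cfg k x) 1 <= 2 * a + b] <->
  all (fun p => [&& p.2 <= 0, p.2 + p.1%:Z <= a & p.2 + 2 * p.1%:Z <= 2 * a + b])
    (refl k x).
Proof.
move=> gx a0 b0; have gr : graded l (refl k x) by rewrite graded_refl.
set y := refl k x in gr *; have oE i : occ (cfg k x) i = occ (cfg k y) (- i).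
  exact: occ_reflect.
split=> [[z0 za zb]|H].
  have [N1 H1] := cfg_right k gr.
  have z : forall s, 0 <= s -> cfg k y s = 0.
    by apply: occ0_right H1 _ => s s0; have := z0 (- s) ltac:(lia); rewrite oE opprK.
  rewrite !oE oppr0 (occ_at0 z) (occ_atN1 z) in za zb.
  apply/allP => p py.
  have := tau_single k (fun w => (- 1) * w%:Z) py.
  have := tau_single k (fun w => (- 2) * w%:Z) py.
  have := tau_single k (fun w => 0 * w%:Z) py.
  rewrite -!/(cfg k y _) (z 0) //; move: za zb.
  move: (cfg k y (- 1)) (cfg k y (- 2)); clear; lia.
have z s : 0 <= s -> cfg k y s = 0.
  move=> s0; apply: tau_eq0; apply: sub_all H => p /and3P[p0 _ _].
  by nia.
have sy : sorted geq (map fst y) by case/andP: gr.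
have y1 : cfg k y (- 1) <= a.
  apply: tau_crowd => //; apply: sub_all H => p; lia.
have y2 : cfg k y (- 2) <= 2 * a + b.
  apply: tau_crowd => //; first by lia.
  apply: sub_all H => p; lia.
split.
- move=> s s0; rewrite oE; rewrite /occ !z; lia.
- by rewrite oE oppr0 (occ_at0 z).
- by rewrite !oE oppr0 (occ_at0 z) (occ_atN1 z); move: y1 y2; clear; lia.
Qed.

Lemma energy_left k l x : graded l x -> all (fun p => p.2 <= 0) (refl k x) ->
  cfg k x 0 = energy k x.
Proof.
by move=> gx H; rewrite cfg_reflect mul0r subr0 [X in _ + X]tau_eq0 ?addr0.
Qed.

Lemma occ_hinge (n : nat) i :
  occ (fun s => Num.max 0 (n%:Z - s)) i = (i == n%:Z)%:Z.
Proof. by rewrite /occ; lia. Qed.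

(** The convex function with second difference c. *)
Definition pot (N : nat) (c : int -> nat) (s : int) : int :=
  \sum_(n < N.+1) Num.max 0 (n%:Z - s) * (c n%:Z)%:Z.

Lemma occ_pot (N : nat) (c : int -> nat) i : (forall j, (j < 0) || (N%:Z < j) -> c j = 0%N) ->
  occ (pot N c) i = (c i)%:Z.
Proof.
move=> c0; rewrite /occ /pot mulr_sumr -sumrB -big_split /=.
under eq_bigr => n _ do rewrite mulrA -mulrBl -mulrDl -/(occ (fun s => Num.max 0 (n%:Z - s)) i) occ_hinge.
case: (boolP ((i < 0) || (N%:Z < i))) => iN.
  rewrite c0 // big1 // => n _; case: eqVneq => [iE|]; last by rewrite mul0r.
  by have := ltn_ord n; lia.
have nN : (`|i| < N.+1)%N by lia.
rewrite (bigD1 (Ordinal nN)) //= big1 ?addr0.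
  by rewrite (_ : (`|i|%N : int) = i) ?eqxx ?mul1r //; lia.
move=> n; rewrite -val_eqE /= => nE; rewrite (_ : (i == n%:Z) = false) ?mul0r //; lia.
Qed.

Lemma pot_right (N : nat) (c : int -> nat) s : N%:Z <= s -> pot N c s = 0.
Proof.
move=> Ns; rewrite /pot big1 // => n _; have nN := ltn_ord n.
by rewrite (_ : Num.max 0 _ = 0) ?mul0r //; lia.
Qed.

End Particles.

(** * Gaussian binomials and partitions in a box *)

Lemma q_unit : q != 0.
Proof. by rewrite /q tofrac_eq0 polyX_eq0. Qed.

Lemma q_not_root (i : nat) : (0 < i)%N -> 1 - q ^ i%:Z != 0.
Proof.
move=> i0; rewrite subr_eq0 /q -exprnP -tofracXn -tofrac1 tofrac_eq.
apply/eqP => /(congr1 (fun p : {poly int} => size p)).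
by rewrite size_poly1 size_polyXn => -[]; case: i i0.
Qed.

Lemma qD (m n : int) : q ^ (m + n) = q ^ m * q ^ n.
Proof. exact/expfzDr/q_unit. Qed.

Lemma qbinomE (m L : nat) : qbinom (L%:Z + m%:Z) m =
  \prod_(1 <= i < m.+1) ((1 - q ^ (L + i)%N%:Z) / (1 - q ^ i%:Z)).
Proof.
rewrite /qbinom ifT; last by lia.
by apply: eq_bigr => i _; rewrite addrK.
Qed.

Lemma qbinom_neg (m : nat) (L : int) : L < 0 -> qbinom (L + m%:Z) m = 0.
Proof. by move=> L0; rewrite /qbinom ifF //; lia. Qed.

Lemma qbinom_box0 (m : nat) : qbinom (0%:Z + m%:Z) m = 1.
Proof.
rewrite qbinomE big_seq big1 // => i; rewrite mem_index_iota => /andP[i1 _].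
by rewrite add0n divff // q_not_root.
Qed.

Lemma qbinomS (m L : nat) :
  qbinom (L%:Z + m.+1%:Z) m.+1 =
  qbinom (L.+1%:Z + m%:Z) m * ((1 - q ^ L.+1%:Z) / (1 - q ^ m.+1%:Z)).
Proof.
rewrite !qbinomE !prodf_div mulf_div; congr (_ / _); last by rewrite big_nat_recr.
rewrite big_nat_recl // addn1 mulrC; congr (_ * _).
by rewrite [RHS]big_nat [LHS]big_nat; apply: eq_bigr => i _; rewrite addnS addSn.
Qed.

Lemma pascal_ratio (F : fieldType) (u v w : F) : 1 - w != 0 ->
  u * ((1 - v * w) / (1 - w)) = u * ((1 - v) / (1 - w)) + v * u.
Proof. by move=> nz; field. Qed.

Lemma qbinom_pascal (m L : nat) :
  qbinom (L.+1%:Z + m.+1%:Z) m.+1 =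
  qbinom (L%:Z + m.+1%:Z) m.+1 + q ^ L.+1%:Z * qbinom (L.+1%:Z + m%:Z) m.
Proof.
have E : qbinom (L.+1%:Z + m.+1%:Z) m.+1 = qbinom (L.+1%:Z + m%:Z) m
    * ((1 - q ^ (L.+1 + m.+1)%N%:Z) / (1 - q ^ m.+1%:Z)).
  by rewrite !qbinomE [LHS]big_nat_recr.
have nz := q_not_root (ltn0Sn m).
by rewrite E qbinomS PoszD qD; apply: pascal_ratio.
Qed.

(** The partitions with at most m parts, all at most L, padded with zeros. *)
Fixpoint boxed (m L : nat) : seq (seq nat) :=
  if m is m'.+1 then [seq h :: s | h <- iota 0 L.+1, s <- boxed m' h] else [:: [::]].

Lemma mem_boxed m L (s : seq nat) :
  (s \in boxed m L) = (size s == m) && path geq L s.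
Proof.
elim: m L s => [|m IH] L s; first by case: s.
apply/allpairsPdep/idP => [[h [t [hL tm ->]]]|].
  move: hL tm; rewrite IH mem_iota /= eqSS add0n ltnS => hL /andP[-> ->].
  by rewrite hL.
case: s => [//|h t] /=; rewrite eqSS => /and3P[st hL pt].
exists h, t; split; rewrite ?IH ?st //.
by rewrite -[_ :: _]/(iota 0 L.+1) mem_iota add0n ltnS.
Qed.

Lemma uniq_boxed m L : uniq (boxed m L).
Proof.
elim: m L => [//|m IH] L; apply: allpairs_uniq_dep; first exact: iota_uniq.
  by move=> h _; apply: IH.
by move=> [h s] [h' s'] _ _ [/= -> ->].
Qed.

(** Splitting off the largest part h leaves a partition in the box of height h;
    summing over h telescopes by the Pascal rule. *)
Lemma sum_boxed m L :
  \sum_(s <- boxed m L) q ^ (sumn s)%:Z = qbinom (L%:Z + m%:Z) m.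
Proof.
elim: m L => [|m IH] L.
  by rewrite big_seq1 expr0z /qbinom big_geq // ifT //; lia.
have tele M : \sum_(h <- iota 0 M.+1) q ^ h%:Z * qbinom (h%:Z + m%:Z) m =
    qbinom (M%:Z + m.+1%:Z) m.+1.
  elim: M => [|M IHM]; first by rewrite big_seq1 expr0z mul1r !qbinom_box0.
  by rewrite -[in iota _ _]addn1 iotaD big_cat IHM add0n big_seq1 qbinom_pascal.
rewrite -tele big_allpairs_dep; apply: eq_bigr => h _.
rewrite -IH mulr_sumr; apply: eq_bigr => s _.
by rewrite /= PoszD qD.
Qed.

(** * Collections with prescribed weights and bounded positions *)

Implicit Types (lo hi : int).
Local Notation desc := (sorted (fun a b : int => b <= a)).

Definition staircases (m : nat) lo hi : seq (seq int) :=
  if lo <= hi then [seq [seq lo + t%:Z | t <- s] | s <- boxed m `|(hi - lo)%R|%N]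
  else if m == 0%N then [:: [::]] else [::].

Lemma mem_staircases m lo hi hs : (hs \in staircases m lo hi) =
  [&& size hs == m, desc hs & all (fun h => lo <= h <= hi) hs].
Proof.
have trg : transitive geq by move=> a b c ba ac; apply: leq_trans ac ba.
rewrite /staircases; case: leP => [lh|hl]; last first.
  case: m => [|m]; first by case: hs.
  case: hs => [|h hs] //=; rewrite in_nil; apply/esym/negbTE.
  by rewrite !negb_and; apply/orP; right; apply/orP; right; lia.
apply/mapP/and3P => [[s sb ->]|[/eqP sz dh ah]].
  move: sb; rewrite mem_boxed (path_sortedE trg) => /and3P[/eqP sz sl ss].
  split; first by rewrite size_map sz.
  - by rewrite sorted_map; apply: sub_sorted ss => a b /=; lia.
  - by rewrite all_map; apply: sub_all sl => a /=; lia.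
exists [seq `|(h - lo)%R|%N | h <- hs].
  rewrite mem_boxed size_map sz eqxx (path_sortedE trg) /=; apply/andP; split.
    by rewrite all_map; apply: sub_all ah => h /=; lia.
  rewrite sorted_map.
  apply: (sub_in_sorted (P := fun h => lo <= h <= hi) _ ah dh).
  by move=> a b; rewrite /in_mem /=; lia.
by rewrite -map_comp map_id_in // => h /(allP ah) /=; lia.
Qed.

Lemma uniq_staircases m lo hi : uniq (staircases m lo hi).
Proof.
rewrite /staircases; case: ifP => _; last by case: ifP.
rewrite map_inj_uniq ?uniq_boxed //; apply: inj_map => a b; lia.
Qed.

Lemma sum_staircases m lo hi :
  \sum_(hs <- staircases m lo hi) q ^ (\sum_(h <- hs) h) =
  q ^ (m%:Z * lo) * (if m == 0%N then 1 else qbinom (hi - lo + m%:Z) m).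
Proof.
rewrite /staircases; case: leP => [lh|hl]; last first.
  case: m => [|m] /=; first by rewrite big_seq1 big_nil mul0r !expr0z mulr1.
  by rewrite big_nil qbinom_neg ?mulr0 //; lia.
have -> : (if m == 0%N then 1 else qbinom (hi - lo + m%:Z) m) =
    qbinom (`|(hi - lo)%R|%N%:Z + m%:Z) m.
  case: m => [|m] /=; last by congr qbinom; lia.
  by rewrite /qbinom big_geq // ifT //; lia.
rewrite -sum_boxed mulr_sumr big_map [LHS]big_seq [RHS]big_seq.
apply: eq_bigr => s; rewrite mem_boxed => /andP[/eqP <- _].
rewrite -qD big_map; congr (q ^ _).
elim: s => [|t s IH]; first by rewrite big_nil mul0r.
by rewrite big_cons IH /=; lia.
Qed.

Section Family.
Variables (lo hi : nat -> int) (cnt : nat -> nat).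

Fixpoint family (l : nat) : seq (seq (nat * int)) :=
  if l is l'.+1 then
    [seq blk l hs ++ y | hs <- staircases (cnt l) (lo l) (hi l), y <- family l']
  else [:: [::]].

Definition weight_count (x : seq (nat * int)) (w : nat) : nat := count (fun p => p.1 == w) x.

Lemma weight_count_blk l hs y w :
  weight_count (blk l hs ++ y) w = ((l == w) * size hs + weight_count y w)%N.
Proof.
rewrite /weight_count count_cat; congr addn.
by elim: hs => [|h hs IH] /=; rewrite ?muln0 // IH mulnS.
Qed.

Lemma weight_count_out l x w : canon l x -> (l < w)%N -> weight_count x w = 0%N.
Proof.
case/andP=> xa _ lw; apply/eqP; rewrite -leqn0 leqNgt -has_count; apply/negP.
case/hasP => p px /eqP pw; have := allP xa _ (map_f fst px); rewrite pw; lia.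
Qed.

Definition inbox (x : seq (nat * int)) : bool :=
  all (fun p : nat * int => lo p.1 <= p.2 <= hi p.1) x.

Lemma familyP l x : reflect
  [/\ canon l x, inbox x & forall w, (0 < w <= l)%N -> weight_count x w = cnt w]
  (x \in family l).
Proof.
elim: l x => [|l IH] x.
  rewrite /= inE; apply: (iffP eqP) => [->|[+ _ _]].
    by split=> // w; lia.
  by case: x => [//|[w h] x] /andP[/= /andP[]]; lia.
apply: (iffP allpairsP) => [[[hs y] /= [+ /IH[cy iy ny] ->]]|[cx ix nx]].
  rewrite mem_staircases => /and3P[/eqP sz dh ah]; split.
  - exact: canon_blk.
  - by rewrite /inbox all_cat [X in _ && X]iy all_map andbT.
  - move=> w wl; rewrite weight_count_blk sz; case: eqVneq => [<-|lw].
      by rewrite (weight_count_out cy) // mul1n addn0.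
    by rewrite mul0n ny //; lia.
have [hs [y [xE dh cy]]] := canonP (ltn0Sn l) cx.
move: ix; rewrite /inbox xE all_cat all_map => /andP[ah iy].
exists (hs, y); split=> //=.
  rewrite mem_staircases dh [X in _ && X]ah !andbT.
  rewrite -nx ?leqnn // xE weight_count_blk eqxx mul1n.
  by rewrite (weight_count_out cy) // addn0.
apply/IH; split=> // w wl; rewrite -nx; last by lia.
by rewrite xE weight_count_blk (_ : (_ == _) = false) //; lia.
Qed.

Lemma uniq_family l : uniq (family l).
Proof.
elim: l => [//|l IH]; apply: allpairs_uniq => //; first exact: uniq_staircases.
move=> [hs y] [hs' y']; move=> /allpairsP[[? ?] /= [+ _ [-> ->]]] /allpairsP[[? ?] /= [+ _ [-> ->]]].
rewrite !mem_staircases => /andP[/eqP sz _] /andP[/eqP sz' _].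
move/eqP; rewrite eqseq_cat ?size_map ?sz' // => /andP[/eqP e /eqP ->].
by congr pair; apply: inj_map e => a b [].
Qed.

Lemma sum_family l : \sum_(x <- family l) q ^ (\sum_(p <- x) p.2) =
  \prod_(1 <= w < l.+1) (q ^ ((cnt w)%:Z * lo w)
     * (if cnt w == 0%N then 1 else qbinom (hi w - lo w + (cnt w)%:Z) (cnt w))).
Proof.
elim: l => [|l IH]; first by rewrite big_seq1 big_nil expr0z big_geq.
rewrite big_nat_recr //= -IH -sum_staircases mulrC big_distrl big_allpairs_dep /=.
apply: eq_bigr => hs _; rewrite mulr_sumr; apply: eq_bigr => y _.
by rewrite big_cat qD big_map.
Qed.

End Family.

(** * The terms of chi as sums over particles *)

Section Sums.
Implicit Types (x : seq (nat * int)).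

Lemma rE k a b w : (a + b <= k)%N -> (0 < w <= k)%N ->
  (r k a b w)%:Z = Num.max 0 (Num.max (w%:Z - a%:Z) (2 * w%:Z - (2 * a%:Z + b%:Z))).
Proof.
move=> abk /andP[w0 wk]; rewrite /r /rseq nth_cat size_nseq.
case: ltnP => wa; first by rewrite nth_nseq wa; lia.
rewrite nth_cat size_iota; case: ltnP => wb; first by rewrite nth_iota //; lia.
by rewrite (nth_map 0%N) ?size_iota ?nth_iota; lia.
Qed.

Lemma interaction_cons k w h x v :
  interaction k ((w, h) :: x) v = (A k v w)%:Z + interaction k x v.
Proof. by rewrite /interaction big_cons. Qed.

(** On the right every pair interaction is counted twice, once from each side. *)
Lemma energy_pairs k x : 2 * (\sum_(p <- x) p.2 - energy k x) =
  \sum_(p <- x) interaction k x p.1 - \sum_(p <- x) (A k p.1 p.1)%:Z.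
Proof.
elim: x => [|[w h] x IH]; first by rewrite /energy /= !big_nil.
rewrite !big_cons /= {1}/energy /= (tot_shift k (fun=> 0) (fun v => (A k w v)%:Z)) -/(energy k x).
under [in RHS]eq_bigr => p _ do rewrite interaction_cons.
rewrite big_split /= interaction_cons.
have -> : \sum_(p <- x) (A k p.1 w)%:Z = interaction k x w.
  by apply: eq_bigr => p _; rewrite AC.
rewrite -/(interaction k x w); move: IH.
set S := \sum_(p <- x) p.2; set I := \sum_(p <- x) interaction k x p.1.
set D := \sum_(p <- x) (A k p.1 p.1)%:Z; move: S I D (energy k x) (interaction k x w) (A k w w)%:Z.
clear; move=> S I D e f a; lia.
Qed.

Section Counts.
Variables (k : nat).

Definition counts x : {ffun 'I_k -> nat} := [ffun i : 'I_k => weight_count x i.+1].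

Lemma sum_counts l x (f : nat -> int) : (l <= k)%N -> canon l x ->
  \sum_(p <- x) f p.1 = \sum_(i < k) (counts x i)%:Z * f i.+1.
Proof.
move=> lk /andP[xa _]; elim: x xa => [|[w h] x IH] /= xa.
  by rewrite big_nil big1 // => i _; rewrite ffunE mul0r.
case/andP: xa => /andP[w0 wl] xa; rewrite big_cons (IH xa).
have wk : (w.-1 < k)%N by lia.
rewrite (bigD1 (Ordinal wk)) //= [RHS](bigD1 (Ordinal wk)) //= !ffunE /weight_count /=.
rewrite prednK // eqxx addrA; congr (_ + _); first by lia.
apply: eq_bigr => i; rewrite -val_eqE /= => iw; rewrite !ffunE /weight_count /=.
by rewrite (_ : (w == i.+1) = false) //; lia.
Qed.

Lemma interaction_counts l x w : (l <= k)%N -> canon l x ->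
  interaction k x w = (\sum_(i < k) (A k w i.+1 * counts x i)%N)%:Z.
Proof.
move=> lk cx; rewrite /interaction (sum_counts (fun v => (A k w v)%:Z) lk cx).
by rewrite (big_morph _ PoszD (erefl 0%:Z)); apply: eq_bigr => i _; rewrite mulnC PoszM.
Qed.

Lemma energy_counts l x : (l <= k)%N -> canon l x ->
  energy k x = \sum_(p <- x) p.2 - Q (counts x).
Proof.
move=> lk cx; have := energy_pairs k x; have := Q_double (counts x).
rewrite (sum_counts _ lk cx) (sum_counts (fun v => (A k v v)%:Z) lk cx).
have -> : \sum_(i < k) (counts x i)%:Z * (A k i.+1 i.+1)%:Z =
    \sum_(i < k) (A k i.+1 i.+1 * counts x i)%N%:Z.
  by apply: eq_bigr => i _; rewrite mulrC PoszM.
have -> : \sum_(i < k) (counts x i)%:Z * interaction k x i.+1 =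
    \sum_(i < k) \sum_(j < k) (A k i.+1 j.+1 * counts x i * counts x j)%N%:Z.
  apply: eq_bigr => i _; rewrite (interaction_counts _ lk cx) (big_morph _ PoszD (erefl 0%:Z)).
  by rewrite mulr_sumr; apply: eq_bigr => j _; lia.
set S := \sum_i \sum_j _; set D := \sum_i _; set H := \sum_(p <- x) _.
by move: S D H => S D H; lia.
Qed.

Variables (N a b : nat).
Hypothesis abk : (a + b <= k)%N.

Definition mult (m : {ffun 'I_k -> nat}) (w : nat) : nat := oapp m 0%N (insub w.-1).

(** The lower bound for the positions of weight w: r_w plus the interaction with
    all particles but one of weight w. *)
Definition floor (m : {ffun 'I_k -> nat}) (w : nat) : int :=
  (\sum_(i < k) (A k w i.+1 * m i)%N)%:Z - (A k w w)%:Z + (r k a b w)%:Z.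

Definition ceiling (w : nat) : int := N%:Z * w%:Z.

Lemma multE m (i : 'I_k) : mult m i.+1 = m i.
Proof. by rewrite /mult /= valK. Qed.

Lemma mult_counts x w : (0 < w <= k)%N -> mult (counts x) w = weight_count x w.
Proof.
move=> /andP[w0 wk]; have w1k : (w.-1 < k)%N by lia.
by rewrite -{1}(prednK w0) -[w.-1]/(nat_of_ord (Ordinal w1k)) multE ffunE /= prednK.
Qed.

Lemma chi_top_box m (j : 'I_k) :
  chi_top N a b m j = ceiling j.+1 - floor m j.+1 + (mult m j.+1)%:Z.
Proof.
rewrite /chi_top /ceiling /floor multE (big_morph _ PoszD (erefl 0%:Z)).
by set S := \sum_i _; move: S => S; lia.
Qed.

(** For fixed numbers of particles the bounds are constants, so the sum over
    positions factorises into q-binomials.  The lowest positions account for the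
    exponent 2 Q + sum of r_i m_i, and the pair interactions for - Q. *)
Lemma chi_term_family l m : (l <= k)%N -> supp_le l m ->
  chi_term N a b m =
  \sum_(x <- family (floor m) ceiling (mult m) l) q ^ energy k x.
Proof.
move=> lk ml.
have mult0 w : (l < w <= k)%N -> mult m w = 0%N.
  move=> /andP[lw wk]; have w1k : (w.-1 < k)%N by lia.
  have := multE m (Ordinal w1k); rewrite /= prednK; last by lia.
  by move=> ->; apply: ml => /=; rewrite prednK //; lia.
have countsE x : x \in family (floor m) ceiling (mult m) l -> canon l x /\ counts x = m.
  move/familyP => [cx _ nx]; split=> //; apply/ffunP => i; rewrite ffunE -multE.
  have [il|il] := leqP i.+1 l; first by rewrite nx.
  by rewrite (weight_count_out cx) // mult0 // il ltn_ord.
have sE : \sum_(x <- family (floor m) ceiling (mult m) l) q ^ energy k x =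
    q ^ (- Q m) * \sum_(x <- family (floor m) ceiling (mult m) l) q ^ (\sum_(p <- x) p.2).
  rewrite mulr_sumr big_seq [RHS]big_seq; apply: eq_bigr => x /countsE[cx xm].
  by rewrite (energy_counts lk cx) xm addrC qD.
rewrite {}sE sum_family.
set F := (fun w => q ^ ((mult m w)%:Z * floor m w)
     * (if mult m w == 0%N then 1 else qbinom (ceiling w - floor m w + (mult m w)%:Z) (mult m w))).
have -> : \prod_(1 <= w < l.+1) F w = \prod_(1 <= w < k.+1) F w.
  rewrite [RHS](big_cat_nat (n := l.+1)) //=.
  rewrite [X in _ * X]big_nat [X in _ * X]big1 ?mulr1 // => w wlk.
  by rewrite /F mult0 //= mul0r expr0z mulr1.
rewrite big_add1 big_mkord big_split /= mulrA; congr (_ * _).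
  (* - Q + sum of m_i floor_i = Q + sum of r_i m_i, by definition of Q. *)
  rewrite -(big_morph _ qD (expr0z q)) -qD; congr (q ^ _).
  have := Q_double m.
  have -> : \sum_(i < k) \sum_(j < k) (A k i.+1 j.+1 * m i * m j)%N%:Z =
      \sum_(i < k) (m i)%:Z * (\sum_(j < k) (A k i.+1 j.+1 * m j)%N)%:Z.
    apply: eq_bigr => i _; rewrite (big_morph _ PoszD (erefl 0%:Z)) mulr_sumr.
    by apply: eq_bigr => j _; lia.
  have -> : \sum_(i < k) (mult m i.+1)%:Z * floor m i.+1 =
      \sum_(i < k) (m i)%:Z * (\sum_(j < k) (A k i.+1 j.+1 * m j)%N)%:Z
      - \sum_(i < k) (A k i.+1 i.+1 * m i)%N%:Z + (\sum_(i < k) r k a b i.+1 * m i)%N%:Z.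
    rewrite (big_morph _ PoszD (erefl 0%:Z)) -sumrB -big_split /=.
    apply: eq_bigr => i _; rewrite multE /floor.
    by set S := (\sum_j _)%N; move: S => S; rewrite !PoszM; ring.
  set S := \sum_i _ * _; set D := \sum_i _; set R := (\sum_i _)%N.
  by move: S D R => S D R; lia.
rewrite big_mkcond; apply: eq_bigr => i _.
by rewrite multE; case: eqVneq => //= _; rewrite chi_top_box multE.
Qed.

Definition fits l x : bool :=
  [&& canon l x, all (fun p : nat * int => p.2 <= N%:Z * p.1%:Z) x &
  all (fun p : nat * int => [&& p.2 <= 0, p.2 + p.1%:Z <= a%:Z
        & p.2 + 2 * p.1%:Z <= 2 * a%:Z + b%:Z]) (refl k x)].

Lemma fits_family l m x : (l <= k)%N -> supp_le l m ->
  (x \in family (floor m) ceiling (mult m) l) = fits l x && (counts x == m).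
Proof.
move=> lk ml.
have countsE : canon l x -> (forall w, (0 < w <= l)%N -> weight_count x w = mult m w) <->
    counts x = m.
  move=> cx; split=> [nx|<- w wl]; last by rewrite mult_counts //; lia.
  apply/ffunP => i; rewrite ffunE; have [il|il] := leqP i.+1 l.
    by rewrite nx // multE.
  by rewrite (weight_count_out cx) // ml.
have boxE : canon l x -> counts x = m -> inbox (floor m) ceiling x = fits l x.
  move=> cx xm; rewrite /fits cx /= /refl all_map -all_predI; apply: eq_in_all => p px.
  have wl : (0 < p.1 <= l)%N by case/andP: cx => xa _; apply: (allP xa); apply: map_f.
  have wk : (0 < p.1 <= k)%N by case/andP: wl => -> /leq_trans; apply.
  rewrite /= (interaction_counts _ lk cx) xm /floor rE // /ceiling.
  case: p {px wl wk} => w h /=; set S := (\sum_i _)%N; move: S => S; clear; lia.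
apply/familyP/andP => [[cx ix /(countsE cx) xm]|[fx /eqP xm]].
  by rewrite -(boxE cx xm) xm.
have cx : canon l x by case/andP: fx.
by split=> //; [rewrite boxE | apply/countsE].
Qed.

End Counts.

End Sums.

(** * The bijection and the generating functions *)

Section Bijection.
Implicit Types (x : seq (nat * int)) (c : int -> nat) (i j s : int).

Lemma occ_inj (e f : int -> int) N M : (forall s, N <= s -> e s = 0) ->
  (forall s, M <= s -> f s = 0) -> occ e =1 occ f -> e =1 f.
Proof.
move=> eN fM ef s; pose d t := e t - f t.
have dz t : Num.max N M <= t -> d t = 0 by move=> tz; rewrite /d eN ?fM; lia.
suff : d s = 0 by rewrite /d; lia.
apply: (occ0_right dz) (lexx s) => t _; have := ef t; rewrite /occ /d; lia.
Qed.

Definition states (k l N : nat) : set (int -> nat) :=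
  [set c | (forall i : int, (i < 0) || (N%:Z < i) -> c i = 0%N)
   /\ forall i : int,
      [/\ (c i + c (i + 1)%R + c (i + 2)%R <= k)%N,
          (c i + c (i + 1)%R <= l)%N
        & (c (i - 1)%R + 2 * c i + 2 * c (i + 1)%R + c (i + 2)%R <= k + l)%N] ].

Lemma states_finite k l N : finite_set (states k l N).
Proof.
apply: (@sub_finite_set _ _ (\bigcup_(a in `I_l.+1) \bigcup_(b in `I_l.+1)
    admissible k l a b N)); last first.
  apply: bigcup_finite; first exact: finite_II.
  move=> a _; apply: bigcup_finite; first exact: finite_II.
  by move=> b _; apply: admissible_finite.
move=> c [c0 cc]; have [_ + _] := cc 0; rewrite add0r => cl.
exists (c 0) => /=; first by rewrite ltnS (leq_trans _ cl) ?leq_addr.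
by exists (c 1) => //=; rewrite ltnS (leq_trans _ cl) ?leq_addl.
Qed.

Lemma weight_pot (N : nat) c : (forall i : int, (i < 0) || (N%:Z < i) -> c i = 0%N) ->
  weight c = pot N c 0.
Proof.
move=> c0; rewrite /weight (fsbigE [seq n%:Z | n <- iota 0 N.+1]).
- rewrite big_map /pot -(big_mkord xpredT (fun n => Num.max 0 (n%:Z - 0) * (c n%:Z)%:Z)).
  rewrite /index_iota subn0; under eq_bigl do rewrite in_setT.
  by apply: eq_bigr => n _; congr (_ * _); rewrite subr0; lia.
- by rewrite map_inj_uniq ?iota_uniq // => m n [].
- by [].
- move=> i _ iN; rewrite c0 ?mulr0 //; case: i iN => n // nN.
  by apply: contraNT nN => nN; apply/mapP; exists n => //; rewrite mem_iota; lia.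
Qed.

Section States.
Variables (k l N : nat).
Hypothesis (lk : (l <= k)%N).

Definition state x i : nat := `|occ (cfg k x) i|%N.

Lemma stateE x i : canon l x -> (state x i)%:Z = occ (cfg k x) i.
Proof.
by move=> cx; have := conf_occ (cfg_conf lk (canon_graded cx)) i; rewrite /state; lia.
Qed.

Lemma state_inj x y : canon l x -> canon l y -> state x = state y -> x = y.
Proof.
move=> cx cy xy; apply: (cfg_inj lk cx cy).
have [N1 H1] := cfg_right k (canon_graded cx).
have [N2 H2] := cfg_right k (canon_graded cy).
by apply: (occ_inj H1 H2) => s; rewrite -!stateE // xy.
Qed.

Section Corner.
Variables (a b : nat).

(** The condition at the left end of the support described by chi_{a,b}. *)
Definition corner c : bool := (c 0%R <= a)%N && (2 * c 0%R + c 1%R <= 2 * a + b)%N.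

Lemma fits_state x : fits k N a b l x ->
  [/\ states k l N (state x), corner (state x) & weight (state x) = energy k x].
Proof.
case/and3P=> cx xN xa; have gx := canon_graded cx.
have [zl ca cb] := proj2 (left_box k (a := a%:Z) (b := b%:Z) gx isT isT) xa.
have zr := proj2 (right_box k N%:Z gx) xN.
have c0 i : (i < 0) || (N%:Z < i) -> state x i = 0%N.
  by move=> /orP[/zl|/zr]; rewrite /state => ->.
split.
- split=> // i; have cc := cfg_conf lk gx.
  have := conf_P cc i; have := conf_T cc i; have := conf_S cc i.
  rewrite dP_occ dT_occ dS_occ -!stateE //; clear; lia.
- by apply/andP; rewrite -!stateE // in ca cb; move: ca cb; clear; lia.
- rewrite (weight_pot c0) -(energy_left gx); last first.
    by apply: sub_all xa => p /and3P[].
  have [N1 H1] := cfg_right k gx.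
  apply: (occ_inj (pot_right (state x)) H1) => s.
  by rewrite (occ_pot _ c0) stateE.
Qed.

Lemma state_fits c : states k l N c -> corner c ->
  exists2 x, fits k N a b l x & state x = c.
Proof.
move=> [c0 cc] /andP[ca cb]; have oc i := occ_pot i c0.
have cP : conf k l (pot N c).
  split=> i; rewrite ?dP_occ ?dT_occ ?dS_occ !oc; have [] := cc i; clear; lia.
have left0 s : s <= - 1 -> occ (pot N c) s = 0.
  by move=> s1; rewrite oc c0 //; lia.
have [x cx ex] := cfg_surj lk cP (@pot_right N c) left0.
have gx := canon_graded cx; have ox i : occ (cfg k x) i = (c i)%:Z.
  by rewrite -(eq_occ ex) oc.
exists x; last by apply/funext => i; rewrite /state ox.
apply/and3P; split=> //.
  by apply/(right_box k N%:Z gx) => s Ns; rewrite ox c0 // Ns orbT.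
apply/(left_box k (a := a%:Z) (b := b%:Z) gx isT isT).
split; [by move=> s s0; rewrite ox c0 // s0 | by rewrite ox; apply: ca | by rewrite !ox; apply: cb].
Qed.

Hypothesis abk : (a + b <= k)%N.

Lemma chi_fits (X : seq (seq (nat * int))) : uniq X ->
  (forall x, (x \in X) = fits k N a b l x) ->
  chi k l N a b = \sum_(x <- X) q ^ energy k x.
Proof.
move=> uX memX; pose M := undup [seq counts k x | x <- X].
have uM : uniq M by apply: undup_uniq.
have MP m : m \in M -> supp_le l m.
  rewrite mem_undup => /mapP[x]; rewrite memX => /and3P[cx _ _] -> i li.
  by rewrite ffunE (weight_count_out cx).
have inM x : fits k N a b l x -> counts k x \in M.
  by move=> fx; rewrite mem_undup map_f // memX.
rewrite /chi (fsbigE M) //.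
- transitivity (\sum_(m <- M) \sum_(x <- X | counts k x == m) q ^ energy k x).
    rewrite big_seq_cond [RHS]big_seq; apply: congr_big => // m.
      by apply/andP/idP => [[]//|mM]; split=> //; apply/mem_set/MP.
    move=> /andP[mM _]; rewrite (chi_term_family _ _ lk (MP _ mM)) // -[RHS]big_filter.
    apply/perm_big/uniq_perm; rewrite ?uniq_family ?filter_uniq // => x.
    by rewrite mem_filter memX (fits_family _ abk _ lk (MP _ mM)) andbC.
  rewrite (exchange_big_dep xpredT) //= big_seq [RHS]big_seq; apply: eq_bigr => x xX.
  have cM : counts k x \in M by apply: inM; rewrite -memX.
  rewrite big_mkcond (bigD1_seq (counts k x)) //= eqxx big1 ?addr0 // => m mx.
  by rewrite eq_sym (negPf mx).
- move=> m ml mM; rewrite (chi_term_family _ _ lk ml) // big_seq big1 // => x.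
  rewrite (fits_family _ abk _ lk ml) => /andP[fx /eqP xm].
  by move: mM; rewrite -xm inM.
Qed.

(** The particle collections satisfying the bounds of chi_{a,b} correspond one to
    one to the sequences c with this condition at the left end, and the energy of
    the collection is the weight of c. *)
Lemma chi_states (C : seq (int -> nat)) : uniq C ->
  (forall c, c \in C <-> states k l N c) ->
  chi k l N a b = \sum_(c <- C | corner c) q ^ weight c.
Proof.
move=> uC memC.
have [g gP] : exists g : (int -> nat) -> seq (nat * int), forall c,
    states k l N c -> corner c -> fits k N a b l (g c) /\ state (g c) = c.
  have : forall c, exists x, states k l N c -> corner c -> fits k N a b l x /\ state x = c.
    move=> c; have [[sc cc]|nc] := pselect (states k l N c /\ corner c).
      by have [x fx xc] := state_fits sc cc; exists x.
    by exists [::] => sc cc; case: nc.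
  by case/choice => g gP; exists g.
pose D := [seq c <- C | corner c].
have DP c : c \in D -> fits k N a b l (g c) /\ state (g c) = c.
  by rewrite mem_filter => /andP[cc /memC sc]; apply: gP.
rewrite (@chi_fits [seq g c | c <- D]).
- rewrite big_map -[RHS]big_filter -/D big_seq [RHS]big_seq; apply: eq_bigr => c /DP[fg gc].
  by have [_ _ <-] := fits_state fg; rewrite gc.
- rewrite map_inj_in_uniq ?filter_uniq // => c d /DP[_ gc] /DP[_ gd] e.
  by rewrite -gc -gd e.
- move=> x; apply/mapP/idP => [[c /DP[fg _] ->]//|fx].
  have [sx cx _] := fits_state fx; have xD : state x \in D.
    by rewrite mem_filter cx; apply/memC.
  exists (state x) => //; have [fg gx] := DP _ xD.
  by apply: state_inj; [case/andP: fx | case/andP: fg |].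
Qed.

End Corner.

(** The boundary conventions agree with the description: no sequence has
    c_0 <= -1, and for a + b = k + 1 the bound 2 c_0 + c_1 <= 2 a + b already
    follows with b - 1 in place of b from c_0 <= a and c_0 + c_1 <= k. *)
Lemma chi_ext_states (C : seq (int -> nat)) (a : int) b : uniq C ->
  (forall c, c \in C <-> states k l N c) -> - 1 <= a <= k%:Z -> a + b%:Z <= k.+1%:Z ->
  chi_ext k l N a b =
  \sum_(c <- C) q ^ weight c *+ (((c 0)%:Z <= a) && ((2 * c 0%R + c 1%R)%N%:Z <= 2 * a + b%:Z)).
Proof.
move=> uC memC a1k abk; case: a a1k abk => [a|a] /andP[a1 ak] abk /=; last first.
  by rewrite big1.
have cl c : c \in C -> (c 0%R + c 1%R <= l)%N.
  by move/memC => [_ /(_ 0)[_ + _]]; rewrite add0r.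
case: eqVneq => ab.
  rewrite (chi_states _ uC memC); last by lia.
  rewrite big_mkcond big_seq [RHS]big_seq; apply: eq_bigr => c /cl cc.
  rewrite (_ : (_ && _) = corner a (k - a) c); first by case: corner.
  by rewrite /corner; move: cc ab ak lk; clear; lia.
rewrite (chi_states _ uC memC); last by lia.
rewrite big_mkcond; apply: eq_bigr => c _.
rewrite (_ : (_ && _) = corner a b c); first by case: corner.
by rewrite /corner; clear; lia.
Qed.

End States.

End Bijection.

Lemma mulrn_inclusion_exclusion (R : comNzRingType) (v : R) (n0 n1 n2 n3 n4 : nat) :
  (n0 + n2 + n3 = n1 + n4)%N -> v *+ n0 = v *+ n1 - v *+ n2 - v *+ n3 + v *+ n4.
Proof.
move=> n01; transitivity (v *+ (n0 + n2 + n3) - v *+ n2 - v *+ n3).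
  by rewrite !mulrnDr; ring.
by rewrite n01 mulrnDr; ring.
Qed.

Theorem theorem4p7 (N k l a b : nat)
    (hl : (1 <= l)%N) (hlk : (l <= k)%N) (hab : (a + b <= l)%N) :
  \sum_(c \in admissible k l a b N) q ^ weight c =
  if (0 < b)%N then
    chi_ext k l N a%:Z b - chi_ext k l N (a%:Z - 1) (b + 2)
    - chi_ext k l N a%:Z (b - 1) + chi_ext k l N (a%:Z - 1) (b + 1)
  else
    chi_ext k l N a%:Z 0 - chi_ext k l N (a%:Z - 1) 2.
Proof.
have [C0 /seteqP[C0P PC0]] := (finite_seqP _).1 (states_finite k l N).
pose C := undup C0; have uC : uniq C by apply: undup_uniq.
have memC c : c \in C <-> states k l N c.
  by rewrite mem_undup; split=> [/PC0|/C0P].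
have ext a' b' := chi_ext_states (a := a') (b := b') hlk uC memC.
have -> : \sum_(c \in admissible k l a b N) q ^ weight c =
    \sum_(c <- C) q ^ weight c *+ ((c 0 == a) && (c 1 == b)).
  have -> : admissible k l a b N = [set` [seq c <- C | (c 0 == a) && (c 1 == b)]].
    apply/seteqP; split=> c /=; rewrite mem_filter.
      by move=> [c0 -> -> cc]; rewrite !eqxx; apply/memC.
    by case/andP=> /andP[/eqP ca /eqP cb] /memC[c0 cc]; split.
  rewrite -fsbig_seq ?filter_uniq // big_filter big_mkcond.
  by apply: eq_bigr => c _; case: ifP.
case: posnP => b0.
  rewrite !ext; try (move: hab hlk; clear; lia).
  rewrite -sumrB; apply: eq_bigr => c _; apply/eqP; rewrite eq_sym subr_eq -mulrnDr; apply/eqP.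
  by congr (_ *+ _); rewrite b0; clear; lia.
rewrite !ext; try (move: b0 hab hlk; clear; lia).
rewrite -!sumrB -big_split; apply: eq_bigr => c _ /=.
(* From c_0 <= a and 2 c_0 + c_1 <= 2 a + b, exclude c_0 <= a - 1 and exclude
   2 c_0 + c_1 <= 2 a + b - 1; what remains is c_0 = a and c_1 = b. *)
apply: mulrn_inclusion_exclusion; move: b0; clear; lia.
Qed.
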